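(* Let $1<p<\infty$ and let $f\in C(\mathbb{R}^N)$ satisfy $|f(\xi)|\le C_f(1+|\xi|^\beta)$ for all $\xi\in\mathbb{R}^N$, where $C_f>0$ and $1\le\beta<p$. Let $\Xi\subset\mathbb{R}^N\times\mathbb{R}$ be a bounded domain and let $u\in L^\infty(\Xi)$ be a lower semicontinuous weak supersolution to $\partial_t u-\Delta_p u=f(Du)$ in $\Xi$. Then $u$ is a viscosity supersolution to $\partial_t u-\Delta_p u=f(Du)$ in $\Xi$.
   Context: Points are $z=(x,t)\in\mathbb{R}^N\times\mathbb{R}$, $dz=dx\,dt$; $D$ and $D^2$ denote the gradient and Hessian in the space variable $x$. For a bounded domain $\Omega\subset\mathbb{R}^N$ and $t_1<t_2$, $\Omega_{t_1,t_2}:=\Omega\times(t_1,t_2)$. The parabolic Sobolev space $L^p(t_1,t_2;W^{1,p}(\Omega))$ consists of measurable $u:\Omega_{t_1,t_2}\to\mathbb{R}$ with $u(\cdot,t)\in W^{1,p}(\Omega)$ for a.e. $t$ and $\int_{\Omega_{t_1,t_2}}|u|^p+|Du|^p\,dz<\infty$. Weak supersolution: $u:\Xi\to\mathbb{R}$ is a weak supersolution to $\partial_tu-\Delta_pu=f(Du)$ in $\Xi$ if whenever $\Omega_{t_1,t_2}\Subset\Xi$ we have $u\in L^p(t_1,t_2;W^{1,p}(\Omega))$ and $$\int_\Xi -u\,\partial_t\varphi+|Du|^{p-2}Du\cdot D\varphi-\varphi f(Du)\,dz\ge0$$ for all non-negative $\varphi\in C_0^\infty(\Omega_{t_1,t_2})$.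 For $\varphi\in C^2$ with $D\varphi\ne0$ set $\Delta_p\varphi:=|D\varphi|^{p-2}\left(\Delta\varphi+\frac{p-2}{|D\varphi|^2}\langle D^2\varphi D\varphi,D\varphi\rangle\right)$. Viscosity supersolution: a lower semicontinuous and bounded function $u:\Xi\to\mathbb{R}$ is a viscosity supersolution in $\Xi$ if whenever $\varphi\in C^2(\Xi)$ and $(x_0,t_0)\in\Xi$ are such that $\varphi(x_0,t_0)=u(x_0,t_0)$, $\varphi(x,t)<u(x,t)$ for $(x,t)\ne(x_0,t_0)$, and $D\varphi(x,t)\neq0$ for $x\ne x_0$, then $$\limsup_{(x,t)\to(x_0,t_0),\;x\neq x_0}\big(\partial_t\varphi(x,t)-\Delta_p\varphi(x,t)-f(D\varphi(x,t))\big)\ge0.$$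
   Formalization: The function u is additionally assumed to equal its essential lower limit at every point of Ξ (the lower semicontinuous representative of its class); without this, lowering u at a single point gives a counterexample. *)

(* Defs.v *)
From HB Require Import structures.
From mathcomp Require Import all_boot all_order all_algebra.
From mathcomp Require Import all_classical all_reals all_analysis.

Set Implicit Arguments.
Unset Strict Implicit.
Unset Printing Implicit Defensive.

Import Order.TTheory GRing.Theory Num.Theory.
Import numFieldNormedType.Exports.

Local Open Scope classical_set_scope.
Local Open Scope ring_scope.

Definition rV_display : measure_display -> measure_display.
Proof. exact. Qed.

Section measurable_rV.
Context {d} {T : measurableType d} (n : nat).

Let coords : 'I_n -> 'rV[T]_n -> T := fun i v => v ord0 i.

Let rV_set0 : g_sigma_preimage coords set0.
Proof. exact: sigma_algebra0. Qed.

Let rV_setC A : g_sigma_preimage coords A -> g_sigma_preimage coords (~` A).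
Proof. exact: sigma_algebraC. Qed.

Let rV_bigcup (F : (set 'rV[T]_n)^nat) :
  (forall i, g_sigma_preimage coords (F i)) ->
  g_sigma_preimage coords (\bigcup_i (F i)).
Proof. exact: sigma_algebra_bigcup. Qed.

HB.instance Definition _ := @isMeasurable.Build (rV_display d)
  'rV[T]_n (g_sigma_preimage coords) rV_set0 rV_setC rV_bigcup.

End measurable_rV.

Lemma measurable_coord d (T : measurableType d) n (i : 'I_n) :
  measurable_fun [set: 'rV[T]_n] (fun v : 'rV[T]_n => v ord0 i).
Proof.
move=> _ Y mY; rewrite setTI; apply: sub_sigma_algebra => /=.
rewrite -bigcup_seq/=; exists i => /=; first by rewrite mem_index_enum.
by exists Y => //; rewrite setTI.
Qed.

Lemma measurable_fun_rVP d1 d2 (T1 : measurableType d1)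
    (T2 : measurableType d2) n (f : T1 -> 'rV[T2]_n) :
  measurable_fun [set: T1] f <->
  forall i, measurable_fun [set: T1] (fun x => f x ord0 i).
Proof.
split=> [mf i|mf].
  exact: (measurableT_comp (@measurable_coord _ _ _ i) mf).
move=> _ A mA; rewrite setTI.
have : preimage_set_system [set: T1] f
    (g_sigma_preimage (fun i (v : 'rV[T2]_n) => v ord0 i)) (f @^-1` A).
  by exists A => //; rewrite setTI.
rewrite -g_sigma_preimage_comp; apply: smallest_sub.
  exact: sigma_algebra_measurable.
case: n => [|n] in f mf A mA *; first by rewrite big_ord0.
rewrite -bigcup_mkord_ord; apply: bigcup_sub => i Ii.
by move=> B [C mC <-]; exact: mf.
Qed.

Section lebesgue_rV.
Context {R : realType}.

Definition rV_cons n (xv : R * 'rV[R]_n) : 'rV[R]_n.+1 :=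
  \row_i (if unlift ord0 i is Some j then xv.2 ord0 j else xv.1).

Lemma rV_cons0 n (xv : R * 'rV[R]_n) : rV_cons xv ord0 ord0 = xv.1.
Proof. by rewrite mxE unlift_none. Qed.

Lemma rV_consS n (xv : R * 'rV[R]_n) (i : 'I_n) :
  rV_cons xv ord0 (lift ord0 i) = xv.2 ord0 i.
Proof. by rewrite mxE liftK. Qed.

Lemma measurable_rV_cons n :
  measurable_fun [set: R * 'rV[R]_n] (@rV_cons n).
Proof.
apply/measurable_fun_rVP => i; case: (unliftP ord0 i) => [j ->|->].
  rewrite (_ : (fun _ => _) = (fun v : 'rV[R]_n => v ord0 j) \o snd).
    by apply: (measurableT_comp (@measurable_coord _ _ _ j)).
  by apply/funext => xv /=; rewrite rV_consS.
rewrite (_ : (fun _ => _) = fst); first exact: measurable_fst.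
by apply/funext => xv /=; rewrite rV_cons0.
Qed.

Section cons_measure.
Variables (n : nat) (mu : {sigma_finite_measure set 'rV[R]_n -> \bar R}).
Local Open Scope ereal_scope.

Definition cons_measure : set 'rV[R]_n.+1 -> \bar R :=
  pushforward (@lebesgue_measure R \x mu) (@rV_cons n).

Let cons_measure0 : cons_measure set0 = 0.
Proof. by rewrite /cons_measure /pushforward preimage_set0 measure0. Qed.

Let cons_measure_ge0 A : 0 <= cons_measure A.
Proof. by rewrite /cons_measure /pushforward measure_ge0. Qed.

Let cons_measure_sigma_additive : semi_sigma_additive cons_measure.
Proof.
move=> F mF tF mUF; rewrite /cons_measure /pushforward preimage_bigcup.
apply: measure_semi_sigma_additive.
- by move=> k; rewrite -[X in measurable X]setTI; exact: measurable_rV_cons.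
- apply/trivIsetP => /= i j _ _ ij; rewrite -preimage_setI.
  by move/trivIsetP : tF => /(_ _ _ _ _ ij) ->//; rewrite preimage_set0.
- rewrite -preimage_bigcup -[X in measurable X]setTI.
  exact: measurable_rV_cons.
Qed.

HB.instance Definition _ := isMeasure.Build _ _ _ cons_measure
  cons_measure0 cons_measure_ge0 cons_measure_sigma_additive.

Let cons_measure_sigma_finite : sigma_finite setT cons_measure.
Proof.
pose uncons (v : 'rV[R]_n.+1) : R * 'rV[R]_n :=
  (v ord0 ord0, \row_i v ord0 (lift ord0 i)).
have consK : cancel (@rV_cons n) uncons.
  move=> [x v]; rewrite /uncons rV_cons0; congr pair.
  by apply/rowP => i; rewrite mxE rV_consS.
have muncons : measurable_fun [set: 'rV[R]_n.+1] uncons.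
  apply/measurable_fun_pairP; split; first exact: measurable_coord.
  apply/measurable_fun_rVP => i /=.
  rewrite (_ : (fun _ => _) = fun v : 'rV[R]_n.+1 => v ord0 (lift ord0 i)).
    exact: measurable_coord.
  by apply/funext => v /=; rewrite mxE.
have /sigma_finiteP[F [TF ndF Foo]] := sigma_finiteT (@lebesgue_measure R).
have /sigma_finiteP[G [TG ndG Goo]] := sigma_finiteT mu.
exists (fun k => uncons @^-1` (F k `*` G k)).
  rewrite -preimage_bigcup -(preimage_setT uncons); congr (_ @^-1` _).
  apply/seteqP; split => [[x v] _|//].
  have : [set: R] x by []. rewrite TF => -[i _ Fix].
  have : [set: 'rV[R]_n] v by []. rewrite TG => -[j _ Gjv].
  exists (maxn i j) => //; split.
    by move: x Fix; exact/subsetPset/ndF/leq_maxl.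
  by move: v Gjv; exact/subsetPset/ndG/leq_maxr.
move=> k; have [mF Fk] := Foo k; have [mG Gk] := Goo k; split.
  by rewrite -[X in measurable X]setTI; apply: muncons => //; exact: measurableX.
rewrite /cons_measure /pushforward -comp_preimage.
rewrite (_ : uncons \o @rV_cons n = id); last by apply/funext => xv; exact: consK.
by rewrite preimage_id product_measure1E// lte_mul_pinfty// ge0_fin_numE.
Qed.

HB.instance Definition _ := Measure_isSigmaFinite.Build _ _ _ cons_measure
  cons_measure_sigma_finite.

End cons_measure.

Fixpoint lebesgue_rV n : {sigma_finite_measure set 'rV[R]_n -> \bar R} :=
  if n is m.+1 then cons_measure (lebesgue_rV m) else \d_(0 : 'rV[R]_0).

Lemma lebesgue_rV_box n (A : 'I_n -> set R) :
  (forall i, measurable (A i)) ->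
  (lebesgue_rV n [set v | forall i, A i (v ord0 i)] =
   \prod_(i < n) lebesgue_measure (A i))%E.
Proof.
elim: n => [|n IHn] in A * => mA /=.
  by rewrite big_ord0 diracE mem_set// => -[].
rewrite big_ord_recl -IHn//.
pose B := [set v : 'rV[R]_n | forall i, A (lift ord0 i) (v ord0 i)].
have mB : measurable B.
  rewrite (_ : B = \bigcap_(i in [set: 'I_n])
      ((fun v : 'rV[R]_n => v ord0 i) @^-1` A (lift ord0 i))).
    apply: fin_bigcap_measurable => // i _.
    by rewrite -[X in measurable X]setTI; exact: measurable_coord.
  by apply/seteqP; split => [v Bv i _|v Bv i]; [exact: Bv|exact: Bv].
rewrite -product_measure1E//; last exact: mA.
rewrite /cons_measure /pushforward.
congr ((lebesgue_measure \x lebesgue_rV n)%E _).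
apply/seteqP; split => [[x v] /= Av|[x v] [/= Ax Bv] i].
  split; first by have := Av ord0; rewrite rV_cons0.
  by move=> i; have := Av (lift ord0 i); rewrite rV_consS.
by case: (unliftP ord0 i) => [j ->|->]; rewrite ?rV_consS ?rV_cons0 //=; exact: Bv.
Qed.

End lebesgue_rV.

Section calculus.
Context {R : realType}.

(* The norm [`|v|] of ['rV[R]_N] is the sup norm; the Euclidean norm is needed
   for the p-Laplacian. *)
Definition edot N (v w : 'rV[R]_N) : R := \sum_(i < N) v ord0 i * w ord0 i.
Definition enorm N (v : 'rV[R]_N) : R := Num.sqrt (edot v v).

(* Meaningful for [U] open: derivatives are two-sided limits in [V]. In finite
   dimension this is equivalent to continuity on [U] of all partial derivatives
   of order at most [k]. *)
Fixpoint Ck (V : normedModType R) (k : nat) (U : set V) (phi : V -> R) : Prop :=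
  if k is k'.+1 then
    (forall z, U z -> differentiable phi z) /\
    (forall v, Ck k' U ('D_v phi))
  else forall z, U z -> {for z, continuous phi}.

Definition test_function (V : normedModType R) (U : set V) (phi : V -> R) :=
  (forall k, Ck k [set: V] phi) /\
  let supp := closure [set z | phi z != 0] in compact supp /\ supp `<=` U.

Definition bounded_domain (V : normedModType R) (U : set V) :=
  [/\ open U, connected U, U !=set0 & bounded_set U].

Variable N : nat.
Implicit Types (phi : 'rV[R]_N * R -> R) (z : 'rV[R]_N * R).

Definition dt phi z : R := 'D_((0 : 'rV[R]_N), (1 : R)) phi z.
Definition dx (i : 'I_N) phi z : R :=
  'D_((delta_mx ord0 i : 'rV[R]_N), (0 : R)) phi z.
Definition grad phi z : 'rV[R]_N := \row_i dx i phi z.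
Definition hess phi z : 'M[R]_N := \matrix_(i, j) dx i (dx j phi) z.

Definition p_laplace (p : R) phi z : R :=
  let g := grad phi z in
  enorm g `^ (p - 2) *
  (\tr (hess phi z) + (p - 2) / enorm g ^+ 2 * edot (g *m hess phi z) g).

End calculus.

Section supersolutions.
Context {R : realType} (N : nat).
Implicit Types (u : 'rV[R]_N * R -> R) (Omega : set 'rV[R]_N)
  (Xi : set ('rV[R]_N * R)).

(* [measurableTypeR R] and [R] have definitionally equal measurable sets. *)
Definition lebesgue_st :
    {measure set ('rV[R]_N * measurableTypeR R)%type -> \bar R} :=
  (lebesgue_rV N \x lebesgue_measure)%E.

Definition Linfty Xi u :=
  measurable_fun Xi u /\
  ('N[lebesgue_st]_+oo[(EFin \o u) \_ Xi] < +oo)%E.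

(* [w] belongs to W^{1,p}(Omega) and [g] is its weak gradient. *)
Definition sobolev (p : R) Omega (w : 'rV[R]_N -> R) (g : 'rV[R]_N -> 'rV[R]_N) :=
  [/\ measurable_fun Omega w,
      measurable_fun Omega g,
      (\int[lebesgue_rV N]_(x in Omega)
         (`|w x| `^ p + enorm (g x) `^ p)%:E < +oo)%E &
      forall psi i, test_function Omega psi ->
        \int[lebesgue_rV N]_(x in Omega)
          (w x * 'D_(delta_mx ord0 i : 'rV[R]_N) psi x) =
        - \int[lebesgue_rV N]_(x in Omega) (g x ord0 i * psi x)].

Definition cylinder Omega (t1 t2 : R) : set ('rV[R]_N * R) :=
  Omega `*` `]t1, t2[%classic.

(* [u] belongs to L^p(t1,t2;W^{1,p}(Omega)) and [Du] is its weak gradient in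
   the space variable. *)
Definition parabolic_sobolev (p : R) Omega (t1 t2 : R) u
    (Du : 'rV[R]_N * R -> 'rV[R]_N) :=
  let Q := cylinder Omega t1 t2 in
  [/\ measurable_fun Q u,
      measurable_fun Q Du,
      {ae (@lebesgue_measure R), forall t, t1 < t < t2 ->
        sobolev p Omega (fun x => u (x, t)) (fun x => Du (x, t))} &
      (\int[lebesgue_st]_(z in Q)
         (`|u z| `^ p + enorm (Du z) `^ p)%:E < +oo)%E].

(* For p < 2 the flux [|Du|^(p-2) Du] is 0 where [Du = 0], whatever the value
   of [0 `^ (p - 2)]. The gradient [Du] is only relevant on the cylinder: test
   functions and their derivatives vanish outside of it, hence so does the
   integrand. *)
Definition weak_supersolution (p : R) (f : 'rV[R]_N -> R) Xi u :=
  forall Omega t1 t2, bounded_domain Omega -> t1 < t2 ->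
  let Q := cylinder Omega t1 t2 in
  compact (closure Q) -> closure Q `<=` Xi ->
  exists2 Du, parabolic_sobolev p Omega t1 t2 u Du &
  forall phi, test_function Q phi -> (forall z, 0 <= phi z) ->
  (0 <= \int[lebesgue_st]_(z in Xi)
    (- u z * dt phi z
     + enorm (Du z) `^ (p - 2) * edot (Du z) (grad phi z)
     - phi z * f (Du z))%:E)%E.

(* Off [Xi] the topology of [subspace Xi] is discrete, so this only constrains
   the restriction of [u] to [Xi]. *)
Definition lsc_on Xi u :=
  lower_semicontinuous (EFin \o u : subspace Xi -> \bar R).

(* An element of L^oo is a class of functions modulo null sets, whereas semi-
   continuity and the viscosity notion depend on values at points. The lower
   semicontinuous representative is the one equal to its essential lower limit
   at every point. Without this normalization, lowering the value of a
   supersolution at a single point preserves lower semicontinuity and the weak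
   notion, but in general not the viscosity notion. *)
Definition ess_liminf u (z : 'rV[R]_N * R) : \bar R :=
  ereal_sup [set a | exists2 V, nbhs z V &
    {ae lebesgue_st, forall w, V w -> (a <= (u w)%:E)%E}].

Definition viscosity_supersolution (p : R) (f : 'rV[R]_N -> R) Xi u :=
  [/\ lsc_on Xi u,
      [bounded u z | z in Xi] &
      forall phi x0 t0, Ck 2 Xi phi -> Xi (x0, t0) ->
        phi (x0, t0) = u (x0, t0) ->
        (forall z, Xi z -> z <> (x0, t0) -> phi z < u z) ->
        (forall z, Xi z -> z.1 <> x0 -> grad phi z <> 0) ->
        (0 <= limf_esup
          (fun z => (dt phi z - p_laplace p phi z - f (grad phi z))%:E)
          (within [set z | z.1 <> x0] (nbhs (x0, t0))))%E].

End supersolutions.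

(* Main.v *)
Require Import Defs.
From HB Require Import structures.
From mathcomp Require Import all_boot all_order all_algebra.
From mathcomp Require Import all_classical all_reals all_analysis.
From mathcomp Require Import measurable_realfun ess_sup_inf.
From mathcomp Require Import ring lra.

Set Implicit Arguments.
Unset Strict Implicit.
Unset Printing Implicit Defensive.

Import Order.TTheory GRing.Theory Num.Theory.
Import numFieldNormedType.Exports.

Local Open Scope classical_set_scope.
Local Open Scope ring_scope.

(** Suppose that the viscosity inequality fails for a test function phi
    touching u from below at z0 = (x0, t0). Then, for some eps > 0, phi satisfies
      dt phi - Delta_p phi - f (D phi) <= - eps
    near z0 off the set x = x0. As u is lower semicontinuous and u > phi off z0,
    u >= phi + 2 m on a shell around z0 for all small m > 0. The heart
    of the proof is a comparison principle [comparison]: u >= phi + m almost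
    everywhere in the smaller ball B inside the shell. Since u (z0) is the
    essential lower limit of u at z0, this yields u (z0) > phi (z0), which is
    absurd.

    For the comparison, both inequalities are tested with the square of the
    positive part of phi + m - u. This function vanishes near the boundary of B,
    but u has no time derivative, so u is first replaced by its mollification
    u_h. The weak inequality, tested with a translate of the mollifier, says
    that u_h is a classical supersolution in which the flux and the reaction
    term are the mollifications V_h and s_h of |Du|^(p-2) Du and f (Du)
    ([mollified_supersolution], [mollified_gradient]). With
    g = (phi + m - u_h)^+, testing with g^2 gives [tested_difference]:
      int_B 2 g (|D phi|^(p-2) D phi - V_h) . (D phi - D u_h)
          + g^2 (eps - f (D phi) + s_h) <= 0;
    the time derivatives combine to the derivative of g^3 / 3, of integral 0.
    On the side of phi this needs the weak form of the inequality satisfied by phi,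
    although the p-Laplacian is only controlled off x = x0, possibly with a vanishing
    gradient there. The hyperplane through x0 orthogonal to one axis is cut
    out; the error from the cutoff is an integral of the derivative of a
    function of one variable against a continuous function, which tends to 0
    as the cutoff shrinks ([concentration], [subsolution_weak]).

    As h tends to 0 the integrand converges almost everywhere. It is bounded
    below by a multiple of the mollification of 1 + |Du|^p, which converges in
    L1, so Fatou's lemma applies ([fatou_bounded_below]); the product of V_h and
    D u_h, two mollifications, is bounded by [convolve_product_le]. In the limit
    the integrand is at least (eps / 2) ((phi + m - u)^+)^2 if m is small: where
    Du is close to D phi, monotonicity of the flux and continuity of f suffice;
    elsewhere strict monotonicity gives a bound from below by a multiple of
    1 + |Du|^p, which absorbs the growth of f, of exponent beta < p, because
    that term carries the small factor (phi + m - u)^+ <= m ([flux_reaction]).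
    Hence (phi + m - u)^+ = 0 almost everywhere in B. *)

#[local] Arguments lebesgue_st {R N} : simpl never.

(** * Lebesgue measure on space-time *)

Section spacetime.
Context {R : realType} (N : nat).
Local Notation Z := ('rV[R]_N * R)%type.
Local Notation mu := (@lebesgue_st R N).
Implicit Types (z w : Z) (i : option 'I_N).

(** Indexing the N + 1 coordinates of space-time by [option] treats time like any
    other coordinate; [None] is time. *)
Definition crd i z : R := if i is Some j then z.1 ord0 j else z.2.

Lemma crdD i z w : crd i (z + w) = crd i z + crd i w.
Proof. by case: i => [j|] //=; rewrite mxE. Qed.

Lemma crdN i z : crd i (- z) = - crd i z.
Proof. by case: i => [j|] //=; rewrite mxE. Qed.

Lemma crdB i z w : crd i (z - w) = crd i z - crd i w.
Proof. by rewrite crdD crdN. Qed.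

Lemma norm_ltP z r : `|z| < r <-> forall i, `|crd i z| < r.
Proof.
rewrite prod_normE /= gt_max; split=> [/andP[h1 h2] [j|]//=|h].
  apply: le_lt_trans h1; rewrite [leRHS]/Num.Def.normr/= mx_normrE.
  by rewrite (le_bigmax _ (fun ij : 'I_1 * 'I_N => `|z.1 ij.1 ij.2|) (ord0, j)).
apply/andP; split; last exact: (h None).
have r0 : 0 < r by apply: le_lt_trans (h None).
rewrite [ltLHS]/Num.Def.normr/= mx_normrE; apply/bigmax_ltP; split => //.
by move=> [a j] _ /=; rewrite (ord1 a); exact: (h (Some j)).
Qed.

Lemma ballP z r w : ball z r w <-> forall i, `|crd i z - crd i w| < r.
Proof.
rewrite -ball_normE /=; split=> [/norm_ltP h i|h]; first by rewrite -crdB.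
by apply/norm_ltP => i; rewrite crdB.
Qed.

Lemma norm_leP z r : 0 <= r -> `|z| <= r <-> forall i, `|crd i z| <= r.
Proof.
move=> r0; split=> [h i|h].
  apply/ler_addgt0Pl => e e0; apply/ltW.
  by move: i; apply/norm_ltP; rewrite (le_lt_trans h)// ltrDr.
apply/ler_addgt0Pl => e e0; apply/ltW/norm_ltP => i.
by rewrite (le_lt_trans (h i))// ltrDr.
Qed.

Lemma le_crd_norm i z : `|crd i z| <= `|z|.
Proof. by move: i; apply/norm_leP. Qed.

Lemma measurable_crd i : measurable_fun [set: 'rV[R]_N * measurableTypeR R] (crd i).
Proof.
case: i => [j|] /=; last exact: measurable_snd.
exact: (measurableT_comp (measurable_coord j) measurable_fst).
Qed.

Lemma measurable_ball_st z r :
  measurable (ball z r : set ('rV[R]_N * measurableTypeR R)).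
Proof.
rewrite (_ : ball z r = \bigcap_(i in [set: option 'I_N])
    [set w | `|crd i z - crd i w| < r]); last first.
  apply/seteqP; split=> [w /ballP h i _|w h]; first exact: h.
  by apply/ballP => i; exact: h.
apply: fin_bigcap_measurable => // i _.
have m : measurable_fun [set: 'rV[R]_N * measurableTypeR R]
    (fun w => `|crd i z - crd i w|).
  apply: measurableT_comp => //.
  by apply: measurable_funB => //; exact: measurable_crd.
rewrite -[X in measurable X]setTI.
rewrite (_ : [set w | _] = (fun w => `|crd i z - crd i w|) @^-1` `]-oo, r[); last first.
  by apply/seteqP; split => w /=; rewrite in_itv.
exact: m.
Qed.

Definition ratpt (q : 'rV[rat]_N * rat) : Z := (map_mx ratr q.1, ratr q.2).

Lemma ratpt_dense z r : 0 < r -> exists q, ball z r (ratpt q).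
Proof.
move=> r0.
have H (x : R) : exists q : rat, `|x - ratr q| < r.
  have /rat_in_itvoo[q] : x - r < x + r by rewrite ltrBlDr -addrA ltrDl addr_gt0.
  by rewrite in_itv /= => /andP[h1 h2]; exists q; rewrite distrC ltr_distl h1 h2.
have [q hq] := choice H.
exists (\row_j q (z.1 ord0 j), q z.2); apply/ballP => -[j|] /=; last exact: hq.
by rewrite !mxE; exact: hq.
Qed.

(** An open set is a countable union of balls with rational centres and radii
    1 / (n + 1), and a ball of the sup norm is a finite intersection of
    half-spaces. *)
Lemma open_measurable_st (U : set Z) : open U ->
  measurable (U : set ('rV[R]_N * measurableTypeR R)).
Proof.
move=> oU.
pose I := (('rV[rat]_N * rat) * nat)%type.
pose P (k : I) := ball (ratpt k.1) (k.2.+1%:R^-1) `<=` U.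
rewrite (_ : U = \bigcup_(k in P) ball (ratpt k.1) (k.2.+1%:R^-1)); last first.
  apply/seteqP; split=> [z Uz|z [k Pk]]; last exact: Pk.
  have /nbhs_ballP[e /= e0 he] := open_nbhs_nbhs (conj oU Uz).
  pose n := Num.bound (2 / e).
  have hn : n.+1%:R^-1 < e / 2.
    rewrite invf_plt ?posrE ?divr_gt0// invf_div.
    have /archi_boundP h : 0 <= 2 / e by rewrite divr_ge0// ltW.
    by apply: lt_le_trans h _; rewrite ler_nat.
  have [|q hq] := @ratpt_dense z (n.+1%:R^-1); first by rewrite invr_gt0.
  exists (q, n); last by apply: ball_sym.
  move=> w hw; apply: he; rewrite [e]splitr.
  by apply: ball_triangle (le_ball (ltW hn) hq) (le_ball (ltW hn) hw).
rewrite bigcup_mkcond.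
apply: countable_bigcupT_measurable => [|k]; first exact: countableP.
by case: ifP => // _; exact: measurable_ball_st.
Qed.

Lemma continuous_on_measurable (B : set Z) (g : Z -> R) : open B ->
  (forall z, B z -> {for z, continuous g}) ->
  measurable_fun (B : set ('rV[R]_N * measurableTypeR R)) g.
Proof.
move=> oB cg; apply: (measurability _ (RGenOpens.measurableE R)) => _ [_ [a [b ->] <-]].
apply: open_measurable_st.
rewrite openE => z [Bz /= gz].
have : nbhs z B by exact: open_nbhs_nbhs.
have : nbhs z (g @^-1` `]a, b[).
  apply: (cg z Bz); apply: open_nbhs_nbhs; split => //; exact: interval_open.
by move=> h1 h2; apply: filterI.
Qed.

End spacetime.

Section measure_preserving.

Definition preserving d (T : measurableType d) (R : realType)
    (m : set T -> \bar R) (s : T -> T) :=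
  measurable_fun [set: T] s /\
  forall A, measurable A -> m (s @^-1` A) = m A.

(** Both measures agree on rectangles, and the product measure is determined by
    its values there. *)
Lemma preserving_prod d1 d2 (T1 : measurableType d1) (T2 : measurableType d2)
    (R : realType) (m1 : {sigma_finite_measure set T1 -> \bar R})
    (m2 : {sigma_finite_measure set T2 -> \bar R}) (s1 : T1 -> T1) (s2 : T2 -> T2) :
  preserving m1 s1 -> preserving m2 s2 ->
  preserving (m1 \x m2)%E (fun z => (s1 z.1, s2 z.2)).
Proof.
move=> [ms1 e1] [ms2 e2].
have ms : measurable_fun [set: T1 * T2] (fun z => (s1 z.1, s2 z.2)).
  by apply: measurable_fun_pair; [exact: (measurableT_comp ms1 measurable_fst)|
    exact: (measurableT_comp ms2 measurable_snd)].
split => // A mA.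
apply/esym; apply: (@product_measure_unique _ _ _ _ _ _ _ (pushforward (m1 \x m2)%E (fun z => (s1 z.1, s2 z.2)))) => // B C mB mC.
rewrite /= /pushforward -(e1 _ mB) -(e2 _ mC) -product_measure1E//.
- by rewrite -[X in measurable X]setTI; exact: ms1.
- by rewrite -[X in measurable X]setTI; exact: ms2.
Qed.

Lemma preserving_shift1 (R : realType) (a : R) :
  preserving (@lebesgue_measure R) (fun x : measurableTypeR R => x + a : measurableTypeR R).
Proof.
have ms : measurable_fun [set: measurableTypeR R]
    (fun x : measurableTypeR R => x + a : measurableTypeR R).
  by apply: measurable_funD.
split => // A mA.
apply/esym; apply: (@lebesgue_measure_unique _ (pushforward (@lebesgue_measure R)
   (fun x : measurableTypeR R => x + a : measurableTypeR R))) => //= _ [[b c]] _ <-.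
rewrite /pushforward.
rewrite (_ : _ @^-1` _ = `](b - a), (c - a)]%classic); last first.
  by apply/seteqP; split => x /=; rewrite !in_itv /= ltrBlDr lerBrDr.
rewrite !lebesgue_measure_itv/= !lte_fin ltrD2r.
by case: ifP => // _; rewrite -!EFinB; congr EFin; ring.
Qed.

Lemma rV_consD (R : realType) n (z w : R * 'rV[R]_n) :
  rV_cons (z.1 + w.1, z.2 + w.2) = rV_cons z + rV_cons w.
Proof.
by apply/rowP => i; rewrite !mxE; case: unliftP => //= j _; rewrite mxE.
Qed.

Lemma rV_cons_surj (R : realType) n (a : 'rV[R]_n.+1) : exists w, a = rV_cons w.
Proof.
exists (a ord0 ord0, \row_i a ord0 (lift ord0 i)); apply/rowP => i.
by rewrite !mxE; case: unliftP => [j ->|->] //=; rewrite mxE.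
Qed.

Lemma measurable_shift_rV (R : realType) n (a : 'rV[R]_n) :
  measurable_fun [set: 'rV[measurableTypeR R]_n]
    (fun v : 'rV[R]_n => v + a : 'rV[measurableTypeR R]_n).
Proof.
apply/measurable_fun_rVP => i; under eq_fun do rewrite mxE.
by apply: measurable_funD => //; exact: measurable_coord.
Qed.

(** The measure on row vectors is built one coordinate at a time, so translation
    invariance follows by induction from the one-dimensional case. *)
Lemma preserving_shift_rV (R : realType) n (a : 'rV[R]_n) :
  preserving (@lebesgue_rV R n) (fun v : 'rV[R]_n => v + a).
Proof.
split; first exact: measurable_shift_rV.
elim: n a => [|n IHn] a A mA.
  by rewrite (_ : _ @^-1` _ = A)//; apply/seteqP; split => v /=; rewrite !thinmx0.
have [w ->] := rV_cons_surj a.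
rewrite /= /cons_measure /pushforward.
have [ms e] := @preserving_prod _ _ _ _ _ (@lebesgue_measure R) (@lebesgue_rV R n)
  _ _ (preserving_shift1 w.1) (conj (@measurable_shift_rV _ _ _) (IHn w.2)).
have mcA : measurable (@rV_cons R n @^-1` A : set (measurableTypeR R * _)).
  by rewrite -[X in measurable X]setTI; exact: measurable_rV_cons.
rewrite -[RHS](e _ mcA); congr ((_ \x _)%E _).
by apply/seteqP; split => z /=; rewrite rV_consD.
Qed.

Lemma preserving_ge0_integral d (T : measurableType d) (R : realType)
    (m : {measure set T -> \bar R}) (s : T -> T) (f : T -> \bar R) :
  preserving m s -> measurable_fun [set: T] f -> (forall x, 0 <= f x)%E ->
  (\int[m]_x f (s x) = \int[m]_x f x)%E.
Proof.
move=> [ms e] mf f0.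
transitivity (\int[pushforward m s]_x f x)%E.
  by rewrite ge0_integral_pushforward// preimage_setT.
by apply: eq_measure_integral => A mA _; exact: e.
Qed.

Lemma preserving_integral d (T : measurableType d) (R : realType)
    (m : {measure set T -> \bar R}) (s : T -> T) (f : T -> \bar R) :
  preserving m s -> measurable_fun [set: T] f ->
  (\int[m]_x f (s x) = \int[m]_x f x)%E.
Proof.
move=> ps mf; rewrite [LHS]integralE [RHS]integralE.
rewrite -/(f \o s) funepos_comp funeneg_comp /=.
by rewrite -(preserving_ge0_integral ps (measurable_funepos mf))//
  -(preserving_ge0_integral ps (measurable_funeneg mf)).
Qed.

End measure_preserving.

Section spacetime_measure.
Context {R : realType} (N : nat).
Local Notation Z := ('rV[R]_N * R)%type.
Local Notation mu := (@lebesgue_st R N).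

Lemma preserving_shift (a : Z) : preserving mu (fun z : Z => z + a).
Proof.
exact: (preserving_prod (preserving_shift_rV a.1) (preserving_shift1 a.2)).
Qed.

Lemma lebesgue_st_ball (z : Z) r : 0 < r ->
  mu (ball z r) = ((r *+ 2) ^+ N.+1)%:E.
Proof.
move=> r0.
rewrite (_ : ball z r =
   [set v : 'rV[R]_N | forall j, ball (z.1 ord0 j) r (v ord0 j)] `*` ball z.2 r); last first.
  apply/seteqP; split => [w /ballP h|w [h1 h2]].
    by split => [j|]; [have := h (Some j)|have := h None]; rewrite -ball_normE.
  apply/ballP => -[j|]; last by move: h2; rewrite -ball_normE.
  by have := h1 j; rewrite -ball_normE.
have mB (x : R) : measurable (ball x r) by exact: measurable_ball.
have mQ : measurable [set v : 'rV[R]_N | forall j, ball (z.1 ord0 j) r (v ord0 j)].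
  rewrite (_ : [set v | _] = \bigcap_(i in [set: 'I_N])
      ((fun v : 'rV[R]_N => v ord0 i) @^-1` ball (z.1 ord0 i) r)).
    apply: fin_bigcap_measurable => // i _.
    by rewrite -[X in measurable X]setTI; apply: measurable_coord.
  by apply/seteqP; split => [v Bv i _|v Bv i]; [exact: Bv|exact: Bv].
transitivity (lebesgue_rV N [set v : 'rV[R]_N | forall j, ball (z.1 ord0 j) r (v ord0 j)]
   * lebesgue_measure (ball z.2 r))%E; first by apply: (product_measure1E _ _ mQ); exact: mB.
rewrite (lebesgue_rV_box (A := fun j => ball (z.1 ord0 j) r)); last first.
  by move=> j; exact: mB.
rewrite lebesgue_measure_ball ?ltW// exprSr EFinM; congr (_ * _)%E.
under eq_bigr do rewrite lebesgue_measure_ball ?ltW//.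
by rewrite prodEFin prodr_const card_ord.
Qed.

Lemma lebesgue_st_open_gt0 (U : set Z) : open U -> U !=set0 -> (0 < mu U)%E.
Proof.
move=> oU [z Uz].
have /nbhs_ballP[e /= e0 he] := open_nbhs_nbhs (conj oU Uz).
apply: (@lt_le_trans _ _ (mu (ball z e))).
  by rewrite lebesgue_st_ball// lte_fin exprn_gt0// pmulrn_rgt0.
apply: le_measure => //; rewrite inE; last exact: open_measurable_st.
exact: measurable_ball_st.
Qed.

Lemma lebesgue_st_bounded (B : set Z) : measurable (B : set ('rV[R]_N * measurableTypeR R)) -> bounded_set B -> (mu B < +oo)%E.
Proof.
move=> mB [M [Mr /(_ (Num.max M 0 + 1))]].
rewrite (le_lt_trans (_ : _ <= Num.max M 0)) ?ltrDl ?le_max ?lexx// => /(_ isT) hB.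
have M0 : 0 < Num.max M 0 + 2 by rewrite ltr_wpDl// le_max lexx orbT.
apply: (@le_lt_trans _ _ (mu (ball (0:Z) (Num.max M 0 + 2)))).
  apply: le_measure; rewrite ?inE//; first exact: measurable_ball_st.
  by move=> w Bw; rewrite -ball_normE/= sub0r normrN (le_lt_trans (hB _ Bw))// ltrD2l ltr1n.
by rewrite lebesgue_st_ball ?ltry.
Qed.

End spacetime_measure.

(** * Density of continuous functions in L1 *)

Section L1_density.
Context d (T : measurableType d) (R : realType).
Variables (m : {measure set T -> \bar R}) (K : set T).
Hypotheses (mK : measurable K) (finK : (m K < +oo)%E).
Variable C : set (T -> R).
Hypothesis C_cst : forall c, C (cst c).
Hypothesis C_add : forall f g, C f -> C g -> C (f \+ g).
Hypothesis C_mul : forall f g, C f -> C g -> C (f \* g).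
Hypothesis C_measurable : forall f, C f -> measurable_fun [set: T] f.

Let L1 (g : T -> R) : \bar R := \int[m]_(x in K) `|g x|%:E.

Definition L1_approximable (g : T -> R) := measurable_fun K g /\
  forall e, 0 < e -> exists2 k, C k & (L1 (g \- k)%R <= e%:E)%E.

Let mC f : C f -> measurable_fun K f.
Proof. by move=> /C_measurable; exact: measurable_funTS. Qed.

Let mabs (f : T -> R) : measurable_fun K f -> measurable_fun K (fun x => `|f x|%:E).
Proof. by move=> mf; apply/measurable_EFinP; apply: measurableT_comp. Qed.

Let L1_triangle (f g h : T -> R) :
  measurable_fun K f -> measurable_fun K g -> measurable_fun K h ->
  (forall x, K x -> `|h x| <= `|f x| + `|g x|) -> (L1 h <= L1 f + L1 g)%E.
Proof.
move=> mf mg mh H; rewrite /L1.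
rewrite -ge0_integralD//=; try exact: mabs.
apply: ge0_le_integral => //.
- exact: mabs.
- by apply: emeasurable_funD; exact: mabs.
Qed.

Lemma L1_approximable_class f : C f -> L1_approximable f.
Proof.
move=> Cf; split; first exact: mC.
move=> e e0; exists f => //.
rewrite /L1; under eq_integral do rewrite /= subrr normr0.
by rewrite integral0 lee_fin ltW.
Qed.

Lemma L1_approximable_limit (g : T -> R) : measurable_fun K g ->
  (forall e, 0 < e -> exists2 h, L1_approximable h & (L1 (g \- h)%R <= e%:E)%E) ->
  L1_approximable g.
Proof.
move=> mg H; split => // e e0.
have e2 : 0 < e / 2 by rewrite divr_gt0.
have [h [mh /(_ _ e2)[k Ck hk]] gh] := H _ e2.
exists k => //; rewrite [e]splitr EFinD.
have mk := mC Ck.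
apply: le_trans (leeD gh hk).
apply: L1_triangle; try exact: measurable_funB.
by move=> x Kx /=; rewrite (le_trans _ (ler_normD _ _))// addrA subrK.
Qed.

Lemma L1_approximableD f g :
  L1_approximable f -> L1_approximable g -> L1_approximable (f \+ g).
Proof.
move=> [mf hf] [mg hg]; split; first exact: measurable_funD.
move=> e e0.
have e2 : 0 < e / 2 by rewrite divr_gt0.
have [k Ck hk] := hf _ e2; have [l Cl hl] := hg _ e2.
have mk := mC Ck; have ml := mC Cl.
exists (k \+ l); first exact: C_add.
rewrite [e]splitr EFinD; apply: le_trans (leeD hk hl).
apply: L1_triangle; try exact: measurable_funB.
  by apply: measurable_funB; exact: measurable_funD.
by move=> x Kx /=; rewrite (le_trans _ (ler_normD _ _))// opprD addrACA.
Qed.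

Lemma L1_approximableZ c f : L1_approximable f -> L1_approximable (fun x => c * f x).
Proof.
move=> [mf hf]; split; first exact: measurable_funM.
move=> e e0; have c1 : 0 < `|c| + 1 by rewrite ltr_wpDl.
have [k Ck hk] := hf (e / (`|c| + 1)) (divr_gt0 e0 c1).
have mk := mC Ck.
exists (cst c \* k); first exact: C_mul.
apply: (@le_trans _ _ ((`|c|)%:E * L1 (f \- k)%R)%E).
  rewrite /L1 -ge0_integralZl//=; last by apply: mabs; exact: measurable_funB.
  under eq_integral do rewrite -mulrBr normrM EFinM.
  by [].
apply: le_trans (lee_wpmul2l _ hk) _; first by rewrite lee_fin.
by rewrite -EFinM lee_fin mulrCA ger_pMr// ler_pdivrMr// mul1r lerDl.
Qed.

Lemma L1_approximable_sum n (f : 'I_n -> T -> R) :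
  (forall i, L1_approximable (f i)) -> L1_approximable (fun x => \sum_i f i x).
Proof.
elim: n f => [|n IHn] f hf.
  by under eq_fun do rewrite big_ord0; apply: L1_approximable_class; exact: (C_cst 0).
under eq_fun do rewrite big_ord_recl; apply: L1_approximableD => //.
exact: IHn.
Qed.

(** By dominated convergence. *)
Lemma L1_approximable_bounded_limit (g_ : (T -> R)^nat) (g : T -> R) (M : R) :
  (forall n, L1_approximable (g_ n)) ->
  (forall n x, `|g_ n x| <= M) -> (forall x, g_ ^~ x @ \oo --> g x) ->
  L1_approximable g.
Proof.
move=> hg gM gc.
have mgn n : measurable_fun K (g_ n) by have [] := hg n.
have mg : measurable_fun K g.
  by apply: (measurable_fun_cvg mgn) => x _; exact: gc.
apply: L1_approximable_limit => // e e0.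
have := @dominated_convergence _ _ _ m K mK (fun n => EFin \o g_ n) (EFin \o g)
  (cst M%:E).
have iM : m.-integrable K (cst M%:E).
  apply/integrableP; split; first exact: measurable_cst.
  by rewrite integral_cst//= lte_mul_pinfty// lee_fin.
move=> /(_ _ _ _ iM) []; [|exact/measurable_EFinP| | | ].
- by move=> n; exact/measurable_EFinP.
- by apply: aeW => x _; apply: cvg_EFin; [exact: nearW|exact: gc].
- by apply: aeW => x n _ /=; rewrite lee_fin.
move=> _ /fine_cvgP[fin /cvgr_dist_lt /(_ _ e0) H] _.
have [n _ /(_ n (leqnn n)) [Hf Hd]] := filterI fin H.
exists (g_ n) => //.
rewrite /L1; under eq_integral do rewrite /= distrC.
move: Hf Hd; rewrite /= sub0r normrN; set I := (X in X \is a fin_num) => Hf Hd.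
change (I <= e%:E)%E.
by rewrite -(fineK Hf) lee_fin (le_trans (ler_norm _) (ltW Hd)).
Qed.

(** The sets whose indicator is a bounded limit of functions of the class; they
    form a pi-system because the class is stable under products. *)
Definition class_limits : set (set T) := [set A | measurable A /\
  exists k_ : (T -> R)^nat, [/\ forall n, C (k_ n), forall n x, `|k_ n x| <= 1 &
    forall x, k_ ^~ x @ \oo --> (\1_A x : R)]].

Hypothesis C_generates : @measurable _ T = <<s class_limits >>.

Let sum_indic_disjoint (F : (set T)^nat) x j n : trivIset [set: nat] F -> F j x ->
  \sum_(i < n) (\1_(F i) x : R) = (j < n)%:R.
Proof.
move=> tF Fjx.
have F0 i : i != j -> \1_(F i) x = 0 :> R.
  move=> ij; rewrite indicE memNset// => Fix.
  by move/trivIsetP : tF => /(_ i j Logic.I Logic.I ij) /seteqP[/(_ x) /(_ (conj Fix Fjx))].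
case: ltnP => jn.
  rewrite (bigD1 (Ordinal jn))//= big1 ?addr0 ?indicE ?mem_set// => i ij.
  by apply: F0; apply: contraNneq ij => ij; apply/eqP/val_inj.
rewrite big1// => i _; apply: F0; rewrite neq_ltn (leq_trans (ltn_ord i))//.
Qed.

(** Dynkin induction: the sets with approximable indicator are stable under
    complements and disjoint unions and contain the pi-system [class_limits]. *)
Lemma L1_approximable_indic A : measurable A -> L1_approximable (\1_A : T -> R).
Proof.
rewrite C_generates; move: A; apply: (@dynkin_induction _ _ class_limits
  (fun A => L1_approximable (\1_A : T -> R))) => //.
- move=> A B [mA [k [Ck k1 kA]]] [mB [l [Cl l1 lB]]].
  split; first exact: measurableI.
  exists (fun n => k n \* l n); split => [n|n x|x]; first exact: C_mul.
    by rewrite /= normrM mulr_ile1.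
  by rewrite indicI; apply: cvgM; [exact: kA|exact: lB].
- by rewrite indicT; apply: L1_approximable_class; exact: C_cst.
- move=> A [mA [k [Ck k1 kA]]].
  by apply: L1_approximable_bounded_limit k1 kA => n; exact: L1_approximable_class.
- move=> A mA hA.
  rewrite (_ : \1_(~` A) = cst 1 \+ (fun x => -1 * \1_A x)); last first.
    by apply/funext => x; rewrite /= !indicE in_setC mulN1r; case: (x \in A); rewrite ?subrr ?subr0.
  apply: L1_approximableD; first by apply: L1_approximable_class; exact: C_cst.
  exact: L1_approximableZ.
- move=> F mF tF hF.
  apply: (@L1_approximable_bounded_limit (fun n x => \sum_(i < n) (\1_(F i) x : R)) _ 1).
  + by move=> n; exact: L1_approximable_sum.
  + move=> n x; have [[j _ Fjx]|nF] := pselect ((\bigcup_i F i) x).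
      by rewrite (sum_indic_disjoint n tF Fjx) ger0_norm// lern1 leq_b1.
    rewrite big1 ?normr0// => i _; rewrite indicE memNset// => Fix.
    by apply: nF; exists i.
  + move=> x; have [[j _ Fjx]|nF] := pselect ((\bigcup_i F i) x).
      rewrite indicE mem_set; last by exists j.
      apply/cvgrPdist_lt => e e0; exists j.+1 => // n /= jn.
      by rewrite (sum_indic_disjoint n tF Fjx) jn subrr normr0.
    rewrite indicE memNset//; apply/cvgrPdist_lt => e e0; apply: nearW => n.
    rewrite big1 ?subrr ?normr0// => i _; rewrite indicE memNset// => Fix.
    by apply: nF; exists i.
Qed.

Import HBSimple.

(** Integrable functions are L1 limits of simple functions, which are finite
    linear combinations of indicators. *)
Theorem L1_density (g : T -> R) : m.-integrable K (EFin \o g) ->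
  forall e, 0 < e -> exists2 k, C k & (L1 (g \- k)%R <= e%:E)%E.
Proof.
move=> ig; suff [] : L1_approximable g by [].
have mg : measurable_fun K g by apply/measurable_EFinP; case/integrableP: ig.
apply: L1_approximable_limit => // e e0.
have [g_ [_ _ /fine_cvgP[fin /cvgr_dist_lt /(_ _ e0) H]]] :=
  approximation_sfun_integrable mK ig.
have [n _ /(_ n (leqnn n)) [Hf Hd]] := filterI fin H.
exists (g_ n).
  rewrite (_ : (g_ n : T -> R) = fun x => g_ n x)//.
  under eq_fun do rewrite fimfunEord.
  apply: L1_approximable_sum => i; apply: L1_approximableZ.
  exact: L1_approximable_indic.
move: Hf Hd; rewrite /= sub0r normrN; set I := (X in X \is a fin_num) => Hf Hd.
change (I <= e%:E)%E.
by rewrite -(fineK Hf) lee_fin (le_trans (ler_norm _) (ltW Hd)).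
Qed.

End L1_density.

Section spacetime_density.
Context {R : realType} (N : nat).
Local Notation Z := ('rV[R]_N * R)%type.
Local Notation T := ('rV[R]_N * measurableTypeR R)%type.
Local Notation mu := (@lebesgue_st R N).

Definition bounded_continuous : set (T -> R) := [set f |
  continuous (f : Z -> R) /\ exists M : R, forall z, `|f z| <= M].

Lemma continuous_crd (i : option 'I_N) : continuous (@crd R N i).
Proof.
move=> z; apply/cvgrPdist_lt => e e0; near=> w.
rewrite -crdB (le_lt_trans (le_crd_norm _ _))//.
Unshelve. all: by end_near. Qed.

(** The indicator of a closed half-space is the decreasing limit of ramps. *)
Lemma class_limits_halfspace (i : option 'I_N) (x : R) :
  class_limits bounded_continuous (@crd R N i @^-1` `[x, +oo[).
Proof.
split.
  by rewrite -[X in measurable X]setTI; apply: measurable_crd.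
(* The ramp of slope n below the threshold x. *)
pose k (n : nat) (z : Z) : R := Num.max 0 (Num.min 1 (1 + n%:R * (crd i z - x))).
have k01 n z : 0 <= k n z <= 1.
  by rewrite /k le_max lexx /= ge_max ler01 ge_min lexx.
exists k; split.
- move=> n; split; last by exists 1 => z; have /andP[k0 k1] := k01 n z; rewrite ger0_norm.
  pose h (z : Z) : R := 1 + n%:R * (crd i z - x).
  move=> z; have : {for z, continuous (cst 0 \max (cst 1 \min h))}; last by [].
  apply: (@continuous_max R Z (cst 0) (cst 1 \min h)); first exact: cvg_cst.
  apply: (@continuous_min R Z (cst 1) h); first exact: cvg_cst.
  apply: cvgD; first exact: cvg_cst.
  apply: cvgM; first exact: cvg_cst.
  by apply: cvgB; [exact: continuous_crd|exact: cvg_cst].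
- by move=> n z; have /andP[k0 k1] := k01 n z; rewrite ger0_norm.
move=> z; rewrite indicE; have [xz|zx] := leP x (crd i z).
  rewrite mem_set; last by rewrite /= in_itv /= xz.
  apply/cvgrPdist_lt => e e0; apply: nearW => n.
  rewrite /k min_l ?max_r ?subrr ?normr0//.
  by rewrite lerDl mulr_ge0// subr_ge0.
rewrite memNset; last by rewrite /= in_itv /= andbT leNgt zx.
apply/cvgrPdist_lt => e e0.
exists (Num.bound (x - crd i z)^-1) => // n /= hn.
rewrite /k max_l ?subrr ?normr0//.
rewrite ge_min; apply/orP; right.
have d0 : 0 < x - crd i z by rewrite subr_gt0.
rewrite -opprB mulrN subr_le0 -ler_pdivrMr// mul1r.
have /archi_boundP h : 0 <= (x - crd i z)^-1 by rewrite invr_ge0 ltW.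
by apply: (le_trans (ltW h)); rewrite ler_nat.
Qed.

Lemma class_limits_generates :
  @measurable _ T = <<s class_limits bounded_continuous >>.
Proof.
apply/seteqP; split; last first.
  apply: smallest_sub; first exact: sigma_algebra_measurable.
  by move=> A [].
pose S := g_sigma_algebraType (class_limits bounded_continuous).
have mc (i : option 'I_N) : measurable_fun [set: S] (crd i : S -> measurableTypeR R).
  apply: (measurability _ (RGenCInfty.measurableE R)) => _ [_ [x ->] <-].
  by rewrite setTI; apply: sub_sigma_algebra; exact: class_limits_halfspace.
have mid : measurable_fun [set: S] (fun z : S => (z : T)).
  apply/measurable_fun_pairP; split; last exact: (mc None).
  by apply/measurable_fun_rVP => j; exact: (mc (Some j)).
by move=> A mA; have := mid measurableT A mA; rewrite setTI.
Qed.

(** The half-spaces generate the Borel sets, so the density theorem for algebras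
    of functions applies to the bounded continuous functions. *)
Lemma spacetime_density (K : set Z) (g : Z -> R) : measurable (K : set T) ->
  bounded_set K -> mu.-integrable K (EFin \o g) ->
  forall e, 0 < e -> exists2 k : Z -> R,
    continuous k /\ (exists M : R, forall z, `|k z| <= M) &
    (\int[mu]_(z in K) `|g z - k z|%:E <= e%:E)%E.
Proof.
move=> mK bK ig e e0.
have [|||||k Ck hk] := @L1_density _ T R mu K mK _ bounded_continuous _ _ _ _ class_limits_generates _ ig e e0.
- exact: lebesgue_st_bounded.
- move=> c; split; first exact: cst_continuous.
  by exists `|c|.
- move=> f1 f2 [c1 [M1 b1]] [c2 [M2 b2]]; split.
    by move=> z; apply: continuousD; [exact: c1|exact: c2].
  by exists (M1 + M2) => z; rewrite (le_trans (ler_normD _ _))// lerD.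
- move=> f1 f2 [c1 [M1 b1]] [c2 [M2 b2]]; split.
    by move=> z; apply: continuousM; [exact: c1|exact: c2].
  by exists (M1 * M2) => z; rewrite normrM ler_pM.
- by move=> f1 [c1 _]; apply: (@continuous_on_measurable R N [set: Z]) => [|z _]; [exact: (@openT Z)|exact: c1].
- by exists k.
Qed.

End spacetime_density.

(** * Directional derivatives and smooth functions *)

Section directional_derivatives.
Context {R : realType} {V : normedModType R}.
Implicit Types (f g : V -> R) (x v : V).

Lemma is_derive_cvg f x v (l : R) :
  (fun h : R => h^-1 *: (f (h *: v + x) - f x) : R) @ 0^' --> l -> is_derive x v f l.
Proof. by move=> fl; apply: DeriveDef; [apply/cvg_ex; exists l|exact: cvg_lim]. Qed.

Lemma cvg_is_derive f x v (l : R) : is_derive x v f l ->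
  (fun h : R => h^-1 *: (f (h *: v + x) - f x) : R) @ 0^' --> l.
Proof. by move=> [df <-]. Qed.

Lemma is_derive_line f x v (l : R) : is_derive x v f l <->
  is_derive (0 : R) 1 (fun h : R => f (h *: v + x)) l.
Proof.
have E : (fun h : R => h^-1 *: (f (h *: v + x) - f x)) =
    (fun h : R => h^-1 *: (f ((h *: (1 : R) + 0 : R) *: v + x) - f (0 *: v + x))).
  by apply/funext => h; rewrite addr0 scale0r add0r [_%:A]mulr1.
split=> [/cvg_is_derive|[dg dl]].
  rewrite E => h; apply: DeriveDef; first by apply/cvg_ex; exists l.
  exact: cvg_lim.
apply: is_derive_cvg; rewrite E.
by move: dg; rewrite /derivable -dl => dg.
Qed.

Lemma is_derive_line_at f x v (l s : R) : is_derive (s *: v + x) v f l ->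
  is_derive s 1 (fun h : R => f (h *: v + x)) l.
Proof.
move=> /cvg_is_derive h.
have E : (fun h : R => h^-1 *: (f (h *: v + (s *: v + x)) - f (s *: v + x))) =
    (fun h : R => h^-1 *: (f ((h *: (1 : R) + s : R) *: v + x) - f (s *: v + x))).
  by apply/funext => k; rewrite scalerDl addrA [_%:A]mulr1.
rewrite E in h; apply: DeriveDef; first by apply/cvg_ex; exists l.
exact: cvg_lim.
Qed.

Lemma is_derive_chain f (k : R -> R) x v (a b : R) :
  is_derive (f x) 1 k a -> is_derive x v f b ->
  is_derive x v (k \o f) (a * b).
Proof.
move=> hk /is_derive_line hf; apply/is_derive_line.
apply: (@is_derive1_comp R k (fun h => f (h *: v + x)) 0 a b) => //.
by rewrite scale0r add0r.
Qed.

(** The one-dimensional mean value theorem along a line. *)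
Lemma MVT_directional f (df : V -> R) v x (s : R) :
  (forall y, is_derive y v f (df y)) ->
  exists2 t : R, `|t| <= `|s| & f (s *: v + x) - f x = df (t *: v + x) * s.
Proof.
move=> hf; pose g (h : R) := f (h *: v + x).
have dg (h : R) : is_derive h 1 g (df (h *: v + x)).
  exact: is_derive_line_at.
have cg (a b : R) : {within `[a, b], continuous g}.
  apply: continuous_subspaceT => h.
  by apply/differentiable_continuous/derivable1_diffP; case: (dg h).
have -> : f x = g 0 by rewrite /g scale0r add0r.
rewrite -/(g s).
have [s0|s0] := leP 0 s.
  have [|c + e] := @MVT_segment R g _ _ _ s0 (fun h _ => dg h); first exact: cg.
  rewrite in_itv /= => /andP[c0 cs].
  by exists c; rewrite ?ger0_norm// e subr0.
have [|c + e] := @MVT_segment R g _ _ _ (ltW s0) (fun h _ => dg h); first exact: cg.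
rewrite in_itv /= => /andP[cs c0].
exists c; first by rewrite !ler0_norm ?lerN2// ltW.
by rewrite -opprB e sub0r mulrN opprK.
Qed.

End directional_derivatives.

Section Ck_theory.
Context {R : realType} {V : normedModType R}.
Implicit Types (f g : V -> R) (v : V).

Lemma CkS k f : Ck k.+1 setT f -> Ck k setT f.
Proof.
elim: k f => [|k IHk] f /= [df hf].
  by move=> z _; apply: differentiable_continuous; exact: df.
by split => // v; apply: IHk; exact: hf.
Qed.

Lemma Ck_cst k (c : R) : Ck k setT (cst c : V -> R).
Proof.
elim: k c => [|k IHk] c /=; first by move=> z _; exact: cst_continuous.
split => [z _|v]; first exact: differentiable_cst.
rewrite (_ : 'D_v (cst c) = cst 0); first exact: IHk.
by apply/funext => z; rewrite derive_cst.
Qed.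

Lemma Ck_add k f g : Ck k setT f -> Ck k setT g -> Ck k setT (fun z => f z + g z).
Proof.
elim: k f g => [|k IHk] f g /=.
  by move=> cf cg z _; apply: continuousD; [exact: cf|exact: cg].
move=> [df hf] [dg hg]; split => [z _|v].
  by apply: differentiableD; [exact: df|exact: dg].
rewrite (_ : 'D_v _ = (fun z => 'D_v f z + 'D_v g z)); first exact: IHk.
apply/funext => z; rewrite (@deriveD _ _ _ f g)//.
  by apply: diff_derivable; exact: df.
by apply: diff_derivable; exact: dg.
Qed.

Lemma Ck_mul k f g : Ck k setT f -> Ck k setT g -> Ck k setT (fun z => f z * g z).
Proof.
elim: k f g => [|k IHk] f g.
  by move=> /= cf cg z _; apply: continuousM; [exact: cf|exact: cg].
move=> hf0 hg0; have [df hf] := hf0; have [dg hg] := hg0; split => [z _|v].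
  by apply: differentiableM; [exact: df|exact: dg].
rewrite (_ : 'D_v _ = (fun z => f z * 'D_v g z + g z * 'D_v f z)).
  apply: Ck_add; apply: IHk; first [exact: hf|exact: hg|exact: CkS].
apply/funext => z; rewrite (@deriveM _ _ f g)//.
  by apply: diff_derivable; exact: df.
by apply: diff_derivable; exact: dg.
Qed.

Lemma Ck_prod k n (F : 'I_n -> V -> R) : (forall i, Ck k setT (F i)) ->
  Ck k setT (fun z => \prod_i F i z).
Proof.
elim: n F => [|n IHn] F hF.
  by under eq_fun do rewrite big_ord0; exact: (Ck_cst k 1).
under eq_fun do rewrite big_ord_recl; apply: Ck_mul => //.
exact: IHn.
Qed.

(** Composition with an affine [l]: the directional derivative of [b \o l] is a
    constant times [b^`() \o l], so a class of functions of one variable that is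
    stable under derivation consists of functions of class [Ck] for all [k] after
    composition. *)
Lemma Ck_comp (S : set (R -> R)) (l : V -> R) :
  (forall b, S b -> (forall x, derivable b x 1) /\ S b^`()%classic) ->
  (forall z, differentiable l z) -> (forall v, exists c, forall z, 'D_v l z = c) ->
  forall k b, S b -> Ck k setT (b \o l).
Proof.
move=> hS dl hl; elim=> [|k IHk] b Sb.
  move=> z _; apply: continuous_comp; first exact: differentiable_continuous.
  by apply/differentiable_continuous/derivable1_diffP; have [] := hS _ Sb.
have [db Sb'] := hS _ Sb.
split=> [z _|v]; first by apply: differentiable_comp => //; exact/derivable1_diffP.
have [c hc] := hl v.
rewrite (_ : 'D_v (b \o l) = (fun z => (b^`()%classic \o l) z * c)).
  by apply: Ck_mul; [exact: IHk|exact: Ck_cst].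
apply/funext => z.
have [] := @is_derive_chain R V l b z v (b^`()%classic (l z)) c; last by [].
  by rewrite derive1E; exact: derivableP.
by rewrite -(hc z); apply: derivableP; exact: diff_derivable.
Qed.

End Ck_theory.

(** * Smooth bump functions *)

Section flat_function.
Context {R : realType}.
Implicit Types (P : {poly R}) (x y : R).

(** The functions P (1 / x) exp (- 1 / x), extended by 0 to x <= 0. They are
    closed under derivation, which makes them all smooth at once. *)
Definition flat P x : R := if 0 < x then P.[x^-1] * expR (- x^-1) else 0.

Lemma horner_expR_bound P : exists2 C : R, 0 <= C &
  forall y, 0 <= y -> `|P.[y]| <= C * expR y.
Proof.
have pw n : exists2 C : R, 0 <= C & forall y, 0 <= y -> y ^+ n <= C * expR y.
  case: n => [|n]; first by exists 1 => // y y0; rewrite mul1r expr0 -expR0 ler_expR.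
  exists (n.+1`!%:R) => // y y0.
  have h := expR_ge1Dxn n y0.
  rewrite mulrC -ler_pdivrMr ?ltr0n ?fact_gt0//.
  by apply: le_trans h; rewrite lerDr.
have [c hc] := choice (fun n => let: ex_intro2 C h1 h2 := pw n in ex_intro _ C (conj h1 h2)).
exists (\sum_(i < size P) `|P`_i| * c i).
  by apply: sumr_ge0 => i _; rewrite mulr_ge0//; case: (hc i).
move=> y y0; rewrite horner_coef (le_trans (ler_norm_sum _ _ _))// mulr_suml.
apply: ler_sum => i _; rewrite normrM (ger0_norm (exprn_ge0 _ y0)) -mulrA.
by rewrite ler_wpM2l//; case: (hc i) => _; exact.
Qed.

(** The exponential dominates all polynomials; the quadratic bound gives the
    derivative 0 at the origin. *)
Lemma flat_quadratic P : exists2 C : R, 0 <= C & forall x, `|flat P x| <= C * x ^+ 2.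
Proof.
have [C C0 hC] := horner_expR_bound ('X^2 * P).
exists C => // x; rewrite /flat; case: ifPn => x0; last by rewrite normr0 mulr_ge0// sqr_ge0.
have xi0 : 0 <= x^-1 by rewrite invr_ge0 ltW.
have := hC _ xi0; rewrite hornerM hornerXn normrM ger0_norm ?exprn_ge0//.
rewrite normrM (ger0_norm (expR_ge0 _)) expRN => h.
rewrite ler_pdivrMr ?expR_gt0// mulrAC -ler_pdivrMr ?exprn_gt0//.
by rewrite mulrC -exprVn.
Qed.

Lemma is_derive_flat P x : is_derive x 1 (flat P) (flat ('X^2 * (P - P^`())) x).
Proof.
have [x0|x0|->] := ltgtP x 0.
- rewrite [X in is_derive _ _ _ X]/flat ltNge (ltW x0) /=.
  apply: (@near_eq_is_derive _ _ _ (cst 0)).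
    near=> y; rewrite /flat ltNge ifF//; apply/negbF/ltW.
    by near: y; exact: lt_nbhsl.
- rewrite [X in is_derive _ _ _ X]/flat x0.
  apply: (@near_eq_is_derive _ _ _ (fun y => P.[y^-1] * expR (- y^-1))).
    near=> y; rewrite /flat ifT//.
    by near: y; exact: lt_nbhsr.
  have dv : is_derive x 1 (fun y : R => y^-1) (- x ^- 2).
    apply: is_derive_eq; first by apply: is_deriveV; rewrite gt_eqF.
    by rewrite scaler1.
  have d1 := @is_derive1_comp R (horner P) (fun y => y^-1) x _ _ (is_derive_poly P _) dv.
  have d2 := @is_derive1_comp R expR (fun y => - y^-1) x _ _ (is_derive_expR _) (is_deriveN dv).
  refine (is_derive_eq (is_deriveM d1 d2) _).
  rewrite /= !hornerE -!exprVn /GRing.scale /=; ring.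
have [C C0 hC] := flat_quadratic P.
rewrite [X in is_derive _ _ _ X]/flat ltxx; apply: is_derive_cvg.
apply/cvgrPdist_lt => e e0; near=> h.
have fl0 : flat P 0 = 0 by rewrite /flat ltxx.
have -> : h *: (1 : R) + 0 = h by rewrite addr0 [_%:A]mulr1.
rewrite fl0 subr0 sub0r normrN normrM normfV.
have h0 : 0 < `|h| by rewrite normr_gt0; near: h; exact: nbhs_dnbhs_neq.
rewrite mulrC ltr_pdivrMr// (le_lt_trans (hC h))//.
rewrite -real_normK ?num_real// expr2 mulrA ltr_pM2r//.
rewrite (@le_lt_trans _ _ ((C + 1) * `|h|))//; first by rewrite ler_wpM2r// lerDl.
rewrite mulrC -ltr_pdivlMr ?ltr_wpDl//.
near: h; apply: dnbhs0_lt; by rewrite divr_gt0// ltr_wpDl.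
Unshelve. all: by end_near. Qed.

Lemma flat_closed_derive b : [set b | exists P, b = flat P] b ->
  (forall x, derivable b x 1) /\ [set b | exists P, b = flat P] b^`()%classic.
Proof.
move=> [P ->]; split; first by move=> x; case: (is_derive_flat P x).
exists ('X^2 * (P - P^`())); apply/funext => x; rewrite derive1E.
by case: (is_derive_flat P x).
Qed.

End flat_function.

Section bump.
Context {R : realType}.
Implicit Types (h s x : R).

(** A smooth even function of [s], positive exactly on the interval ]-h, h[. *)
Definition bump1 h s : R := flat 1 (h + s) * flat 1 (h - s).

Lemma flat1_ge0 x : 0 <= flat 1 x.
Proof. by rewrite /flat; case: ifP => // _; rewrite hornerE mul1r expR_ge0. Qed.

Lemma flat1_gt0 x : (0 < flat 1 x) = (0 < x).
Proof.
by rewrite /flat; case: ifP => //; rewrite hornerE mul1r expR_gt0.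
Qed.

Lemma bump1_ge0 h s : 0 <= bump1 h s.
Proof. by rewrite mulr_ge0// flat1_ge0. Qed.

Lemma bump1_gt0 h s : (0 < bump1 h s) = (`|s| < h).
Proof.
rewrite ltr_norml -(subr_gt0 (- h) s) opprK [s + h]addrC -(subr_gt0 s h) -(flat1_gt0 (h + s)) -(flat1_gt0 (h - s)) /bump1.
move: (flat1_ge0 (h + s)) (flat1_ge0 (h - s)); rewrite !le_eqVlt => /orP[/eqP<-|a] /orP[/eqP<-|b].
- by rewrite mul0r ltxx.
- by rewrite mul0r ltxx.
- by rewrite mulr0 ltxx andbF.
- by rewrite mulr_gt0// a b.
Qed.

Lemma bump1_even h s : bump1 h (- s) = bump1 h s.
Proof. by rewrite /bump1 opprK mulrC. Qed.

Lemma Ck_bump1 (V : normedModType R) (l : V -> R) h k :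
  (forall z, differentiable l z) -> (forall v, exists c, forall z, 'D_v l z = c) ->
  Ck k setT (fun z => bump1 h (l z)).
Proof.
move=> dl hl; apply: Ck_mul.
- apply: (@Ck_comp _ _ _ (fun z => h + l z) (@flat_closed_derive R)); last by exists 1.
    by move=> z; apply: differentiableD.
  move=> v; have [c hc] := hl v; exists c => z.
  rewrite (@deriveD _ _ _ (cst h) l)//; first by rewrite derive_cst add0r hc.
  exact: diff_derivable.
- apply: (@Ck_comp _ _ _ (fun z => h - l z) (@flat_closed_derive R)); last by exists 1.
    by move=> z; apply: differentiableB.
  move=> v; have [c hc] := hl v; exists (- c) => z.
  rewrite (@deriveB _ _ _ (cst h) l)//; first by rewrite derive_cst sub0r hc.
  exact: diff_derivable.
Qed.

Definition bumpx N h (x : 'rV[R]_N) : R := \prod_(j < N) bump1 h (x ord0 j).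

(** As the norm is the sup norm, the product of the bumps of the coordinates is
    positive exactly on the open ball of radius [h]. *)
Definition bumpz N h (z : 'rV[R]_N * R) : R := bumpx h z.1 * bump1 h z.2.

Lemma Ck_bumpx N h (a : 'rV[R]_N) k : Ck k setT (fun x : 'rV[R]_N => bumpx h (x - a)).
Proof.
apply: Ck_prod => j; apply: Ck_bump1 => [x|v].
  rewrite (_ : (fun z : 'rV[R]_N => (z - a) ord0 j) =
     (fun z : 'rV[R]_N => z ord0 j) - cst (a ord0 j)).
    by apply: differentiableB => //; exact: differentiable_coord.
  by apply/funext => z; rewrite !mxE.
exists (v ord0 j) => z.
have [//] : is_derive z v (fun z : 'rV[R]_N => (z - a) ord0 j) (v ord0 j).
apply: is_derive_cvg; apply/cvgrPdist_lt => e e0; near=> s.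
have s0 : s != 0 by near: s; exact: nbhs_dnbhs_neq.
rewrite !mxE.
set b := v ord0 j; set c := z ord0 j; set d := a ord0 j.
have -> : s * b + c - d - (c - d) = s * b by ring.
by rewrite [_ *: _]mulKf// subrr normr0.
Unshelve. all: by end_near. Qed.

Section spacetime_bump.
Variable N : nat.
Local Notation Z := ('rV[R]_N * R)%type.
Implicit Types (z w a v : Z).

Lemma is_derive_crd (i : option 'I_N) z v : is_derive z v (crd i) (crd i v).
Proof.
apply: is_derive_cvg; apply/cvgrPdist_lt => e e0; near=> s.
have s0 : s != 0 by near: s; exact: nbhs_dnbhs_neq.
rewrite crdD addrK (_ : crd i (s *: v) = s * crd i v); last first.
  by case: i => [j|] //=; rewrite mxE.
by rewrite [_ *: _]mulKf// subrr normr0.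
Unshelve. all: by end_near. Qed.

(** A coordinate is linear and continuous. *)
Lemma differentiable_crd (i : option 'I_N) z : differentiable (@crd R N i) z.
Proof.
have dfst : differentiable (fst : Z -> 'rV[R]_N) z.
  by apply: linear_differentiable => w; exact: cvg_fst.
have dsnd : differentiable (snd : Z -> R) z.
  by apply: linear_differentiable => w; exact: cvg_snd.
case: i => [j|] //=.
apply: (@differentiable_comp R _ _ _ fst (fun v : 'rV[R]_N => v ord0 j) z dfst).
exact: differentiable_coord.
Qed.

Lemma Ck_bumpz h a k : Ck k setT (fun z : Z => bumpz h (z - a)).
Proof.
have H i : Ck k setT (fun z : Z => bump1 h (crd i (z - a))).
  have -> : (fun z : Z => bump1 h (crd i (z - a))) = (fun z : Z => bump1 h (crd i z - crd i a)).
    by apply/funext => z; rewrite crdB.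
  apply: Ck_bump1 => [z|v].
    by apply: differentiableB => //; exact: differentiable_crd.
  exists (crd i v) => z.
  have [d e] := is_derive_crd i z v.
  by rewrite (@deriveB _ _ _ (crd i) (cst (crd i a)))// e derive_cst subr0.
apply: Ck_mul; last exact: (H None).
by apply: Ck_prod => j; exact: (H (Some j)).
Qed.

Lemma bumpz_ge0 h z : 0 <= bumpz h z.
Proof. by rewrite mulr_ge0 ?bump1_ge0// prodr_ge0// => j _; exact: bump1_ge0. Qed.

Lemma bumpz_gt0 h z : `|z| < h -> 0 < bumpz h z.
Proof.
move=> /norm_ltP zh; rewrite mulr_gt0//; last by rewrite bump1_gt0; exact: (zh None).
by apply: prodr_gt0 => j _; rewrite bump1_gt0; exact: (zh (Some j)).
Qed.

Lemma bumpz_eq0 h z : h <= `|z| -> bumpz h z = 0.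
Proof.
move=> hz; apply/eqP; apply: contraLR hz; rewrite -ltNge mulf_eq0 negb_or.
rewrite prodf_seq_neq0 => /andP[/allP h1 h2].
apply/norm_ltP => -[j|].
  rewrite -bump1_gt0 lt_def bump1_ge0 andbT.
  by have := h1 j (mem_index_enum _).
by rewrite -bump1_gt0 lt_def bump1_ge0 h2.
Qed.

Lemma bumpz_even h z : bumpz h (- z) = bumpz h z.
Proof.
rewrite /bumpz /= bump1_even; congr (_ * _); apply: eq_bigr => j _.
by rewrite mxE bump1_even.
Qed.

End spacetime_bump.

Lemma compact_bounded_closed_prod N (A : set ('rV[R]_N * R)) :
  bounded_set A -> closed A -> compact A.
Proof.
move=> [M [Mr hM]] cA.
have M1 z : A z -> `|z| <= M + 1 by apply: hM; rewrite ltrDl.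
have M0 : 0 < `|M| + 1 by rewrite ltr_wpDl.
have c1 : compact (closed_ball (0 : 'rV[R]_N) (`|M| + 1)).
  apply: bounded_closed_compact; last exact: closed_ball_closed.
  exists (`|M| + 1); split; first exact: num_real.
  move=> y hy w; rewrite closed_ballE//= /closed_ball_ /= sub0r normrN => hw.
  exact: (le_trans hw (ltW hy)).
have c2 : compact `[(- (`|M| + 1)), (`|M| + 1)] by exact: segment_compact.
apply: (subclosed_compact cA (compact_setX c1 c2)) => z Az.
have zM : `|z| <= `|M| + 1 by rewrite (le_trans (M1 _ Az))// lerD2r ler_norm.
split; last by rewrite /= in_itv /= -ler_norml (le_trans (le_crd_norm None z)).
rewrite closed_ballE//= /closed_ball_ /= sub0r normrN.
by move: zM; rewrite prod_normE ge_max => /andP[].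
Qed.

End bump.

(** * Compactly supported kernels *)

Lemma closed_norm_sub_le (R : realType) (V : normedModType R) (a : V) (h : R) :
  closed [set w : V | `|w - a| <= h].
Proof.
rewrite (_ : [set w : V | _] = (fun w : V => `|w - a|) @^-1` [set x | x <= h])//.
apply: closed_comp; last exact: closed_le.
move=> z _; apply: (@continuous_comp _ _ _ (fun w : V => w - a) (fun z : V => `|z|)).
  by apply: cvgB; [exact: cvg_id|exact: cvg_cst].
exact: norm_continuous.
Qed.

Lemma test_function_ball (R : realType) (V : normedModType R) (a : V) (h : R)
    (U : set V) (k : V -> R) : compact [set w : V | `|w - a| <= h] ->
  (forall n, Ck n setT k) -> (forall w, h < `|w - a| -> k w = 0) ->
  (forall w, `|w - a| <= h -> U w) -> test_function U k.
Proof.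
move=> cK hC k0 hU; split => //.
have sub : closure [set z : V | k z != 0] `<=` [set w | `|w - a| <= h].
  rewrite closureE; apply: smallest_sub; first exact: closed_norm_sub_le.
  move=> w /=; apply: contraNP => /negP; rewrite -ltNge => /k0 ->.
  by [].
split; last by move=> w /sub /hU.
by apply: (subclosed_compact _ cK) => //; exact: closed_closure.
Qed.

(** Uniform continuity at the points of a compact set, where the second point is
    not required to lie in the set. *)
Lemma compact_unif (R : realType) (V : normedModType R) (K : set V) (k : V -> R) :
  compact K -> (forall x, K x -> {for x, continuous k}) -> forall e, 0 < e ->
  exists2 d, 0 < d & forall z w, K z -> `|z - w| < d -> `|k z - k w| < e.
Proof.
move=> cK ck e e0.
pose P (d : R) (z : V) := forall w, `|z - w| < d -> `|k z - k w| < e.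
have H := (@compact_near_coveringP _ K).1 cK R (0^'+) P _.
have {H}/H hP : forall x : V, K x -> \forall x' \near x & i \near 0^'+, P i x'.
  move=> x Kx.
  have e2 : 0 < e / 2 by rewrite divr_gt0.
  have /cvgrPdist_lt /(_ _ e2) /nbhs_ballP[d /= d0] := ck x Kx.
  rewrite -ball_normE => hd.
  have d2 : 0 < d / 2 by rewrite divr_gt0.
  exists ([set x' | `|x - x'| < d / 2], [set i | i < d / 2]).
    split; first by apply/nbhs_ballP; exists (d / 2) => //; rewrite -ball_normE.
    exact: nbhs_right_lt.
  move=> [x' i] /= [hx' hi] w hw.
  have h1 : `|k x - k x'| < e / 2.
    by apply: hd => /=; apply: lt_le_trans hx' _; rewrite ler_pdivrMr// ler_pMr// ler1n.
  have h2 : `|k x - k w| < e / 2.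
    apply: hd => /=; rewrite [d]splitr -(subrK x' x) -addrA.
    by rewrite (le_lt_trans (ler_normD _ _))// ltrD// (lt_trans hw).
  rewrite [e]splitr -(subrK (k x) (k x')) -addrA (le_lt_trans (ler_normD _ _))// ltrD//.
  by rewrite distrC.
have : \forall d \near 0^'+, 0 < d /\ (forall z, K z -> P d z).
  near=> d; split; first by near: d; exact: nbhs_right_gt.
  by near: d; exact: hP.
by move=> /filter_ex [d [d0 hd]]; exists d => // z w Kz; exact: hd.
Unshelve. all: by end_near. Qed.

Section kernels.
Context {R : realType} (N : nat).
Local Notation Z := ('rV[R]_N * R)%type.
Implicit Types (z w a v : Z) (h : R).

(** Continuous functions supported in the closed ball of radius [h]. *)
Definition ckernel h (k : Z -> R) :=
  continuous k /\ forall z, h < `|z| -> k z = 0.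

Let compact_le h : compact [set z : Z | `|z| <= h].
Proof.
apply: compact_bounded_closed_prod.
  exists h; split; first exact: num_real.
  by move=> y hy z /= zh; exact: le_trans zh (ltW hy).
rewrite (_ : [set z : Z | _] = (fun z : Z => `|z|) @^-1` [set x | x <= h])//.
apply: closed_comp; last exact: closed_le.
by move=> z _; exact: norm_continuous.
Qed.

Lemma ckernel_unif h k : ckernel h k -> forall e, 0 < e ->
  exists2 d, 0 < d & forall z w, `|z - w| < d -> `|k z - k w| < e.
Proof.
move=> [ck k0] e e0.
have [d d0 hd] := @compact_unif R Z _ k (@compact_le (h + 1)) (fun x _ => ck x) e e0.
exists (Num.min d 1); first by rewrite lt_min d0 ltr01.
move=> z w; rewrite lt_min => /andP[zw zw1].
have [zh|zh] := leP `|z| (h + 1); first exact: hd zw.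
rewrite k0; last by apply: lt_trans zh; rewrite ltrDl.
rewrite k0 ?subrr ?normr0//.
rewrite -(ltrD2r 1) (lt_trans zh)// -{1}(subrK w z) addrC.
by rewrite (le_lt_trans (ler_normD _ _))// ltrD2l.
Qed.

Lemma ckernel_bounded h k : ckernel h k -> exists2 M, 0 <= M & forall z, `|k z| <= M.
Proof.
move=> [ck k0].
have c : {within [set z : Z | `|z| <= `|h|], continuous (fun z => `|k z|)}.
  apply: continuous_subspaceT => z.
  by apply: (@continuous_comp _ _ _ k (fun x : R => `|x|)); [exact: ck|exact: norm_continuous].
have [] := @compact_EVT_max _ R _ _ _ (@compact_le `|h|) c.
  by exists 0 => /=; rewrite normr0.
move=> y _ hy; exists `|k y| => // z.
have [zh|zh] := leP `|z| `|h|; first by apply: hy; rewrite inE.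
by rewrite k0 ?normr0// (le_lt_trans (ler_norm _)).
Qed.

(** The derivative vanishes on the open set where the kernel vanishes identically. *)
Lemma ckernel_derive h k v : Ck 1 setT k -> ckernel h k -> ckernel h ('D_v k).
Proof.
move=> [_ /(_ v) cD] [ck k0]; split; first by move=> z; exact: cD.
move=> z zh; rewrite (@near_eq_derive _ _ _ k (cst 0)) ?derive_cst//.
have : nbhs (`|z|) [set x | h < x].
  by apply: open_nbhs_nbhs; split => //; exact: open_gt.
move=> /(@norm_continuous _ _ z) H.
by near=> w; rewrite k0//; near: w; exact: H.
Unshelve. all: by end_near. Qed.

Lemma ckernel_bumpz h : ckernel h (bumpz h : Z -> R).
Proof.
split; last by move=> z /ltW; exact: bumpz_eq0.
have H := @Ck_bumpz R N h 0 0; move=> z.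
move: H => /= H.
have := H z Logic.I; rewrite (_ : (fun z => bumpz h (z - 0)) = bumpz h)//.
by apply/funext => w; rewrite subr0.
Qed.

Lemma test_function_ckernel (Q : set Z) h k a : (forall n, Ck n setT (fun z => k (z - a))) ->
  ckernel h k -> (forall w, `|w - a| <= h -> Q w) ->
  test_function Q (fun z => k (z - a)).
Proof.
move=> hC [ck k0] hQ; apply: (@test_function_ball _ _ a h) => // [|w aw]; last exact: k0.
apply: (@subclosed_compact _ _ [set z : Z | `|z| <= h + `|a|]); first exact: closed_norm_sub_le.
  exact: compact_le.
by move=> w /= wh; rewrite -(subrK a w) (le_trans (ler_normD _ _))// lerD2r.
Qed.

End kernels.

(** * Mollification *)

Section convolution.
Context {R : realType} (N : nat).
Local Notation Z := ('rV[R]_N * R)%type.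
Local Notation T := ('rV[R]_N * measurableTypeR R)%type.
Local Notation mu := (@lebesgue_st R N).
Implicit Types (z w a v : Z) (h : R) (k g : Z -> R) (Q : set Z).

(** The kernel is centred at [z] and [g] is only evaluated in [Q]. For an even
    kernel and [z] at distance more than [h] from the boundary of [Q] this is the
    usual convolution. *)
Definition convolve Q k g z : R := \int[mu]_(w in Q) (k (w - z) * g w).

Lemma near_norm_lt z (d : R) : 0 < d -> \forall w \near z, `|z - w| < d.
Proof.
by move=> d0; apply/nbhs_ballP; exists d => //= w; rewrite -ball_normE.
Qed.

Lemma continuous_measurable_st k : continuous k -> measurable_fun [set: T] k.
Proof.
by move=> ck; apply: (@continuous_on_measurable R N [set: Z]) => [|z _]; [exact: (@openT Z)|exact: ck].
Qed.

Lemma continuous_translate k a : continuous k -> continuous (fun w => k (w - a)).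
Proof.
move=> ck w; apply: (@continuous_comp _ _ _ (fun w : Z => w - a) k); last exact: ck.
by apply: cvgB; [exact: cvg_id|exact: cvg_cst].
Qed.

Lemma integrable_bounded_mul d (X : measurableType d) (m : {measure set X -> \bar R})
    (D : set X) (k g : X -> R) (M : R) :
  measurable D -> measurable_fun D k -> (forall x, D x -> `|k x| <= M) ->
  m.-integrable D (EFin \o g) -> m.-integrable D (EFin \o (fun x => k x * g x)).
Proof.
move=> mD mk kM ig.
have mg : measurable_fun D g by apply/measurable_EFinP; case/integrableP: ig.
apply: (@le_integrable _ _ _ m D mD _ (fun x => (M * g x)%:E)).
- by apply/measurable_EFinP; exact: measurable_funM.
- move=> x Dx; rewrite lee_fin !normrM ler_wpM2r//.
  by rewrite (le_trans (kM _ Dx))// ler_norm.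
- by under eq_fun do rewrite EFinM; exact: integrableZl.
Qed.

Lemma integrable_EFinD d (X : measurableType d) (m : {measure set X -> \bar R})
    (D : set X) (f g : X -> R) : measurable D ->
  m.-integrable D (EFin \o f) -> m.-integrable D (EFin \o g) ->
  m.-integrable D (EFin \o (fun x => f x + g x)).
Proof. by move=> mD hf hg; exact: (integrableD mD hf hg). Qed.

Lemma integrable_EFinB d (X : measurableType d) (m : {measure set X -> \bar R})
    (D : set X) (f g : X -> R) : measurable D ->
  m.-integrable D (EFin \o f) -> m.-integrable D (EFin \o g) ->
  m.-integrable D (EFin \o (fun x => f x - g x)).
Proof. by move=> mD hf hg; exact: (integrableB mD hf hg). Qed.

Lemma integrable_EFinZ d (X : measurableType d) (m : {measure set X -> \bar R})
    (D : set X) (c : R) (f : X -> R) : measurable D ->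
  m.-integrable D (EFin \o f) -> m.-integrable D (EFin \o (fun x => c * f x)).
Proof. by move=> mD hf; exact: (integrableZl mD c hf). Qed.

Section fixed_function.
Variables (Q : set Z) (g : Z -> R).
Hypotheses (mQ : measurable (Q : set T)) (ig : mu.-integrable Q (EFin \o g)).

Let mg : measurable_fun (Q : set T) g.
Proof. by apply/measurable_EFinP; case/integrableP: ig. Qed.

Lemma integrable_convolve h k z : ckernel h k ->
  mu.-integrable Q (EFin \o (fun w => k (w - z) * g w)).
Proof.
move=> hk; have [M M0 kM] := ckernel_bounded hk.
apply: (@integrable_bounded_mul _ T mu Q (fun w => k (w - z)) g M) => //.
apply: measurable_funTS; apply: continuous_measurable_st.
by apply: continuous_translate; case: hk.
Qed.

Let G := \int[mu]_(w in Q) `|g w|.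

Let G0 : 0 <= G. Proof. exact: Rintegral_ge0. Qed.

Let iabs : mu.-integrable Q (EFin \o (fun w => `|g w|)).
Proof. exact: (integrable_norm ig). Qed.

Lemma integral_mul_le (k : Z -> R) e : (forall w, Q w -> `|k w| <= e) ->
  measurable_fun (Q : set T) k ->
  `|\int[mu]_(w in Q) (k w * g w)| <= e * \int[mu]_(w in Q) `|g w|.
Proof.
move=> ke mk.
have ikg := @integrable_bounded_mul _ T mu Q k g e mQ mk ke ig.
apply: le_trans (le_normr_Rintegral mQ ikg) _.
rewrite -RintegralZl//; apply: le_Rintegral => //.
- exact: (integrable_norm ikg).
- by under [X in _.-integrable _ X]eq_fun do rewrite /= EFinM; exact: integrableZl.
- by move=> w Qw; rewrite normrM ler_wpM2r// ke.
Qed.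

(** Follows from the uniform continuity of the kernel. *)
Lemma convolve_continuous h k : ckernel h k -> continuous (convolve Q k g).
Proof.
move=> hk z; apply/cvgrPdist_lt => e e0.
have d0 : 0 < e / (G + 1) by rewrite divr_gt0// ltr_wpDl.
have [d dd0 hd] := ckernel_unif hk d0.
near=> y.
have zy : `|z - y| < d.
  by near: y; exact: near_norm_lt.
rewrite /convolve -RintegralB//; [|exact: (integrable_convolve _ hk)..].
under eq_Rintegral do rewrite -mulrBl.
apply: le_lt_trans (@integral_mul_le _ (e / (G + 1)) _ _) _.
- move=> w _; apply/ltW/hd; rewrite opprB addrC addrA subrK.
  by rewrite distrC.
- apply: measurable_funB; apply: measurable_funTS; apply: continuous_measurable_st;
  by apply: continuous_translate; case: hk.
- by rewrite mulrAC ltr_pdivrMr ?ltr_wpDl// ltr_pM2l// ltrDl.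
Unshelve. all: by end_near. Qed.

(** By the mean value theorem and the uniform continuity of [dk], the difference
    quotients of the kernel converge uniformly. The sign is that of the
    derivative of w - z in [z]. *)
Lemma convolve_derive h k (dk : Z -> R) z v :
  (forall y, is_derive y v k (dk y)) -> ckernel h k -> ckernel h dk ->
  is_derive z v (convolve Q k g) (- convolve Q dk g z).
Proof.
move=> kdk hk hdk; apply: is_derive_cvg; apply/cvgrPdist_le => e e0.
have d0 : 0 < e / (G + 1) by rewrite divr_gt0// ltr_wpDl.
have [d dd0 hd] := ckernel_unif hdk d0.
near=> s.
have s0 : s != 0 by near: s; exact: nbhs_dnbhs_neq.
have sv : `|s| * `|v| < d.
  rewrite (@le_lt_trans _ _ (`|s| * (`|v| + 1)))//; first by rewrite ler_wpM2l// lerDl.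
  rewrite -ltr_pdivlMr ?ltr_wpDl//.
  by near: s; apply: dnbhs0_lt; rewrite divr_gt0// ltr_wpDl.
rewrite -normrN opprD !opprK.
have -> : convolve Q dk g z + s^-1 *: (convolve Q k g (s *: v + z) - convolve Q k g z) =
   \int[mu]_(w in Q) ((dk (w - z) + s^-1 * (k (w - (s *: v + z)) - k (w - z))) * g w).
  rewrite /convolve -RintegralB//; [|exact: (integrable_convolve _ hk)..].
  have iB : mu.-integrable Q (EFin \o (fun w => k (w - (s *: v + z)) * g w - k (w - z) * g w)).
    by apply: integrable_EFinB => //; exact: (integrable_convolve _ hk).
  rewrite -[s^-1 *: _]/(s^-1 * _) -RintegralZl// -RintegralD//.
  - by apply: eq_Rintegral => w _; ring.
  - exact: (integrable_convolve _ hdk).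
  - exact: integrable_EFinZ.
have mk a : measurable_fun (Q : set T) (fun w => k (w - a)).
  apply: measurable_funTS; apply: continuous_measurable_st.
  by apply: continuous_translate; case: hk.
have mdk a : measurable_fun (Q : set T) (fun w => dk (w - a)).
  apply: measurable_funTS; apply: continuous_measurable_st.
  by apply: continuous_translate; case: hdk.
apply: le_trans (@integral_mul_le _ (e / (G + 1)) _ _) _.
- move=> w _.
  have [t ts] := MVT_directional (w - z) (- s) kdk.
  rewrite (_ : - s *: v + (w - z) = w - (s *: v + z)); last first.
    by rewrite opprD scaleNr addrC -addrA; congr (_ + _); rewrite addrC.
  move=> ->; rewrite mulrN mulrN mulrC mulfK//.
  apply/ltW/hd.
  rewrite opprD addrA addrAC subrr sub0r normrN normrZ.
  by rewrite (le_lt_trans _ sv)// ler_wpM2r// (le_trans ts)// normrN.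
- apply: measurable_funD => //; apply: measurable_funM => //.
  by apply: measurable_funB.
- by rewrite mulrAC ler_pdivrMr ?ltr_wpDl// ler_pM2l// lerDl.
Unshelve. all: by end_near. Qed.

End fixed_function.
End convolution.
Section sigma_finite_st.
Context {R : realType} (N : nat).
Local Notation T := ('rV[R]_N * measurableTypeR R)%type.

Lemma lebesgue_st_sigma_finite : sigma_finite [set: T] (@lebesgue_st R N).
Proof.
exists (fun n => ball (0 : 'rV[R]_N * R) n.+1%:R); last first.
  by move=> n; split; [exact: measurable_ball_st|rewrite lebesgue_st_ball ?ltry].
apply/seteqP; split => // z _.
exists (Num.bound `|z : 'rV[R]_N * R|) => //.
rewrite -ball_normE /= sub0r normrN.
have /archi_boundP h := normr_ge0 (z : 'rV[R]_N * R).
by apply: (lt_le_trans h); rewrite ler_nat.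
Qed.

(** A copy of the space-time measure carrying its sigma-finiteness, for the use
    of the theorem of Tonelli. *)
Definition st_measure : set T -> \bar R := @lebesgue_st R N.

HB.instance Definition _ := Measure.copy st_measure (@lebesgue_st R N : set _ -> \bar R).
HB.instance Definition _ := Measure_isSigmaFinite.Build _ _ _ st_measure lebesgue_st_sigma_finite.
End sigma_finite_st.

Section mollification.
Context {R : realType} (N : nat).
Local Notation Z := ('rV[R]_N * R)%type.
Local Notation T := ('rV[R]_N * measurableTypeR R)%type.
Local Notation mu := (@lebesgue_st R N).
Implicit Types (z w a v : Z) (h : R) (k g : Z -> R) (Q B : set Z).

Lemma integrable_ckernel h k : ckernel h k -> mu.-integrable setT (EFin \o k).
Proof.
move=> hk; have [M M0 kM] := ckernel_bounded hk.
have mk := continuous_measurable_st (proj1 hk).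
have mb : measurable (ball (0 : Z) (`|h| + 1) : set T) by exact: measurable_ball_st.
rewrite (_ : EFin \o k = (EFin \o k) \_ (ball (0 : Z) (`|h| + 1))); last first.
  apply/funext => z; rewrite /patch; case: ifPn => // /negP; rewrite inE => zb.
  rewrite /= (proj2 hk)//; apply: contra_notT zb; rewrite -leNgt => zh.
  rewrite -ball_normE /= sub0r normrN (le_lt_trans zh)// (le_lt_trans (ler_norm _))//.
  by rewrite ltrDl.
apply/(integrable_mkcond _ mb).
apply: measurable_bounded_integrable => //.
- by rewrite lebesgue_st_ball ?ltry// ltr_wpDl.
- exact: measurable_funTS.
- exists M; split; first exact: num_real.
  by move=> y My z _; exact: (le_trans (kM z) (ltW My)).
Qed.

Lemma integral_translate (f : Z -> \bar R) a : measurable_fun [set: T] f ->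
  (\int[mu]_z f (z + a)%R = \int[mu]_z f z)%E.
Proof. by move=> mf; exact: (preserving_integral (preserving_shift a) mf). Qed.

Definition bump_mass h : R := \int[mu]_z bumpz h z.

Lemma bump_mass_gt0 h : 0 < h -> 0 < bump_mass h.
Proof.
move=> h0.
have ik := integrable_ckernel (@ckernel_bumpz R N h).
rewrite /bump_mass /Rintegral fine_gt0//; apply/andP; split; last first.
  by have /fin_numPlt/andP[] := integrable_fin_num measurableT ik.
pose c := bumpz h (0 : Z).
have c0 : 0 < c by apply: bumpz_gt0; rewrite normr0.
have [ck _] := @ckernel_bumpz R N h.
have c2 : 0 < c / 2 by rewrite divr_gt0.
have /cvgrPdist_lt /(_ _ c2) /nbhs_ballP[d /= d0 hd] := ck 0.
have mb : measurable (ball (0 : Z) d : set T) by exact: measurable_ball_st.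
have mk : measurable_fun setT (EFin \o bumpz h : T -> \bar R).
  by apply/measurable_EFinP; exact: continuous_measurable_st.
apply: (@lt_le_trans _ _ (\int[mu]_(z in ball (0 : Z)%R d) (c / 2)%:E)%E).
  rewrite integral_cst// mule_gt0 ?lte_fin//.
  by rewrite lebesgue_st_ball// lte_fin exprn_gt0// pmulrn_rgt0.
apply: (@le_trans _ _ (\int[mu]_(z in ball (0 : Z)%R d) (bumpz h z)%:E)%E).
  apply: ge0_le_integral => //.
  - by move=> *; rewrite lee_fin ltW.
  - exact: measurable_funTS.
  - move=> z /hd /=; rewrite lee_fin -/c ltr_distlC => /andP[+ _].
    by rewrite {1}[c]splitr addrK => /ltW.
apply: ge0_subset_integral => //.
by move=> z _; rewrite lee_fin bumpz_ge0.
Qed.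

Definition mollifier h z : R := (bump_mass h)^-1 * bumpz h z.

Lemma mollifier_ge0 h z : 0 < h -> 0 <= mollifier h z.
Proof. by move=> h0; rewrite mulr_ge0 ?bumpz_ge0// invr_ge0 ltW// bump_mass_gt0. Qed.

Lemma ckernel_mollifier h : ckernel h (mollifier h).
Proof.
have [ck k0] := @ckernel_bumpz R N h; split.
  by move=> z; apply: cvgM; [exact: cvg_cst|exact: ck].
by move=> z hz; rewrite /mollifier k0// mulr0.
Qed.

Lemma Ck_mollifier h a n : Ck n setT (fun z => mollifier h (z - a)).
Proof. by apply: Ck_mul; [exact: Ck_cst|exact: Ck_bumpz]. Qed.

Lemma mollifier_even h z : mollifier h (- z) = mollifier h z.
Proof. by rewrite /mollifier bumpz_even. Qed.

Let m_moll h : measurable_fun setT (mollifier h : T -> R).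
Proof. by apply: continuous_measurable_st; case: (ckernel_mollifier h). Qed.

Lemma integral_mollifier h a : 0 < h ->
  (\int[mu]_z (mollifier h (z - a))%:E = 1)%E.
Proof.
move=> h0.
rewrite (integral_translate (f := fun z => (mollifier h z)%:E)); last first.
  by apply/measurable_EFinP.
rewrite /mollifier; under eq_integral do rewrite EFinM.
rewrite integralZl//; last exact: (integrable_ckernel (@ckernel_bumpz R N h)).
rewrite -[X in (_ * X)%E]fineK; last first.
  exact: (integrable_fin_num measurableT (integrable_ckernel (@ckernel_bumpz R N h))).
by rewrite -EFinM mulVf// gt_eqF// bump_mass_gt0.
Qed.

Lemma integral_mollifier_supp h Q z : 0 < h -> measurable (Q : set T) ->
  (forall w, `|w - z| <= h -> Q w) ->
  \int[mu]_(w in Q) mollifier h (w - z) = 1.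
Proof.
move=> h0 mQ hQ; rewrite Rintegral_mkcond (_ : _ \_ _ = fun w => mollifier h (w - z)).
  by rewrite /Rintegral integral_mollifier.
apply/funext => w; rewrite /patch; case: ifPn => // /negP; rewrite inE => nQ.
have [_ ->//] := ckernel_mollifier h.
by rewrite ltNge; apply/negP => /hQ.
Qed.

Lemma convolve_cst h Q z c : 0 < h -> measurable (Q : set T) ->
  (forall w, `|w - z| <= h -> Q w) -> convolve Q (mollifier h) (cst c) z = c.
Proof.
move=> h0 mQ hQ; rewrite /convolve RintegralZr//.
  by rewrite integral_mollifier_supp// mul1r.
apply: (@integrableS _ _ _ mu setT Q _ measurableT mQ) => //.
apply: (@integrable_ckernel (h + `|z|)); split.
  by apply: continuous_translate; case: (ckernel_mollifier h).
move=> w hw; have [_ ->//] := ckernel_mollifier h.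
by rewrite -(ltrD2r `|z|) (lt_le_trans hw)// -{1}(subrK z w) ler_normD.
Qed.

(** Tonelli: the mollifier has integral 1 in each of its two arguments, by
    translation invariance and evenness. *)
Lemma convolve_L1_le h Q g : 0 < h -> measurable (Q : set T) ->
  mu.-integrable Q (EFin \o g) ->
  (\int[mu]_z `|convolve Q (mollifier h) g z|%:E <= \int[mu]_(w in Q) `|g w|%:E)%E.
Proof.
move=> h0 mQ ig.
have mg : measurable_fun (Q : set T) g by apply/measurable_EFinP; case/integrableP: ig.
pose g' : T -> R := (fun w => `|g w|) \_ Q.
have mg' : measurable_fun setT g'.
  by apply/(measurable_restrictT _ mQ); exact: measurableT_comp.
have g'0 w : 0 <= g' w by rewrite /g' /patch; case: ifP.
pose F (zw : T * T) : \bar R := (mollifier h (zw.2 - zw.1) * g' zw.2)%:E.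
have mF : measurable_fun setT F.
  apply/measurable_EFinP; apply: measurable_funM; last first.
    exact: (measurableT_comp mg' measurable_snd).
  have ms : measurable_fun setT (fun zw : T * T => (zw.2 - zw.1 : T)).
    apply/measurable_fun_pairP; split; last first.
      apply: measurable_funB.
        exact: (measurableT_comp measurable_snd measurable_snd).
      exact: (measurableT_comp measurable_snd measurable_fst).
    apply/measurable_fun_rVP => j.
    under eq_fun do rewrite !mxE.
    have mc := @measurable_crd R N (Some j).
    apply: measurable_funB.
      exact: (measurableT_comp mc measurable_snd).
    exact: (measurableT_comp mc measurable_fst).
  exact: (measurableT_comp (m_moll h) ms).
have F0 zw : (0 <= F zw)%E by rewrite lee_fin mulr_ge0// mollifier_ge0.
pose m : {sigma_finite_measure set T -> \bar R} := @st_measure R N.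
apply: (@le_trans _ _ (\int[m]_z \int[m]_w F (z, w))%E).
  apply: ge0_le_integral => //.
  - apply/measurable_EFinP; apply: measurableT_comp => //.
    apply: continuous_measurable_st; apply: convolve_continuous => //.
    exact: (ckernel_mollifier h).
  - exact: (@measurable_fun_fubini_tonelli_F _ _ T T R m F mF F0).
  - move=> z _; rewrite EFin_normr_Rintegral//; last first.
      exact: (integrable_convolve _ _ _ (ckernel_mollifier h)).
    have mkg : measurable_fun (Q : set T) (fun w => mollifier h (w - z) * g w).
      apply: measurable_funM => //; apply: measurable_funTS.
      apply: continuous_measurable_st; apply: continuous_translate.
      by case: (ckernel_mollifier h).
    apply: (@le_trans _ _ (\int[mu]_(w in Q) `|mollifier h (w - z) * g w|%:E)%E).
      apply: (le_trans (le_abse_integral _ _ _)) => //.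
      exact/measurable_EFinP.
    rewrite integral_mkcond [leRHS](_ : _ = (\int[mu]_w F (z, w))%E)//.
    rewrite le_eqVlt; apply/orP; left; apply/eqP; apply: eq_integral => w _.
    rewrite /F /g' /patch /=; case: ifP => _; last by rewrite mulr0.
    by rewrite normrM ger0_norm// mollifier_ge0.
rewrite (@fubini_tonelli _ _ T T R m m F mF F0).
rewrite [leRHS]integral_mkcond.
apply: ge0_le_integral => //.
- by move=> w _; apply: integral_ge0.
- exact: (@measurable_fun_fubini_tonelli_G _ _ T T R m F mF F0).
- by apply/(measurable_restrictT _ mQ); apply/measurable_EFinP; exact: measurableT_comp.
move=> w _; rewrite /F /=.
under eq_integral do rewrite -opprB mollifier_even mulrC EFinM.
rewrite ge0_integralZl//.
- rewrite (integral_mollifier w h0) mule1 /g' /patch; case: ifP => //.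
- apply/measurable_EFinP; apply: continuous_measurable_st; apply: continuous_translate.
  by case: (ckernel_mollifier h).
- by move=> z _; rewrite lee_fin mollifier_ge0.
- by rewrite lee_fin.
Qed.

Lemma integrable_mollified h Q g z : measurable (Q : set T) ->
  mu.-integrable Q (EFin \o g) ->
  mu.-integrable Q (EFin \o (fun w => mollifier h (w - z) * g w)).
Proof. by move=> mQ ig; exact: (integrable_convolve mQ ig z (ckernel_mollifier h)). Qed.

(** The kernel is nonnegative, so pointwise bounds near [z] carry over. *)
Lemma convolve_le h Q g (b : Z -> R) z : 0 < h -> measurable (Q : set T) ->
  mu.-integrable Q (EFin \o g) -> mu.-integrable Q (EFin \o b) ->
  (forall w, Q w -> `|w - z| <= h -> `|g w| <= b w) ->
  `|convolve Q (mollifier h) g z| <= convolve Q (mollifier h) b z.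
Proof.
move=> h0 mQ ig ib gb.
have ikg := integrable_mollified h z mQ ig.
apply: le_trans (le_normr_Rintegral mQ ikg) _; apply: le_Rintegral => //.
- exact: (integrable_norm ikg).
- exact: integrable_mollified.
- move=> w Qw; rewrite normrM ger0_norm ?mollifier_ge0//.
  have [wz|wz] := leP `|w - z| h; first by rewrite ler_wpM2l ?mollifier_ge0 ?gb.
  by have [_ ->//] := ckernel_mollifier h; rewrite !mul0r.
Qed.

Lemma convolveD h Q f g z : measurable (Q : set T) ->
  mu.-integrable Q (EFin \o f) -> mu.-integrable Q (EFin \o g) ->
  convolve Q (mollifier h) (fun w => f w + g w) z =
  convolve Q (mollifier h) f z + convolve Q (mollifier h) g z.
Proof.
move=> mQ jf jg; rewrite /convolve -RintegralD//.
- by apply: eq_Rintegral => w _; rewrite mulrDr.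
- exact: integrable_mollified.
- exact: integrable_mollified.
Qed.

Lemma convolveB h Q f g z : measurable (Q : set T) ->
  mu.-integrable Q (EFin \o f) -> mu.-integrable Q (EFin \o g) ->
  convolve Q (mollifier h) (fun w => f w - g w) z =
  convolve Q (mollifier h) f z - convolve Q (mollifier h) g z.
Proof.
move=> mQ jf jg; rewrite /convolve -RintegralB//.
- by apply: eq_Rintegral => w _; rewrite mulrBr.
- exact: integrable_mollified.
- exact: integrable_mollified.
Qed.

Lemma integrable_continuous_bounded Q k (M : R) : measurable (Q : set T) -> bounded_set Q ->
  continuous k -> (forall z, `|k z| <= M) -> mu.-integrable Q (EFin \o k).
Proof.
move=> mQ bQ ck kM; apply: measurable_bounded_integrable => //.
- exact: lebesgue_st_bounded.
- by apply: measurable_funTS; exact: continuous_measurable_st.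
- exists M; split; first exact: num_real.
  by move=> y My z _; exact: (le_trans (kM z) (ltW My)).
Qed.

(** Approximate [g] in L1 by a bounded continuous [k]: mollifications of [k]
    converge boundedly and pointwise, and mollification does not increase the L1
    norm of g - k. *)
Lemma convolve_L1_cvg Q B g (r : R) (h_ : nat -> R) :
  measurable (Q : set T) -> bounded_set Q -> measurable (B : set T) ->
  (forall z, B z -> forall w, `|w - z| <= r -> Q w) ->
  (forall n, 0 < h_ n <= r) -> h_ n @[n --> \oo] --> 0 ->
  mu.-integrable Q (EFin \o g) ->
  forall e, 0 < e -> \forall n \near \oo,
    (\int[mu]_(z in B) `|convolve Q (mollifier (h_ n)) g z - g z|%:E <= e%:E)%E.
Proof.
move=> mQ bQ mB BQ hr h0 ig e e0.
have r0 : 0 < r by have /andP[a b] := hr 0%N; exact: lt_le_trans b.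
have hn0 n : 0 < h_ n by have /andP[] := hr n.
have hnr n : h_ n <= r by have /andP[] := hr n.
have BsQ : B `<=` Q by move=> z Bz; apply: (BQ z Bz); rewrite subrr normr0 ltW.
have e3 : 0 < e / 3 by rewrite divr_gt0.
have [k [ck [M kM]] hk] := spacetime_density mQ bQ ig e3.
have ik := integrable_continuous_bounded mQ bQ ck kM.
have mg : measurable_fun (Q : set T) g by apply/measurable_EFinP; case/integrableP: ig.
have mk : measurable_fun [set: T] k by exact: continuous_measurable_st.
have mc n (f : Z -> R) : mu.-integrable Q (EFin \o f) ->
    measurable_fun [set: T] (convolve Q (mollifier (h_ n)) f).
  move=> jf; apply: continuous_measurable_st.
  exact: (convolve_continuous mQ jf (ckernel_mollifier (h_ n))).
have icst c : mu.-integrable Q (EFin \o (cst c : Z -> R)).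
  apply: (@integrable_continuous_bounded _ _ `|c|) => //.
  by move=> z; exact: cvg_cst.
have ccst n z c : B z -> convolve Q (mollifier (h_ n)) (cst c) z = c.
  by move=> Bz; apply: convolve_cst => // w wz; apply: (BQ z Bz); exact: le_trans (hnr n).
have M0 : 0 <= M by exact: le_trans (normr_ge0 _) (kM 0).
(* Uniform convergence of the mollifications of the continuous approximant k. *)
have Hk : \forall n \near \oo,
    (\int[mu]_(z in B) `|convolve Q (mollifier (h_ n)) k z - k z|%:E <= (e / 3)%:E)%E.
  have [] := @dominated_convergence _ _ _ mu B mB
    (fun n z => (convolve Q (mollifier (h_ n)) k z - k z)%:E) (cst 0%E) (cst (M + M)%:E).
  - move=> n; apply/measurable_EFinP; apply: measurable_funTS.
    by apply: measurable_funB => //; exact: mc.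
  - exact: measurable_cst.
  - apply: aeW => z Bz; apply: cvg_EFin; first exact: nearW.
    apply/cvgrPdist_le => d d0.
    have /cvgrPdist_lt /(_ _ d0) /nbhs_ballP[s /= s0] := ck z.
    rewrite -ball_normE => hs.
    move/cvgrPdist_lt : h0 => /(_ _ s0).
    apply: filterS => n /=; rewrite !sub0r !normrN (ger0_norm (ltW (hn0 n))) => hns.
    have -> : convolve Q (mollifier (h_ n)) k z - k z =
        convolve Q (mollifier (h_ n)) (fun w => k w - cst (k z) w) z.
      by rewrite convolveB// ccst.
    rewrite -(ccst n z d Bz); apply: convolve_le => //.
    + exact: integrable_EFinB.
    + move=> w _ wz /=; rewrite distrC; apply/ltW/hs => /=.
      by rewrite distrC; exact: le_lt_trans wz hns.
  - apply/integrableP; split; first exact: measurable_cst.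
    rewrite integral_cst//= lte_mul_pinfty ?lee_fin//.
    apply: lebesgue_st_bounded => //.
    move: bQ => [L [Lr hL]]; exists L; split => // y Ly z Bz.
    by apply: (hL y Ly); exact: BsQ.
  - apply: aeW => z n Bz /=; rewrite lee_fin.
    rewrite (le_trans (ler_normB _ _))// lerD//.
    by rewrite -(ccst n z M Bz); apply: convolve_le.
  move=> _ + _; rewrite (_ : [sequence _]_n = fun n =>
     (\int[mu]_(z in B) `|convolve Q (mollifier (h_ n)) k z - k z|%:E)%E); last first.
    apply/funext => n; apply: eq_integral => z _.
    by rewrite /= ?sube0 ?subr0.
  move=> /fine_cvgP[fin /cvgrPdist_lt /(_ _ e3) H].
  apply: filterS2 fin H => n Hf.
  rewrite /= sub0r normrN => Hd.
  by rewrite -(fineK Hf) lee_fin (le_trans (ler_norm _) (ltW Hd)).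
apply: filterS Hk => n Hn.
have mcn f (jf : mu.-integrable Q (EFin \o f)) :
    measurable_fun (B : set T) (fun z => `|convolve Q (mollifier (h_ n)) f z|%:E).
  by apply/measurable_EFinP; apply: measurableT_comp => //; apply: measurable_funTS; exact: mc.
have igk : mu.-integrable Q (EFin \o (fun w => g w - k w)) by exact: integrable_EFinB.
have mBg : measurable_fun (B : set T) g by apply: measurable_funS mg.
have mBk : measurable_fun (B : set T) k by exact: measurable_funTS.
have m2 : measurable_fun (B : set T)
    (fun z => `|convolve Q (mollifier (h_ n)) k z - k z|%:E).
  apply/measurable_EFinP; apply: measurableT_comp => //; apply: measurable_funB => //.
  by apply: measurable_funTS; exact: mc.
have m3 : measurable_fun (B : set T) (fun z => `|g z - k z|%:E).
  by apply/measurable_EFinP; apply: measurableT_comp => //; exact: measurable_funB.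
apply: (@le_trans _ _ (\int[mu]_(z in B)
   (`|convolve Q (mollifier (h_ n)) (fun w => g w - k w) z|%:E +
    (`|convolve Q (mollifier (h_ n)) k z - k z|%:E + `|g z - k z|%:E)))%E).
  apply: ge0_le_integral => //.
  - apply/measurable_EFinP; apply: measurableT_comp => //; apply: measurable_funB => //.
    by apply: measurable_funTS; exact: mc.
  - by apply: emeasurable_funD; [exact: mcn|exact: emeasurable_funD].
  - move=> z Bz; rewrite -!EFinD lee_fin convolveB//.
    set a := convolve _ _ g z; set b := convolve _ _ k z.
    have -> : a - g z = (a - b) + ((b - k z) - (g z - k z)) by ring.
    by rewrite (le_trans (ler_normD _ _))// lerD2l ler_normB.
rewrite ge0_integralD//=; [|exact: mcn|by move=> *; rewrite lee_fin addr_ge0|exact: emeasurable_funD].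
rewrite ge0_integralD//=.
have -> : e = e / 3 + (e / 3 + e / 3) by lra.
rewrite !EFinD; apply: leeD; last apply: leeD => //.
- apply: le_trans hk.
  apply: le_trans (convolve_L1_le (hn0 n) mQ igk).
  apply: ge0_subset_integral => //.
  by apply/measurable_EFinP; apply: measurableT_comp => //; exact: mc.
- apply: le_trans hk; apply: ge0_subset_integral => //.
  by apply/measurable_EFinP; apply: measurableT_comp => //; apply: measurable_funB => //; exact: measurable_funTS.
Qed.

End mollification.

(** * Almost everywhere convergence of mollifications *)

Section almost_everywhere.
Context {R : realType}.

(** The sum of the functions [`|e_ n|] is integrable, hence almost everywhere
    finite, and the terms of a convergent series tend to 0. *)
Lemma ae_cvg0 d (X : measurableType d) (m : {measure set X -> \bar R}) (B : set X)
    (e_ : (X -> R)^nat) : measurable B -> (forall n, measurable_fun B (e_ n)) ->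
  (forall n, \int[m]_(x in B) `|e_ n x|%:E <= (1 / (2 ^ n.+1)%:R)%:E)%E ->
  {ae m, forall x, B x -> e_ n x @[n --> \oo] --> 0}.
Proof.
move=> mB me He.
have mae n : measurable_fun B (fun x => `|e_ n x|%:E).
  by apply/measurable_EFinP; exact: measurableT_comp.
have iS : m.-integrable B (fun x => \sum_(n <oo) `|e_ n x|%:E)%E.
  apply/integrableP; split.
    by apply: ge0_emeasurable_sum => // n x Bx _; rewrite lee_fin.
  under eq_integral do rewrite gee0_abs ?nneseries_ge0//.
  rewrite integral_nneseries//.
  apply: (@le_lt_trans _ _ 1%E); last by rewrite ltry.
  apply: le_trans (@epsilon_trick0 R 1 xpredT ler01).
  by apply: lee_nneseries => [i _ _|n _]; [exact: integral_ge0|exact: He].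
have := integrable_ae mB iS; apply: filterS => x H Bx.
have fin : (\sum_(n <oo) `|e_ n x|%:E < +oo)%E by have /fin_numPlt/andP[] := H Bx.
have tail := nneseries_tail_cvg fin (fun k _ => normr_ge0 _ : (0%R <= `|e_ k x|%:E)%E).
apply/cvgrPdist_lt => e e0.
have /fine_cvgP[fnt /cvgrPdist_lt /(_ _ e0) Ht] := tail.
apply: filterS2 fnt Ht => n fn; rewrite !sub0r !normrN => hn.
rewrite -lte_fin; apply: (@le_lt_trans _ _ (\sum_(n <= k <oo) `|e_ k x|%:E)%E).
  have := @nneseries_lim_ge R (fun k => `|e_ k x|%:E) xpredT n n.+1.
  by rewrite big_nat1; apply => k _ _; rewrite lee_fin.
by rewrite -(fineK fn) lte_fin (le_lt_trans (ler_norm _) hn).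
Qed.

End almost_everywhere.

Section mollification_sequence.
Context {R : realType} (N : nat).
Local Notation Z := ('rV[R]_N * R)%type.
Local Notation T := ('rV[R]_N * measurableTypeR R)%type.
Local Notation mu := (@lebesgue_st R N).

(** L1 convergence is fast along a suitable sequence of scales, chosen here for
    finitely many functions simultaneously. *)
Theorem mollify_ae (J : finType) (g : J -> Z -> R) (Q B : set Z) (r : R) :
  measurable (Q : set T) -> bounded_set Q -> measurable (B : set T) -> 0 < r ->
  (forall z, B z -> forall w, `|w - z| <= r -> Q w) ->
  (forall j, mu.-integrable Q (EFin \o g j)) ->
  exists h_ : nat -> R, [/\ forall k, 0 < h_ k <= r,
    h_ k @[k --> \oo] --> 0,
    forall j, {ae mu, forall z, B z ->
      convolve Q (mollifier (h_ k)) (g j) z @[k --> \oo] --> g j z} &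
    forall j k, (\int[mu]_(z in B) `|convolve Q (mollifier (h_ k)) (g j) z - g j z|%:E
      <= (1 / (2 ^ k.+1)%:R)%:E)%E].
Proof.
move=> mQ bQ mB r0 BQ ig.
pose H (n : nat) : R := r / n.+1%:R.
have Hr n : 0 < H n <= r.
  rewrite /H divr_gt0//= ler_pdivrMr// ler_pMr// ler1n//.
have H0 : H n @[n --> \oo] --> 0.
  rewrite -[X in _ --> X](mulr0 r); apply: cvgM; first exact: cvg_cst.
  exact: cvg_harmonic.
have P k : exists n, [/\ (forall j, \int[mu]_(z in B)
   `|convolve Q (mollifier (H n)) (g j) z - g j z|%:E <= (1 / (2 ^ k.+1)%:R)%:E)%E &
   H n < 1 / k.+1%:R].
  have e0 : 0 < 1 / (2 ^ k.+1)%:R :> R by rewrite divr_gt0// ltr0n expn_gt0.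
  have k0 : 0 < 1 / k.+1%:R :> R by rewrite divr_gt0.
  have h1 := @filter_forall _ _ _ _ (@eventually_filter) (fun j => convolve_L1_cvg mQ bQ mB BQ Hr H0 (ig j) e0).
  move/cvgrPdist_lt : H0 => /(_ _ k0) h2.
  have [n [a b]] := filter_ex (filterI h1 h2).
  exists n; split => //.
  by move: b; rewrite /= sub0r normrN ger0_norm//; case/andP: (Hr n) => /ltW.
have [n_ hn] := choice P.
exists (fun k => H (n_ k)); split => [k|||j k].
- exact: Hr.
- apply/cvgrPdist_lt => e e0.
  have /cvgrPdist_lt /(_ _ e0) := @cvg_harmonic R.
  apply: filterS => k; rewrite /harmonic !sub0r !normrN => hk.
  have [_ h] := hn k; have /andP[h0 _] := Hr (n_ k).
  rewrite gtr0_norm// (lt_trans h)// div1r.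
  by rewrite gtr0_norm// invr_gt0 in hk.
- move=> j.
  have mg : measurable_fun (Q : set T) (g j).
    by apply/measurable_EFinP; case/integrableP: (ig j).
  have BsQ : B `<=` Q by move=> z Bz; apply: (BQ z Bz); rewrite subrr normr0 ltW.
  have /(_ mB) := @ae_cvg0 R _ T mu B (fun k z => convolve Q (mollifier (H (n_ k))) (g j) z - g j z).
  have me k : measurable_fun (B : set T) (fun z => convolve Q (mollifier (H (n_ k))) (g j) z - g j z).
    have mc : measurable_fun [set: T] (convolve Q (mollifier (H (n_ k))) (g j)).
      apply: continuous_measurable_st.
      exact: (convolve_continuous mQ (ig j) (ckernel_mollifier N (H (n_ k)))).
    apply: measurable_funB; last exact: measurable_funS mg.
    exact: measurable_funTS.
  move=> /(_ me (fun k => (hn k).1 j)); apply: filterS => z hz Bz.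
  by apply/subr_cvg0; exact: hz Bz.
- by have [h _] := hn k; exact: h.
Qed.

End mollification_sequence.

(** * Integrals of derivatives *)

Section integration_by_parts.
Context {R : realType} (N : nat).
Local Notation Z := ('rV[R]_N * R)%type.
Local Notation T := ('rV[R]_N * measurableTypeR R)%type.
Local Notation mu := (@lebesgue_st R N).
Implicit Types (z w a v : Z) (F d : Z -> R) (B C : set Z).

(** By translation invariance the difference quotients of [G] have integral 0;
    they converge uniformly to [D] with supports in a common ball. *)
Lemma integral_derive_ckernel h (G D : Z -> R) v :
  ckernel h G -> ckernel h D -> (forall z, is_derive z v G (D z)) ->
  \int[mu]_z D z = 0.
Proof.
move=> kG kD GD.
pose K : set Z := ball 0 (`|h| + `|v| + 1).
have mK : measurable (K : set T) by exact: measurable_ball_st.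
have r0 : 0 < `|h| + `|v| + 1 by rewrite ltr_wpDl// addr_ge0.
have K0 z : ~ K z -> h < `|z| - `|v|.
  move=> nK; rewrite ltNge; apply/negP => hz; apply: nK.
  rewrite /K -ball_normE /= sub0r normrN; rewrite lerBlDr in hz.
  by rewrite (le_lt_trans hz)// (@le_lt_trans _ _ (`|h| + `|v|)) ?ltrDl// lerD2r ler_norm.
have iG := integrable_ckernel kG.
have iD := integrable_ckernel kD.
have mG := continuous_measurable_st (proj1 kG).
have iGs s : mu.-integrable setT (EFin \o (fun z => G (s *: v + z))).
  have kGs : ckernel (h + `|s *: v|) (fun z => G (s *: v + z)).
    split.
      move=> z; apply: (@continuous_comp _ _ _ (fun w : Z => s *: v + w) G); last exact: (proj1 kG).
      by apply: cvgD; [exact: cvg_cst|exact: cvg_id].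
    move=> z hz; apply: (proj2 kG).
    rewrite -(ltrD2r `|s *: v|) (lt_le_trans hz)//.
    by rewrite -{1}(addKr (s *: v) z) addrC -[X in _ <= _ + X]normrN ler_normD.
  exact: (integrable_ckernel kGs).
apply/eqP/negPn/negP => I0.
have [e e0 he] : exists2 e : R, 0 < e & e * fine (mu K) < `|\int[mu]_z D z|.
  exists (`|\int[mu]_z D z| / (fine (mu K) + 1)).
    by rewrite divr_gt0 ?normr_gt0// ltr_wpDl// fine_ge0.
  rewrite mulrAC ltr_pdivrMr ?ltr_wpDl ?fine_ge0//.
  by rewrite ltr_pM2l ?normr_gt0// ltrDl.
have [dd dd0 hd] := ckernel_unif kD e0.
have [s s0 [s1 sv]] : exists2 s : R, 0 < s & s <= 1 /\ s * `|v| < dd.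
  exists (Num.min 1 (dd / (`|v| + 1))).
    by rewrite lt_min ltr01 divr_gt0// ltr_wpDl.
  rewrite ge_min lexx; split => //.
  rewrite (@le_lt_trans _ _ (dd / (`|v| + 1) * `|v|))//.
    by rewrite ler_wpM2r// ge_min lexx orbT.
  by rewrite mulrAC ltr_pdivrMr ?ltr_wpDl// ltr_pM2l// ltrDl.
pose q z := s^-1 * (G (s *: v + z) - G z).
have qD z : `|D z - q z| <= e.
  have [t ts Gt] := MVT_directional z s GD.
  rewrite /q Gt mulrC mulfK ?gt_eqF//; apply/ltW/hd.
  rewrite opprD addrCA subrr addr0 normrN normrZ (le_lt_trans _ sv)// ler_wpM2r//.
  by rewrite (le_trans ts)// gtr0_norm.
have q0 : \int[mu]_z q z = 0.
  rewrite /q RintegralZl//; last by apply: integrable_EFinB => //; exact: iGs.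
  rewrite RintegralB//.
  have -> : \int[mu]_z G (s *: v + z) = \int[mu]_z G z.
    rewrite /Rintegral; congr fine.
    under eq_integral do rewrite addrC.
    by apply: (integral_translate (f := EFin \o G)); exact/measurable_EFinP.
  by rewrite subrr mulr0.
have iq : mu.-integrable setT (EFin \o q).
  by apply: integrable_EFinZ => //; apply: integrable_EFinB => //; exact: iGs.
have iDq : mu.-integrable setT (EFin \o (fun z => D z - q z)) by exact: integrable_EFinB.
have DqK : (fun z => D z - q z) = (fun z => D z - q z) \_ K.
  apply/funext => z; rewrite /patch; case: ifPn => // /negP; rewrite inE => nK.
  have hz := K0 _ nK.
  have hz' : h < `|z| by rewrite (lt_le_trans hz)// lerBlDr lerDl.
  rewrite (proj2 kD)// /q (proj2 kG z)// (proj2 kG) ?subr0 ?mulr0 ?subr0//.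
  rewrite (lt_le_trans hz)// lerBlDr.
  rewrite -{1}(addKr (s *: v) z) addrC (le_trans (ler_normD _ _))// lerD2l normrN normrZ.
  by rewrite ler_piMl// gtr0_norm.
suff : `|\int[mu]_z D z| <= e * fine (mu K) by rewrite leNgt he.
rewrite -[X in `|X|]subr0 -q0 -RintegralB//.
rewrite DqK -Rintegral_mkcond.
have iDqK : mu.-integrable K (EFin \o (fun z => D z - q z)).
  exact: (integrableS measurableT mK _ iDq).
rewrite (le_trans (le_normr_Rintegral mK iDqK))// -Rintegral_cst//.
apply: le_Rintegral => //; first exact: (integrable_norm iDqK).
apply: measurable_bounded_integrable => //.
  by rewrite lebesgue_st_ball ?ltry.
exists e; split; first exact: num_real.
by move=> y ey z _ /=; rewrite gtr0_norm// ltW.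
Qed.

Lemma glue_eq0 F B C z : closed C -> C `<=` B -> (forall z, B z -> ~ C z -> F z = 0) ->
  ~ C z -> \forall w \near z, (F \_ B) w = 0.
Proof.
move=> cC CB F0 nCz.
have : nbhs z (~` C) by apply: open_nbhs_nbhs; split => //; exact: closed_openC.
apply: filterS => w nCw; rewrite /patch; case: ifPn => //; rewrite inE => Bw.
exact: F0.
Qed.

Lemma glue_eq F B z : open B -> B z -> \forall w \near z, F w = (F \_ B) w.
Proof.
move=> oB Bz; have : nbhs z B by exact: open_nbhs_nbhs.
by apply: filterS => w Bw; rewrite /patch mem_set.
Qed.

(** Extending by 0 a function on [B] that vanishes off [C] creates no singularity:
    every point has a neighbourhood inside [B] or inside the complement of [C]. *)
Lemma glue_continuous F B C : open B -> closed C -> C `<=` B ->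
  (forall z, B z -> {for z, continuous F}) -> (forall z, B z -> ~ C z -> F z = 0) ->
  continuous (F \_ B).
Proof.
move=> oB cC CB cF F0 z; have [Bz|nBz] := pselect (B z).
  have E := glue_eq F oB Bz.
  rewrite /continuous_at -(nbhs_singleton E).
  by apply: cvg_trans (cF z Bz); exact: (near_eq_cvg E).
have nCz : ~ C z by move=> /CB.
have E := glue_eq0 cC CB F0 nCz.
rewrite /continuous_at (nbhs_singleton E).
have c0 : (cst (0 : R) : Z -> R) @ z --> (0 : R) by exact: cvg_cst.
apply: cvg_trans c0.
apply: near_eq_cvg; near=> w; apply/esym; near: w; exact: E.
Unshelve. all: by end_near. 
Qed.

Lemma glue_derive F d B C v : open B -> closed C -> C `<=` B ->
  (forall z, B z -> is_derive z v F (d z)) -> (forall z, B z -> ~ C z -> F z = 0) ->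
  forall z, is_derive z v (F \_ B) ((d \_ B) z).
Proof.
move=> oB cC CB dF F0 z; rewrite {2}/patch; case: ifPn => [|/negP]; rewrite inE => Bz.
  by apply: near_eq_is_derive (dF z Bz); exact: glue_eq.
have nCz : ~ C z by move=> /CB.
apply: (@near_eq_is_derive _ _ _ (cst 0)).
by apply: filterS (glue_eq0 cC CB F0 nCz).
Qed.

Lemma derive_vanish F d B C v : open B -> closed C ->
  (forall z, B z -> is_derive z v F (d z)) -> (forall z, B z -> ~ C z -> F z = 0) ->
  forall z, B z -> ~ C z -> d z = 0.
Proof.
move=> oB cC dF F0 z Bz nCz.
have [_ <-] := dF z Bz.
rewrite -(derive_cst (0 : R) z v); apply: near_eq_derive.
have h1 : nbhs z (~` C) by apply: open_nbhs_nbhs; split => //; exact: closed_openC.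
have h2 : nbhs z B by exact: open_nbhs_nbhs.
by apply: filterS2 h1 h2 => w nCw Bw; rewrite F0.
Qed.

Lemma ckernel_glue F B C : open B -> bounded_set B -> closed C -> C `<=` B ->
  (forall z, B z -> {for z, continuous F}) -> (forall z, B z -> ~ C z -> F z = 0) ->
  exists h, ckernel h (F \_ B).
Proof.
move=> oB [M [Mr hM]] cC CB cF F0.
exists (M + 1); split; first exact: glue_continuous cF F0.
move=> z hz; rewrite /patch ifF//; apply/negP; rewrite inE => Bz.
by have := hM (M + 1); rewrite ltrDl => /(_ ltr01 _ Bz) /=; rewrite leNgt hz.
Qed.

Lemma integrable_glue F B C : open B -> bounded_set B -> closed C -> C `<=` B ->
  (forall z, B z -> {for z, continuous F}) -> (forall z, B z -> ~ C z -> F z = 0) ->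
  mu.-integrable B (EFin \o F).
Proof.
move=> oB bB cC CB cF F0.
have [h kh] := ckernel_glue oB bB cC CB cF F0.
have mB : measurable (B : set T) by exact: open_measurable_st.
apply/(integrable_mkcond _ mB); rewrite restrict_EFin.
exact: (integrable_ckernel kh).
Qed.

(** Extend [F] and [d] by 0 and apply [integral_derive_ckernel]. Working inside an
    open set [B] allows functions that are only defined, or smooth, there. *)
Theorem integral_derive_eq0 F d B C v : open B -> bounded_set B -> closed C -> C `<=` B ->
  (forall z, B z -> is_derive z v F (d z)) ->
  (forall z, B z -> {for z, continuous F}) -> (forall z, B z -> {for z, continuous d}) ->
  (forall z, B z -> ~ C z -> F z = 0) ->
  \int[mu]_(z in B) d z = 0.
Proof.
move=> oB bB cC CB dF cF cd F0.
have d0 := derive_vanish oB cC dF F0.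
have [h1 k1] := ckernel_glue oB bB cC CB cF F0.
have [h2 k2] := ckernel_glue oB bB cC CB cd d0.
rewrite Rintegral_mkcond; apply: (@integral_derive_ckernel (Num.max h1 h2) (F \_ B) _ v).
- by split; [exact: (proj1 k1)|move=> z; rewrite gt_max => /andP[a _]; exact: (proj2 k1)].
- by split; [exact: (proj1 k2)|move=> z; rewrite gt_max => /andP[_ a]; exact: (proj2 k2)].
- exact: glue_derive dF F0.
Qed.

End integration_by_parts.

(** * Euclidean geometry and the p-Laplacian flux *)

Lemma continuous_sum_ord (R : realType) (X : topologicalType) n (F : 'I_n -> X -> R) x :
  (forall i, {for x, continuous (F i)}) -> {for x, continuous (fun y => \sum_i F i y)}.
Proof.
move=> hF; change ((fun y => \sum_i F i y) @ x --> \sum_i F i x).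
elim: n F hF => [|n IHn] F hF.
  by under eq_fun do rewrite big_ord0; rewrite big_ord0; exact: cvg_cst.
under eq_fun do rewrite big_ord_recl; rewrite big_ord_recl.
by apply: cvgD; [exact: hF|apply: IHn => i; exact: hF].
Qed.

Section euclidean.
Context {R : realType} (N : nat).
Local Notation E := 'rV[R]_N.
Implicit Types (v w u : E).

Lemma edotC v w : edot v w = edot w v.
Proof. by apply: eq_bigr => i _; rewrite mulrC. Qed.

Lemma edotDl u v w : edot (u + v) w = edot u w + edot v w.
Proof. by rewrite /edot -big_split; apply: eq_bigr => i _; rewrite mxE mulrDl. Qed.

Lemma edotZl a v w : edot (a *: v) w = a * edot v w.
Proof. by rewrite /edot mulr_sumr; apply: eq_bigr => i _; rewrite mxE mulrA. Qed.

Lemma edotBl u v w : edot (u - v) w = edot u w - edot v w.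
Proof. by rewrite edotDl -scaleN1r edotZl mulN1r. Qed.

Lemma edotBr u v w : edot w (u - v) = edot w u - edot w v.
Proof. by rewrite edotC edotBl !(edotC w). Qed.

Lemma edot_ge0 v : 0 <= edot v v.
Proof. by apply: sumr_ge0 => i _; rewrite -expr2 sqr_ge0. Qed.

Lemma enorm_ge0 v : 0 <= enorm v.
Proof. exact: sqrtr_ge0. Qed.

Lemma enorm_sqr v : enorm v ^+ 2 = edot v v.
Proof. by rewrite sqr_sqrtr// edot_ge0. Qed.

Lemma le_coord_enorm v i : `|v ord0 i| <= enorm v.
Proof.
rewrite -sqrtr_sqr ler_wsqrtr// /edot (bigD1 i)//= expr2 lerDl.
by apply: sumr_ge0 => j _; rewrite -expr2 sqr_ge0.
Qed.

Lemma enorm_eq0 v : (enorm v == 0) = (v == 0).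
Proof.
apply/eqP/eqP => [v0|->].
  by apply/rowP => i; apply/eqP; rewrite mxE -normr_le0 -v0 le_coord_enorm.
by rewrite /enorm /edot big1 ?sqrtr0// => i _; rewrite mxE mul0r.
Qed.

Lemma enorm_gt0 v : (0 < enorm v) = (v != 0).
Proof. by rewrite lt_def enorm_ge0 andbT enorm_eq0. Qed.

Lemma le_norm_enorm v : `|v| <= enorm v.
Proof.
rewrite [leLHS]/Num.Def.normr/= mx_normrE (bigmax_le _ (enorm_ge0 v))//= => -[i j] _.
by rewrite ord1 /= le_coord_enorm.
Qed.

Lemma edot_le_enorm v w : edot v w <= enorm v * enorm w.
Proof.
have [->|v0] := eqVneq v 0.
  by rewrite /edot big1 ?mulr_ge0 ?enorm_ge0// => i _; rewrite mxE mul0r.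
have [->|w0] := eqVneq w 0.
  by rewrite /edot big1 ?mulr_ge0 ?enorm_ge0// => i _; rewrite mxE mulr0.
have := edot_ge0 (enorm w *: v - enorm v *: w).
rewrite edotBl !edotBr !edotZl ![edot _ (_ *: _)]edotC !edotZl -!enorm_sqr (edotC w v).
set a := enorm v; set b := enorm w; set c := edot v w.
have a0 : 0 < a by rewrite enorm_gt0. 
have b0 : 0 < b by rewrite enorm_gt0.
rewrite [X in 0 <= X](_ : _ = 2 * (a * b) * (a * b - c)); last by ring.
by rewrite pmulr_rge0 ?subr_ge0// mulr_gt0// mulr_gt0.
Qed.

Lemma enorm_sqrB v w : enorm (v - w) ^+ 2 = enorm v ^+ 2 + enorm w ^+ 2 - 2 * edot v w.
Proof. by rewrite !enorm_sqr edotBl !edotBr (edotC w v); ring. Qed.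

Lemma continuous_enorm : continuous (@enorm R N).
Proof.
move=> v; apply: (@continuous_comp _ _ _ (fun v => edot v v) Num.sqrt); last exact: sqrt_continuous.
apply: continuous_sum_ord => i.
have c := @coord_continuous R 1 N ord0 i v.
by apply: (cvgM c c).
Qed.

End euclidean.

Section flux.
Context {R : realType} (N : nat) (p : R).
Hypothesis p_gt1 : 1 < p.
Local Notation E := 'rV[R]_N.
Implicit Types (v w : E).

(** The value at 0 is 0 for every [p], whatever the convention for the power. *)
Definition flux v : E := enorm v `^ (p - 2) *: v.

Let powR_pred (a : R) : 0 <= a -> a `^ (p - 2) * a = a `^ (p - 1).
Proof.
move=> a0; rewrite mulrC; have := @mulr_powRB1 _ a (p - 1) a0.
by rewrite subr_gt0 => /(_ p_gt1) <-; congr (_ * _ `^ _); ring.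
Qed.

Lemma enorm_fluxE v : enorm v `^ (p - 2) * enorm v = enorm v `^ (p - 1).
Proof. by rewrite powR_pred// enorm_ge0. Qed.

Lemma le_flux_coord v i : `|flux v ord0 i| <= enorm v `^ (p - 1).
Proof.
by rewrite mxE normrM ger0_norm ?powR_ge0// -enorm_fluxE ler_wpM2l ?powR_ge0// le_coord_enorm.
Qed.

(** At 0 the flux tends to 0 because its norm is the power p - 1 > 0 of the norm. *)
Lemma continuous_flux_coord i : continuous (fun v : E => flux v ord0 i).
Proof.
move=> v.
have FF : Filter (nbhs v) by exact: nbhs_filter.
have [v0|v0] := eqVneq v 0.
  have f0 : flux v ord0 i = 0 by rewrite v0 !mxE mulr0.
  apply/cvgrPdist_lt => e e0; rewrite f0.
  have p1 : 0 < p - 1 by rewrite subr_gt0.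
  have d0 : 0 < e `^ (p - 1)^-1 by rewrite powR_gt0.
  have n0 : enorm v = 0 by apply/eqP; rewrite enorm_eq0 v0.
  have /cvgrPdist_lt /(_ _ d0) := @continuous_enorm R N v.
  rewrite n0; apply: filterS => w.
  rewrite !sub0r !normrN ger0_norm ?enorm_ge0// => wd.
  rewrite (le_lt_trans (le_flux_coord w i))//.
  have -> : e = (e `^ (p - 1)^-1) `^ (p - 1).
    by rewrite -powRrM mulVf ?gt_eqF// powRr1 ?ltW.
  by apply: gt0_ltr_powR => //; rewrite nnegrE ?enorm_ge0// ltW.
change ((fun w => flux w ord0 i) @ v --> flux v ord0 i).
under eq_fun do rewrite mxE; rewrite mxE.
apply: cvgM; last exact: (@coord_continuous R 1 N ord0 i v).
apply: (@continuous_comp _ _ _ (@enorm R N) (fun x => x `^ (p - 2))).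
  exact: continuous_enorm.
apply/differentiable_continuous/derivable1_diffP.
by apply: ex_derive; apply: is_derive1_powR; rewrite enorm_gt0.
Qed.

(** A decomposition into two nonnegative terms, by monotonicity of the power p - 1
    and by the Cauchy-Schwarz inequality. *)
Lemma flux_identity v w :
  edot (flux v - flux w) (v - w) =
  (enorm v `^ (p - 1) - enorm w `^ (p - 1)) * (enorm v - enorm w) +
  (enorm v `^ (p - 2) + enorm w `^ (p - 2)) * (enorm v * enorm w - edot v w).
Proof.
rewrite edotBl !edotBr !edotZl (edotC w v) -!enorm_sqr -!enorm_fluxE.
ring.
Qed.

Let sgn_powR (a b : R) : 0 <= a -> 0 <= b -> 0 <= (a `^ (p - 1) - b `^ (p - 1)) * (a - b).
Proof.
move=> a0 b0; have p1 : 0 <= p - 1 by rewrite subr_ge0 ltW.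
have mono (x y : R) : 0 <= x -> 0 <= y -> x <= y -> x `^ (p - 1) <= y `^ (p - 1).
  by move=> x0 y0 xy; apply: ge0_ler_powR => //; rewrite nnegrE.
have [ab|/ltW ba] := leP a b.
  by apply: mulr_le0; rewrite subr_le0// mono.
by apply: mulr_ge0; rewrite subr_ge0// mono.
Qed.

Lemma flux_monotone v w : 0 <= edot (flux v - flux w) (v - w).
Proof.
rewrite flux_identity addr_ge0// ?sgn_powR ?enorm_ge0//.
by apply: mulr_ge0; [rewrite addr_ge0 ?powR_ge0|rewrite subr_ge0 edot_le_enorm].
Qed.

(** If both terms of [flux_identity] vanish then the vectors have equal norms and
    attain equality in the Cauchy-Schwarz inequality. *)
Lemma flux_strict v w : v != w -> 0 < edot (flux v - flux w) (v - w).
Proof.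
move=> vw; rewrite lt_def flux_monotone andbT flux_identity.
have h1 := sgn_powR (enorm_ge0 v) (enorm_ge0 w).
have h2 : 0 <= (enorm v `^ (p - 2) + enorm w `^ (p - 2)) * (enorm v * enorm w - edot v w).
  by apply: mulr_ge0; [rewrite addr_ge0 ?powR_ge0|rewrite subr_ge0 edot_le_enorm].
have p1 : 0 < p - 1 by rewrite subr_gt0.
apply/negP; rewrite paddr_eq0// => /andP[].
rewrite mulf_eq0 !subr_eq0 => ab.
have {}ab : enorm v = enorm w.
  case/orP : ab => /eqP// ab; apply: (powR_injective p1) => //; rewrite nnegrE enorm_ge0//.
rewrite ab mulf_eq0 => /orP[|].
  rewrite paddr_eq0 ?powR_ge0// andbb powR_eq0 enorm_eq0 => /andP[/eqP w0 _].
  move: ab; rewrite w0 (eqP (_ : @enorm R N 0 == 0)) ?enorm_eq0// => /eqP.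
  by rewrite enorm_eq0 => /eqP v0; rewrite v0 w0 eqxx in vw.
rewrite subr_eq0 => /eqP e.
have : enorm (v - w) ^+ 2 = 0 by rewrite enorm_sqrB ab -e; ring.
by move/eqP; rewrite expf_eq0 /= enorm_eq0 subr_eq0 (negbTE vw).
Qed.

Let compact_enorm_le (M : R) : compact [set v : E | enorm v <= M].
Proof.
apply: bounded_closed_compact.
  exists M; split; first exact: num_real.
  by move=> y My v /= vM; rewrite (le_trans (le_norm_enorm v))// (le_trans vM)// ltW.
rewrite (_ : [set v : E | _] = @enorm R N @^-1` [set x | x <= M])//.
by apply: closed_comp; [move=> v _; exact: continuous_enorm|exact: closed_le].
Qed.

Let pairing (vw : E * E) := edot (flux vw.1 - flux vw.2) (vw.1 - vw.2).

Let continuous_pairing : continuous pairing.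
Proof.
move=> vw; apply: continuous_sum_ord => i.
have cf (q : E * E -> E) : {for vw, continuous q} ->
    {for vw, continuous (fun x => flux (q x) ord0 i)}.
  move=> cq; apply: (@continuous_comp _ _ _ q (fun v : E => flux v ord0 i)) => //.
  exact: continuous_flux_coord.
have cc (q : E * E -> E) : {for vw, continuous q} ->
    {for vw, continuous (fun x => q x ord0 i)}.
  move=> cq; apply: (@continuous_comp _ _ _ q (fun v : E => v ord0 i)) => //.
  exact: (@coord_continuous R 1 N ord0 i).
have c1 : {for vw, continuous (fst : E * E -> E)} by exact: cvg_fst.
have c2 : {for vw, continuous (snd : E * E -> E)} by exact: cvg_snd.
rewrite (_ : (fun y : E * E => _) = fun x =>
   (flux x.1 ord0 i - flux x.2 ord0 i) * (x.1 ord0 i - x.2 ord0 i)); last first.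
  by apply/funext => x; rewrite !mxE.
by apply: cvgM; apply: cvgB; [exact: cf|exact: cf|exact: cc|exact: cc].
Qed.

(** For bounded [w] this is strict monotonicity and compactness. For [w] much
    larger than [M], the first term of [flux_identity] dominates a multiple of
    the p-th power of the norm of [w]. *)
Lemma flux_coercive (M d : R) : 0 < d -> exists2 c : R, 0 < c &
  forall v w, enorm v <= M -> d <= enorm (v - w) ->
    c * (1 + enorm w `^ p) <= edot (flux v - flux w) (v - w).
Proof.
move=> d0; pose M1 := `|M| + 1; pose L := 2 * M1.
have M10 : 1 <= M1 by rewrite lerDr.
have p1 : 0 < p - 1 by rewrite subr_gt0.
have p0 : 0 < p by rewrite (lt_trans _ p_gt1).
have L1 : 1 <= L by rewrite /L; lra.
pose K : set (E * E) := [set vw | [/\ enorm vw.1 <= M, enorm vw.2 <= L & d <= enorm (vw.1 - vw.2)]].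
have cK : compact K.
  have cl : closed K.
    rewrite (_ : K = ((fun x : E * E => enorm x.1) @^-1` [set x | x <= M]) `&`
       ((fun x : E * E => enorm x.2) @^-1` [set x | x <= L]) `&`
       ((fun x : E * E => enorm (x.1 - x.2)) @^-1` [set x | d <= x])); last first.
      by apply/seteqP; split => [x [a b e]//|x [[a b] e]//].
    have cn (q : E * E -> E) : continuous q -> continuous (fun x => enorm (q x)).
      move=> cq x; apply: (@continuous_comp _ _ _ q (@enorm R N)); first exact: cq.
      exact: continuous_enorm.
    apply: closedI; first apply: closedI.
    - by apply: closed_comp; [move=> x _; apply: cn => y; exact: cvg_fst|exact: closed_le].
    - by apply: closed_comp; [move=> x _; apply: cn => y; exact: cvg_snd|exact: closed_le].
    - apply: closed_comp; last exact: closed_ge.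
      by move=> x _; apply: cn => y; apply: cvgB; [exact: cvg_fst|exact: cvg_snd].
  have cX := compact_setX (@compact_enorm_le M) (@compact_enorm_le L).
  by apply: (subclosed_compact cl cX) => x [a b _].
(* The case of bounded w: the pairing attains a positive minimum on K. *)
have [c2 c20 hc2] : exists2 c, 0 < c & forall vw, K vw -> c <= pairing vw.
  have [K0|K0] := pselect (K !=set0); last first.
    by exists 1 => // vw Kvw; exfalso; apply: K0; exists vw.
  have cp : {within K, continuous pairing} by apply: continuous_subspaceT.
  have [x xK hx] := compact_EVT_min K0 cK cp.
  exists (pairing x).
    apply: flux_strict; rewrite -subr_eq0 -enorm_gt0.
    by move: xK; rewrite inE => -[_ _ /(lt_le_trans d0)].
  by move=> vw Kvw; apply: hx; rewrite inE.
have k0 : 0 < 1 - 2^-1 `^ (p - 1).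
  have one : 1 `^ (p - 1) = 1 :> R by rewrite powR1.
  rewrite subr_gt0 -[ltRHS]one; apply: gt0_ltr_powR => //; rewrite ?nnegrE//.
  by rewrite invf_lt1// ltr1n.
pose c1 := (1 - 2^-1 `^ (p - 1)) / 4.
have c10 : 0 < c1 by rewrite divr_gt0.
have Lp : 0 < 1 + L `^ p by rewrite ltr_wpDr// powR_ge0.
exists (Num.min c1 (c2 / (1 + L `^ p))); first by rewrite lt_min c10 divr_gt0.
move=> v w vM dvw.
have wp : 0 <= 1 + enorm w `^ p by rewrite addr_ge0// powR_ge0.
(* For larger w, the choice of L makes the norm of v at most half of that of w. *)
have [wL|Lw] := leP (enorm w) L.
  apply: (@le_trans _ _ (c2 / (1 + L `^ p) * (1 + enorm w `^ p))).
    by rewrite ler_wpM2r// ge_min lexx orbT.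
  apply: (@le_trans _ _ c2); last by apply: (hc2 (v, w)).
  rewrite mulrAC ler_pdivrMr// ler_pM2l// lerD2l.
  have L0 : 0 <= L by apply: le_trans L1.
  by apply: ge0_ler_powR; rewrite ?nnegrE ?enorm_ge0 ?(ltW p0).
apply: (@le_trans _ _ (c1 * (1 + enorm w `^ p))).
  by rewrite ler_wpM2r// ge_min lexx.
rewrite flux_identity.
set a := enorm v; set b := enorm w.
have b1 : 1 <= b by rewrite (le_trans L1)// ltW.
have b0 : 0 < b by rewrite (lt_le_trans ltr01).
have a0 : 0 <= a by exact: enorm_ge0.
have ab : a <= b / 2.
  rewrite ler_pdivlMr// mulrC (le_trans _ (ltW Lw))// /L ler_pM2l//.
  by rewrite (le_trans vM)// (le_trans (ler_norm _))// lerDl.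
have h2 : 0 <= (a `^ (p - 2) + b `^ (p - 2)) * (a * b - edot v w).
  by apply: mulr_ge0; [rewrite addr_ge0 ?powR_ge0|rewrite subr_ge0 edot_le_enorm].
have h1 : a `^ (p - 1) <= 2^-1 `^ (p - 1) * b `^ (p - 1).
  rewrite -powRM ?(ltW b0)// mulrC; apply: ge0_ler_powR => //; rewrite ?nnegrE ?(ltW p1)//.
  by rewrite divr_ge0// ltW.
have bp1 : 1 <= b `^ p by rewrite -[leLHS](powRr0 b); apply: ler_powR => //; exact: ltW.
have bE : b `^ p = b `^ (p - 1) * b by rewrite mulrC mulr_powRB1// ltW.
have bq : 0 <= b `^ (p - 1) by exact: powR_ge0.
apply: (@le_trans _ _ ((b `^ (p - 1) - a `^ (p - 1)) * (b - a))); last first.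
  by rewrite -[leLHS]addr0 lerD// -mulrNN !opprB.
apply: (@le_trans _ _ (((1 - 2^-1 `^ (p - 1)) * b `^ (p - 1)) * (b / 2))).
  rewrite /c1 -mulrA [leRHS](_ : _ = (1 - 2^-1 `^ (p - 1)) * (b `^ p / 2)); last by rewrite bE; ring.
  by rewrite ler_pM2l//; lra.
apply: ler_pM.
- by rewrite mulr_ge0// ltW.
- by rewrite divr_ge0// ltW.
- by rewrite mulrBl mul1r lerD2l lerN2.
- by move: ab; lra.
Qed.

(** The pointwise inequality that decides the comparison. If [w] is close to [v],
    then f v - f w < eps / 2 and the flux term is nonnegative. Otherwise the flux
    term is at least a multiple of 1 + |w|^p, which dominates f v - f w up to a
    constant, and this constant is compensated by the smallness of [g]. *)
Lemma flux_reaction (f : E -> R) (Cf beta M eps : R) : continuous f ->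
  1 <= beta -> beta < p -> (forall v, `|f v| <= Cf * (1 + enorm v `^ beta)) -> 0 < eps ->
  exists2 m, 0 < m & forall v w g, enorm v <= M -> 0 <= g <= m ->
    g * (eps / 2) <= 2 * edot (flux v - flux w) (v - w) + g * (eps - f v + f w).
Proof.
move=> cf b1 bp fg e0; have e2 : 0 < eps / 2 by rewrite divr_gt0.
have p0 : 0 < p by rewrite (lt_trans _ p_gt1).
have [d d0 hd] := @compact_unif R E _ f (@compact_enorm_le M) (fun x _ => cf x) _ e2.
have [c c0 hc] := flux_coercive M d0.
pose Cf' := `|Cf|.
pose K := Cf' * (2 + `|M| `^ p) + Cf' * 2.
have K0 : 0 <= K.
  by rewrite /K /Cf' addr_ge0// mulr_ge0// addr_ge0// powR_ge0.
have growth v : `|f v| <= Cf' * (2 + enorm v `^ p).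
  apply: (le_trans (fg v)); apply: (@le_trans _ _ (Cf' * (1 + enorm v `^ beta))).
    by rewrite ler_wpM2r ?addr_ge0 ?powR_ge0// ler_norm.
  rewrite ler_wpM2l ?normr_ge0//.
  have [v1|v1] := leP (enorm v) 1.
    have : enorm v `^ beta <= 1.
      have one : 1 `^ beta = 1 :> R by rewrite powR1.
      rewrite -[leRHS]one; apply: ge0_ler_powR; rewrite ?nnegrE ?enorm_ge0//.
      exact: le_trans b1.
    by have := powR_ge0 (enorm v) p; lra.
  have : enorm v `^ beta <= enorm v `^ p by apply: ler_powR; exact: ltW.
  by lra.
exists (c / (K + 1)); first by rewrite divr_gt0// ltr_wpDl.
move=> v w g vM /andP[g0 gm].
have [dvw|dvw] := ltP (enorm (v - w)) d.
  have : `|f v - f w| < eps / 2 by apply: hd => //; exact: le_lt_trans (le_norm_enorm _) dvw.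
  rewrite ltr_norml => /andP[_ h].
  have mono := flux_monotone v w.
  have : g * (eps / 2) <= g * (eps - f v + f w).
    by rewrite ler_wpM2l//; lra.
  by lra.
have h := hc v w vM dvw.
have wp := powR_ge0 (enorm w) p.
have vp : enorm v `^ p <= `|M| `^ p.
  apply: ge0_ler_powR; rewrite ?nnegrE ?enorm_ge0 ?(ltW p0)//.
  exact: le_trans vM (ler_norm _).
have hf : f v - f w <= K * (1 + enorm w `^ p).
  have hv : f v <= Cf' * (2 + `|M| `^ p).
    rewrite (le_trans (ler_norm _))// (le_trans (growth v))// ler_wpM2l ?normr_ge0//.
    by rewrite lerD2l.
  have hw : - f w <= Cf' * (2 + enorm w `^ p).
    by rewrite (le_trans (ler_norm _))// normrN growth.
  have Cf0 : 0 <= Cf' by exact: normr_ge0.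
  have h3 : 0 <= Cf' * (2 + `|M| `^ p) * enorm w `^ p.
    by rewrite !mulr_ge0// addr_ge0// powR_ge0.
  have h4 : 0 <= Cf' * enorm w `^ p by rewrite mulr_ge0.
  rewrite /K; nra.
have : g * (f v - f w) <= c * (1 + enorm w `^ p).
  apply: (@le_trans _ _ (g * (K * (1 + enorm w `^ p)))); first by rewrite ler_wpM2l.
  rewrite mulrA ler_wpM2r ?addr_ge0//.
  apply: (@le_trans _ _ (c / (K + 1) * K)); first by rewrite ler_wpM2r.
  by rewrite mulrAC ler_pdivrMr ?ltr_wpDl// ler_pM2l// lerDl.
have ge : 0 <= g * (eps / 2) by rewrite mulr_ge0// ltW.
have mono := flux_monotone v w.
nra.
Qed.

End flux.

(** * Positive parts and cutoffs *)

Section positive_part.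
Context {R : realType}.
Implicit Types (x y s : R).

Definition posp x : R := Num.max 0 x.

Lemma posp_ge0 x : 0 <= posp x. Proof. by rewrite le_max lexx. Qed.

Lemma posp_le0 x : x <= 0 -> posp x = 0. Proof. by move=> x0; rewrite /posp max_l. Qed.

Lemma posp_id x : 0 <= x -> posp x = x. Proof. by move=> x0; rewrite /posp max_r. Qed.

Lemma posp_le_norm x : posp x <= `|x|.
Proof. by rewrite ge_max normr_ge0 ler_norm. Qed.

Lemma continuous_posp : continuous posp.
Proof.
move=> x; apply: (@continuous_max R R (cst 0) id); first exact: cvg_cst.
exact: cvg_id.
Qed.

(** Powers from 2 on are used because the positive part itself is not
    differentiable at 0. *)
Lemma is_derive_posp n x :
  is_derive x 1 (fun y => posp y ^+ n.+2) (n.+2%:R * posp x ^+ n.+1).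
Proof.
have [x0|x0|->] := ltgtP x 0.
- rewrite (posp_le0 (ltW x0)) expr0n/= mulr0.
  apply: (@near_eq_is_derive _ _ _ (cst 0)).
  near=> y; rewrite posp_le0 ?expr0n//; apply/ltW.
  by near: y; exact: lt_nbhsl.
- rewrite (posp_id (ltW x0)).
  apply: (@near_eq_is_derive _ _ _ (fun y => y ^+ n.+2)).
    near=> y; rewrite posp_id//; apply/ltW.
    by near: y; exact: lt_nbhsr.
  have := is_deriveX n.+2 (is_derive_id x (1 : R)).
  by rewrite exprfctE /= [_ *: _]mulr1.
rewrite (posp_le0 (lexx 0)) expr0n/= mulr0; apply: is_derive_cvg.
apply/cvgrPdist_lt => e e0; near=> h.
rewrite (posp_le0 (lexx 0)) expr0n/= subr0 sub0r normrN.
have -> : h *: (1 : R) + 0 = h by rewrite addr0 [_%:A]mulr1.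
rewrite normrM normfV.
have h0 : 0 < `|h| by rewrite normr_gt0; near: h; exact: nbhs_dnbhs_neq.
rewrite mulrC ltr_pdivrMr// normrX ger0_norm ?posp_ge0//.
have h1 : `|h| < 1 by near: h; apply: dnbhs0_lt.
have he : `|h| < e by near: h; apply: dnbhs0_lt.
apply: (@le_lt_trans _ _ (`|h| ^+ n.+2)).
  by rewrite lerXn2r ?nnegrE ?posp_ge0 ?posp_le_norm.
rewrite exprS mulrC ltr_pM2r// (le_lt_trans _ he)//.
by rewrite exprS ler_piMr// exprn_ile1 ?ltW.
Unshelve. all: by end_near. Qed.

(** Equal to 1 for |s| <= 1/2 and to 0 for |s| >= 1. It is of class C1, which
    suffices because cutoffs are differentiated once. *)
Definition plateau s : R := posp (1 - 4 * (posp (s - 2^-1) ^+ 2 + posp (- s - 2^-1) ^+ 2)) ^+ 2.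

Definition dplateau s : R :=
  2 * posp (1 - 4 * (posp (s - 2^-1) ^+ 2 + posp (- s - 2^-1) ^+ 2)) *
  (- (8 * (posp (s - 2^-1) - posp (- s - 2^-1)))).

Lemma is_derive_plateau s : is_derive s 1 plateau (dplateau s).
Proof.
have d1 : is_derive s 1 (fun y : R => posp (y - 2^-1) ^+ 2) (2 * posp (s - 2^-1)).
  have -> : 2 * posp (s - 2^-1) = 2%:R * posp (s - 2^-1) ^+ 1 * 1 by rewrite mulr1 expr1.
  apply: (@is_derive1_comp R (fun y => posp y ^+ 2) (fun y => y - 2^-1)).
    exact: is_derive_posp.
  refine (is_derive_eq (is_deriveB (is_derive_id s (1 : R)) (is_derive_cst (2^-1 : R) s 1)) _).
  by rewrite subr0.
have d2 : is_derive s 1 (fun y : R => posp (- y - 2^-1) ^+ 2) (- (2 * posp (- s - 2^-1))).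
  have -> : - (2 * posp (- s - 2^-1)) = 2%:R * posp (- s - 2^-1) ^+ 1 * (- 1) by rewrite mulrN1 expr1.
  apply: (@is_derive1_comp R (fun y => posp y ^+ 2) (fun y => - y - 2^-1)).
    exact: is_derive_posp.
  refine (is_derive_eq (is_deriveB (is_deriveN (is_derive_id s (1 : R))) (is_derive_cst (2^-1 : R) s 1)) _).
  by rewrite subr0.
have d3 : is_derive s 1 (fun y : R => 1 - 4 * (posp (y - 2^-1) ^+ 2 + posp (- y - 2^-1) ^+ 2))
    (- (8 * (posp (s - 2^-1) - posp (- s - 2^-1)))).
  have h := is_deriveB (is_derive_cst (1 : R) s 1) (is_deriveZ 4 (is_deriveD d1 d2)).
  by refine (is_derive_eq h _); rewrite /GRing.scale /=; ring.
have -> : dplateau s = 2%:R * posp (1 - 4 * (posp (s - 2^-1) ^+ 2 + posp (- s - 2^-1) ^+ 2)) ^+ 1 *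
  (- (8 * (posp (s - 2^-1) - posp (- s - 2^-1)))) by rewrite expr1.
apply: (@is_derive1_comp R (fun y => posp y ^+ 2) _ s _ _ _ d3).
exact: is_derive_posp.
Qed.

Lemma continuous_dplateau : continuous dplateau.
Proof.
have cp (q : R -> R) : continuous q -> continuous (posp \o q).
  by move=> cq x; apply: continuous_comp; [exact: cq|exact: continuous_posp].
have c1 : continuous (posp \o (fun s : R => s - 2^-1)).
  by apply: cp => x; apply: cvgB; [exact: cvg_id|exact: cvg_cst].
have c2 : continuous (posp \o (fun s : R => - s - 2^-1)).
  by apply: cp => x; apply: cvgB; [apply: cvgN; exact: cvg_id|exact: cvg_cst].
have c3 : continuous (posp \o (fun s => 1 - 4 * (posp (s - 2^-1) ^+ 2 + posp (- s - 2^-1) ^+ 2))).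
  apply: cp => x; apply: cvgB; first exact: cvg_cst.
  apply: cvgM; first exact: cvg_cst.
  apply: cvgD; rewrite expr2; under eq_fun do rewrite expr2.
    by apply: cvgM; exact: (c1 x).
  by apply: cvgM; exact: (c2 x).
move=> x; apply: cvgM.
  by apply: cvgM; [exact: cvg_cst|exact: (c3 x)].
apply: cvgN; apply: cvgM; first exact: cvg_cst.
by apply: cvgB; [exact: (c1 x)|exact: (c2 x)].
Qed.

Lemma continuous_plateau : continuous plateau.
Proof.
by move=> s; apply/differentiable_continuous/derivable1_diffP; case: (is_derive_plateau s).
Qed.

Lemma plateau_ge0 s : 0 <= plateau s. Proof. by rewrite sqr_ge0. Qed.

Lemma plateau_le1 s : plateau s <= 1.
Proof.
rewrite /plateau exprn_ile1 ?posp_ge0// ge_max ler01 /= gerBl mulr_ge0//.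
by rewrite addr_ge0// sqr_ge0.
Qed.

Lemma plateau_eq1 s : `|s| <= 2^-1 -> plateau s = 1.
Proof.
rewrite ler_norml => /andP[h1 h2]; rewrite /plateau.
rewrite (posp_le0 (_ : s - 2^-1 <= 0)); last by rewrite subr_le0.
rewrite (posp_le0 (_ : - s - 2^-1 <= 0)); last by rewrite subr_le0 lerNl.
by rewrite !expr0n/= addr0 mulr0 subr0 posp_id// expr1n.
Qed.

Let far s : 1 <= `|s| -> 1 - 4 * (posp (s - 2^-1) ^+ 2 + posp (- s - 2^-1) ^+ 2) <= 0.
Proof.
move=> s1; rewrite subr_le0.
have half (x : R) : 2^-1 <= x -> 4^-1 <= posp x ^+ 2.
  move=> hx; have x0 : 0 <= x by apply: le_trans hx; rewrite invr_ge0.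
  by rewrite posp_id//; nra.
have q1 := sqr_ge0 (posp (s - 2^-1)); have q2 := sqr_ge0 (posp (- s - 2^-1)).
have [s0|s0] := leP 0 s.
  have : 4^-1 <= posp (s - 2^-1) ^+ 2 by apply: half; rewrite ger0_norm// in s1; lra.
  by lra.
have : 4^-1 <= posp (- s - 2^-1) ^+ 2 by apply: half; rewrite ltr0_norm// in s1; lra.
by lra.
Qed.

Lemma plateau_eq0 s : 1 <= `|s| -> plateau s = 0.
Proof. by move=> s1; rewrite /plateau (posp_le0 (far s1)) expr0n. Qed.

Lemma dplateau_eq0 s : 1 <= `|s| -> dplateau s = 0.
Proof. by move=> s1; rewrite /dplateau (posp_le0 (far s1)) mulr0 mul0r. Qed.

Lemma dplateau_eq0_near s : `|s| <= 2^-1 -> dplateau s = 0.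
Proof.
rewrite ler_norml => /andP[h1 h2]; rewrite /dplateau.
rewrite (posp_le0 (_ : s - 2^-1 <= 0)); last by rewrite subr_le0.
rewrite (posp_le0 (_ : - s - 2^-1 <= 0)); last by rewrite subr_le0 lerNl.
by rewrite subrr mulr0 oppr0 mulr0.
Qed.

Lemma dplateau_bounded s : `|dplateau s| <= 16.
Proof.
have [s1|s1] := leP 1 `|s|; first by rewrite dplateau_eq0// normr0.
rewrite /dplateau normrM normrN [X in _ * X]normrM (ger0_norm (mulr_ge0 _ (posp_ge0 _)))//.
have h1 : posp (1 - 4 * (posp (s - 2^-1) ^+ 2 + posp (- s - 2^-1) ^+ 2)) <= 1.
  by rewrite ge_max ler01 gerBl mulr_ge0// addr_ge0// sqr_ge0.
move: s1; rewrite ltr_norml => /andP[a b].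
have h2 : `|posp (s - 2^-1) - posp (- s - 2^-1)| <= 1.
  have u0 := posp_ge0 (s - 2^-1); have v0 := posp_ge0 (- s - 2^-1).
  have u1 : posp (s - 2^-1) <= 1 by rewrite ge_max ler01 /=; lra.
  have v1 : posp (- s - 2^-1) <= 1 by rewrite ge_max ler01 /=; lra.
  by rewrite ler_norml; apply/andP; split; lra.
have h3 := posp_ge0 (1 - 4 * (posp (s - 2^-1) ^+ 2 + posp (- s - 2^-1) ^+ 2)).
have -> : `|8 : R| = 8 by rewrite ger0_norm.
have h4 := normr_ge0 (posp (s - 2^-1) - posp (- s - 2^-1)).
nra.
Qed.

End positive_part.

(** * Cutoffs concentrating on a hyperplane *)

Section concentration.
Context {R : realType} (N : nat) (i0 : 'I_N) (c : R).
Local Notation Z := ('rV[R]_N * R)%type.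
Local Notation T := ('rV[R]_N * measurableTypeR R)%type.
Local Notation mu := (@lebesgue_st R N).
Implicit Types (z w : Z) (d L h : R).

Let i := Some i0.

Definition slab d L : set Z := [set z | `|crd i z - c| < d /\ `|z| < L].

Lemma measurable_slab d L : measurable (slab d L : set T).
Proof.
rewrite (_ : slab d L = (fun z : T => crd i z) @^-1` (ball c d) `&` ball (0 : Z) L).
  apply: measurableI; last exact: measurable_ball_st.
  rewrite -[X in measurable X]setTI; apply: measurable_crd => //.
  exact: measurable_ball.
apply/seteqP; split => z /=; rewrite -!ball_normE /= sub0r normrN distrC => -[] //.
Qed.

Lemma slab_measure_le L : 0 < L -> exists2 K : R, 0 <= K &
  forall d, 0 < d -> (mu (slab d L) <= (d * K)%:E)%E.
Proof.
move=> L0.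
exists (2 * \prod_(j < N | j != i0) (L *+ 2) * (L *+ 2)).
  by rewrite !mulr_ge0 ?mulrn_wge0 ?(ltW L0)// prodr_ge0// => j _; rewrite mulrn_wge0// ltW.
move=> d d0.
pose A (j : 'I_N) : set R := if j == i0 then ball c d else ball 0 L.
have mA j : measurable (A j) by rewrite /A; case: ifP => _; exact: measurable_ball.
pose box : set 'rV[R]_N := [set v | forall j, A j (v ord0 j)].
have mbox : measurable box.
  rewrite (_ : box = \bigcap_(j in [set: 'I_N]) ((fun v : 'rV[R]_N => v ord0 j) @^-1` A j)).
    apply: fin_bigcap_measurable => // j _.
    by rewrite -[X in measurable X]setTI; apply: measurable_coord.
  by apply/seteqP; split => [v Bv j _|v Bv j]; [exact: Bv|exact: Bv].
have mb : measurable (ball (0 : R) L) by exact: measurable_ball.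
apply: (@le_trans _ _ (mu (box `*` ball (0 : R)%R L))).
  apply: le_measure; rewrite ?inE; [exact: measurable_slab|exact: measurableX|].
  move=> z [zc zL]; have /norm_ltP hz := zL.
  split => [j|]; last by rewrite -ball_normE /= sub0r normrN; exact: (hz None).
  rewrite /A; case: eqP => [->|_]; rewrite -ball_normE /=.
    by rewrite distrC.
  by rewrite sub0r normrN; exact: (hz (Some j)).
rewrite [leLHS](_ : _ = (lebesgue_rV N box * lebesgue_measure (ball (0 : R)%R L))%E); last first.
  by apply: (product_measure1E _ _ mbox); exact: mb.
rewrite lebesgue_rV_box// (bigD1 i0)//= /A eqxx lebesgue_measure_ball ?(ltW d0)//.
rewrite (eq_bigr (fun=> (L *+ 2)%:E)); last first.
  by move=> j /negbTE ->; rewrite lebesgue_measure_ball// ltW.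
rewrite prodEFin lebesgue_measure_ball ?(ltW L0)// -!EFinM lee_fin.
by rewrite -(mulr_natl d) !mulrA (mulrC d).
Qed.

Let e : Z := (delta_mx ord0 i0, 0).

Let crd_e (j : option 'I_N) : crd j e = (j == i)%:R.
Proof. by case: j => [j|] //=; rewrite mxE /=. Qed.

Let norm_e : `|e| <= 1.
Proof.
by apply/norm_leP => // j; rewrite crd_e; case: (j == i); rewrite ?normr1 ?normr0.
Qed.

Let crd_Z (j : option 'I_N) s z : crd j (s *: z) = s * crd j z.
Proof. by case: j => [j|] //=; rewrite mxE. Qed.

Let proj z : Z := (c - crd i z) *: e + z.

Let proj_shift s z : proj (s *: e + z) = proj z.
Proof.
rewrite /proj crdD crd_Z crd_e eqxx mulr1 addrA -scalerDl; congr (_ *: _ + _); ring.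
Qed.

Let proj_dist z : `|z - proj z| <= `|crd i z - c|.
Proof.
rewrite /proj opprD addrCA subrr addr0 normrN normrZ distrC.
by rewrite ler_piMr.
Qed.

Let continuous_proj : continuous proj.
Proof.
move=> z; apply: cvgD; last exact: cvg_id.
apply: (@cvgZ _ _ _ _ _ (fun z : Z => c - crd i z) (cst e)); last exact: cvg_cst.
by apply: cvgB; [exact: cvg_cst|exact: continuous_crd].
Qed.

Lemma is_derive_cutoff d z v :
  is_derive z v (fun z => plateau ((crd i z - c) / d))
    (dplateau ((crd i z - c) / d) * (crd i v / d)).
Proof.
have h : is_derive z v (fun z => (crd i z - c) / d) (crd i v / d).
  have h1 := is_deriveZ d^-1 (is_deriveB (is_derive_crd i z v) (is_derive_cst c z v)).
  rewrite (_ : (fun z => _) = d^-1 *: (@crd R N i - cst c)).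
    by apply: (is_derive_eq h1); rewrite subr0 mulrC.
  by apply/funext => w; rewrite /= mulrC.
exact: (is_derive_chain (is_derive_plateau _) h).
Qed.

Let scaled_continuous (k : R -> R) d : continuous k -> continuous (fun z : Z => k ((crd i z - c) / d)).
Proof.
move=> ck z; apply: (@continuous_comp _ _ _ (fun z : Z => (crd i z - c) / d) k); last exact: ck.
by apply: cvgM; [apply: cvgB; [exact: continuous_crd|exact: cvg_cst]|exact: cvg_cst].
Qed.

(** The factor multiplying [F] has size 1 / d on a set of measure of order [d], so
    its integral need not be small by size alone. But it is the derivative along
    [i0] of a compactly supported function, so that the integral vanishes when [F]
    does not depend on the coordinate [i0]; replacing [F] by its restriction to
    the hyperplane costs at most the modulus of continuity of [F]. *)
Theorem concentration h F : ckernel h F -> forall ep, 0 < ep ->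
  exists2 d0, 0 < d0 & forall d, 0 < d < d0 ->
    `|\int[mu]_z (F z * (dplateau ((crd i z - c) / d) / d))| <= ep.
Proof.
move=> kF ep ep0.
pose L := `|h| + 2.
have L0 : 0 < L by rewrite ltr_wpDl.
have [K K0 hK] := slab_measure_le L0.
have ep1 : 0 < ep / (16 * K + 1) by rewrite divr_gt0// ltr_wpDl// mulr_ge0.
have [dd dd0 hdd] := ckernel_unif kF ep1.
exists (Num.min 1 dd); first by rewrite lt_min ltr01.
move=> d /andP[d0]; rewrite lt_min => /andP[d1 d_dd].
have sc z : d <= `|crd i z - c| -> 1 <= `|(crd i z - c) / d|.
  by rewrite normrM normfV (gtr0_norm d0) ler_pdivlMr// mul1r.
have cF0 : continuous (F \o proj).
  by move=> z; apply: continuous_comp; [exact: continuous_proj|exact: (proj1 kF)].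
have F0z z : h + 1 < `|z| -> `|crd i z - c| < d -> F (proj z) = 0.
  move=> hz cz; apply: (proj2 kF); rewrite -(ltrD2r 1) (lt_le_trans hz)//.
  rewrite -{1}(subrK (proj z) z) addrC (le_trans (ler_normD _ _))// lerD2l.
  by rewrite (le_trans (proj_dist z))// (le_trans (ltW cz))// ltW.
have kG : ckernel (h + 1) (fun z => F (proj z) * plateau ((crd i z - c) / d)).
  split; first by move=> z; apply: cvgM; [exact: cF0|exact: (@scaled_continuous plateau d (@continuous_plateau R) z)].
  move=> z hz; have [cz|cz] := ltP `|crd i z - c| d; first by rewrite F0z// mul0r.
  by rewrite plateau_eq0 ?mulr0// sc.
have kD : ckernel (h + 1) (fun z => F (proj z) * (dplateau ((crd i z - c) / d) / d)).
  split.
    move=> z; apply: cvgM; first exact: cF0.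
    by apply: cvgM; [exact: (@scaled_continuous dplateau d (@continuous_dplateau R) z)|exact: cvg_cst].
  move=> z hz; have [cz|cz] := ltP `|crd i z - c| d; first by rewrite F0z// mul0r.
  by rewrite dplateau_eq0 ?mul0r ?mulr0// sc.
(* With F frozen on the hyperplane, the integrand is the derivative along the
   coordinate of a compactly supported function. *)
have I0 : \int[mu]_z (F (proj z) * (dplateau ((crd i z - c) / d) / d)) = 0.
  apply: (@integral_derive_ckernel _ _ _ _ _ e kG kD) => z.
  have d1' : is_derive z e (F \o proj) 0.
    apply: is_derive_cvg; rewrite (_ : (fun s : R => _) = cst 0); first exact: cvg_cst.
    by apply/funext => s; rewrite /= proj_shift subrr scaler0.
  have := is_deriveM d1' (is_derive_cutoff d z e).
  by rewrite crd_e eqxx div1r scaler0 addr0.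
have kFk : ckernel h (fun z => F z * (dplateau ((crd i z - c) / d) / d)).
  split; last by move=> z hz; rewrite (proj2 kF)// mul0r.
  move=> z; apply: cvgM; first exact: (proj1 kF).
  by apply: cvgM; [exact: (@scaled_continuous dplateau d (@continuous_dplateau R) z)|exact: cvg_cst].
have i1 := integrable_ckernel kFk; have i2 := integrable_ckernel kD.
rewrite -[X in `|X|]subr0 -I0 -RintegralB//.
have mS : measurable (slab d L : set T) by exact: measurable_slab.
have i3 := integrable_EFinB measurableT i1 i2.
pose D z := F z * (dplateau ((crd i z - c) / d) / d) - F (proj z) * (dplateau ((crd i z - c) / d) / d).
rewrite -/D in i3 *.
have DS : D = D \_ (slab d L).
  apply/funext => z; rewrite /patch; case: ifPn => // /negP; rewrite inE => nS.
  have [cz|cz] := ltP `|crd i z - c| d; last by rewrite /D dplateau_eq0 ?mul0r ?mulr0 ?subrr// sc.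
  have hz : L <= `|z| by rewrite leNgt; apply/negP => zL; apply: nS.
  have h1 : h + 1 < `|z|.
    by rewrite (lt_le_trans _ hz)// /L (@le_lt_trans _ _ (`|h| + 1))// ?lerD2r ?ler_norm// ltrD2l ltr1n.
  rewrite /D F0z// (proj2 kF) ?mul0r ?subrr//.
  by rewrite (lt_trans _ h1)// ltrDl.
have iS : mu.-integrable (slab d L) (EFin \o D) by exact: (integrableS measurableT mS _ i3).
have finS : (mu (slab d L) < +oo)%E by apply: le_lt_trans (hK _ d0) _; rewrite ltry.
change (`|Rintegral mu setT D| <= ep); rewrite DS -Rintegral_mkcond.
(* The difference is supported in the slab, of measure at most d K, and the factor
   dplateau / d is at most 16 / d. *)
pose M := ep / (16 * K + 1) * (16 / d).
have M0 : 0 <= M by apply: mulr_ge0; [exact: ltW|rewrite divr_ge0// ltW].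
rewrite (le_trans (le_normr_Rintegral mS iS))//.
apply: (@le_trans _ _ (\int[mu]_(z in slab d L) (cst M z))).
  apply: le_Rintegral => //; first exact: (integrable_norm iS).
    apply: measurable_bounded_integrable => //.
    by exists M; split; [exact: num_real|move=> y My z _ /=; rewrite ger0_norm// ltW].
  move=> z [cz zL]; rewrite /D -mulrBl normrM ler_pM//.
    by apply/ltW/hdd; rewrite (le_lt_trans (proj_dist z))// (lt_trans cz).
  rewrite normrM normfV (gtr0_norm d0) ler_wpM2r ?invr_ge0 ?(ltW d0)//.
  exact: dplateau_bounded.
rewrite Rintegral_cst//.
apply: (@le_trans _ _ (M * (d * K))).
  rewrite ler_wpM2l// -lee_fin fineK ?hK//.
  by rewrite ge0_fin_numE.
rewrite /M (_ : _ * (d * K) = ep * ((16 * K) / (16 * K + 1))); last first.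
  by field; rewrite !gt_eqF//= ltr_wpDl// mulr_ge0.
by rewrite ger_pMr// ler_pdivrMr ?mul1r ?lerDl// ltr_wpDl// mulr_ge0.
Qed.

End concentration.

(** * The weak form of the inequality of a test function *)

Section C2_functions.
Context {R : realType} (N : nat) (p : R).
Hypothesis p_gt1 : 1 < p.
Local Notation Z := ('rV[R]_N * R)%type.
Local Notation T := ('rV[R]_N * measurableTypeR R)%type.
Local Notation mu := (@lebesgue_st R N).
Variables (U : set Z) (phi : Z -> R).
Hypothesis C2 : Ck 2 U phi.
Implicit Types (z v w : Z).

Definition space_dir (i : 'I_N) : Z := (delta_mx ord0 i, 0).

Lemma C2_derive z v : U z -> is_derive z v phi ('D_v phi z).
Proof.
by move=> Uz; apply/derivableP/diff_derivable; have [h _] := C2; exact: h.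
Qed.

Lemma C2_derive2 z v w : U z -> is_derive z w ('D_v phi) ('D_w ('D_v phi) z).
Proof.
move=> Uz; apply/derivableP/diff_derivable; have [_ h] := C2.
by have [h1 _] := h v; exact: h1.
Qed.

Lemma C2_continuous z : U z -> {for z, continuous phi}.
Proof.
by move=> Uz; apply: differentiable_continuous; have [h _] := C2; exact: h.
Qed.

Lemma C2_continuous1 z v : U z -> {for z, continuous ('D_v phi)}.
Proof.
move=> Uz; apply: differentiable_continuous; have [_ h] := C2.
by have [h1 _] := h v; exact: h1.
Qed.

Lemma C2_continuous2 z v w : U z -> {for z, continuous ('D_w ('D_v phi))}.
Proof. by move=> Uz; have [_ h] := C2; have [_ h1] := h v; exact: h1. Qed.

Lemma grad_coord z i : grad phi z ord0 i = 'D_(space_dir i) phi z.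
Proof. by rewrite mxE. Qed.

Lemma continuous_grad z : U z -> {for z, continuous (grad phi)}.
Proof.
move=> Uz; apply/(@cvgrPdist_lt _ 'rV[R]_N) => e e0.
have H : \forall w \near z, forall i, `|'D_(space_dir i) phi z - 'D_(space_dir i) phi w| < e.
  apply: (@filter_forall _ _ (fun i w => `|'D_(space_dir i) phi z - 'D_(space_dir i) phi w| < e) _ (nbhs_filter z)) => i.
  by have /cvgrPdist_lt /(_ _ e0) := @C2_continuous1 z (space_dir i) Uz.
apply: filterS H => w hw.
rewrite [ltLHS]/Num.Def.normr/= mx_normrE; apply/bigmax_ltP; split => //.
by move=> [a j] _ /=; rewrite (ord1 a) !mxE; exact: hw.
Qed.

Lemma continuous_flux_grad z i : U z -> {for z, continuous (fun z => flux p (grad phi z) ord0 i)}.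
Proof.
move=> Uz; apply: (@continuous_comp Z 'rV[R]_N R (grad phi) (fun v : 'rV[R]_N => flux p v ord0 i) z).
  exact: continuous_grad Uz.
exact: (continuous_flux_coord p_gt1).
Qed.

Lemma continuous_enorm_grad z : U z -> {for z, continuous (fun z => enorm (grad phi z))}.
Proof.
move=> Uz; apply: (@continuous_comp Z 'rV[R]_N R (grad phi) (@enorm R N) z).
  exact: continuous_grad Uz.
exact: (@continuous_enorm R N (grad phi z)).
Qed.

(** The derivative of the [i]-th component of the flux of [grad phi] in the
    direction [i], computed by the chain rule where the gradient does not vanish. *)
Definition dflux (i : 'I_N) z : R :=
  let g := grad phi z in
  enorm g `^ (p - 2) * hess phi z i i +
  (p - 2) * enorm g `^ (p - 2) / enorm g ^+ 2 * (\sum_j g ord0 j * hess phi z i j) * g ord0 i.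

(** The p-Laplacian is the divergence of the flux. *)
Lemma sum_dflux z : \sum_i dflux i z = p_laplace p phi z.
Proof.
rewrite /dflux /p_laplace big_split /= -mulr_sumr mulrDr; congr (_ * _ + _).
under eq_bigr do rewrite -mulrA; rewrite -mulr_sumr.
have -> : edot (grad phi z *m hess phi z) (grad phi z) =
   \sum_i (\sum_j grad phi z ord0 j * hess phi z i j) * grad phi z ord0 i.
  rewrite /edot; under eq_bigr do rewrite mxE mulr_suml.
  rewrite exchange_big /=; apply: eq_bigr => i _.
  by rewrite mulr_suml; apply: eq_bigr => j _; ring.
move: (enorm _ `^ _) (enorm _ ^- 2) (\sum_i _) => A B S.
by ring.
Qed.

Lemma enorm_powR (v : 'rV[R]_N) : enorm v `^ (p - 2) = edot v v `^ (2^-1 * (p - 2)).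
Proof. by rewrite powRrM powR12_sqrt// edot_ge0. Qed.

Lemma is_derive_flux z i : U z -> grad phi z != 0 ->
  is_derive z (space_dir i) (fun z => flux p (grad phi z) ord0 i) (dflux i z).
Proof.
move=> Uz g0.
have dE : is_derive z (space_dir i) (fun z => edot (grad phi z) (grad phi z))
    (\sum_j 2 * (grad phi z ord0 j * hess phi z i j)).
  have h (j : 'I_N) : is_derive z (space_dir i)
      (fun z => 'D_(space_dir j) phi z * 'D_(space_dir j) phi z)
      (2 * (grad phi z ord0 j * hess phi z i j)).
    have d := C2_derive2 (space_dir j) (space_dir i) Uz.
    refine (is_derive_eq (is_deriveM d d) _).
    rewrite !mxE /GRing.scale /= -/(dx i (dx j phi) z) -/(dx j phi z); ring.
  have := is_derive_sum h.
  rewrite (_ : \sum_(j < N) _ = fun z => edot (grad phi z) (grad phi z))//.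
  by apply/funext => w; rewrite fct_sumE; apply: eq_bigr => j _; rewrite !mxE.
have E0 : 0 < edot (grad phi z) (grad phi z).
  by rewrite -enorm_sqr exprn_gt0// enorm_gt0.
have dP := @is_derive_chain R _ (fun z => edot (grad phi z) (grad phi z)) (fun x : R => x `^ (2^-1 * (p - 2)))
  z _ _ _ (@is_derive1_powR R (2^-1 * (p - 2)) _ E0) dE.
have dg : is_derive z (space_dir i) ('D_(space_dir i) phi) (hess phi z i i).
  by rewrite mxE; exact: C2_derive2.
have dF := is_deriveM dP dg.
rewrite (_ : (fun z => _) = ((fun x : R => x `^ (2^-1 * (p - 2))) \o (fun z => edot (grad phi z) (grad phi z)))
   * 'D_(space_dir i) phi); last first.
  by apply/funext => w; rewrite mxE enorm_powR grad_coord.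
refine (is_derive_eq dF _).
rewrite /dflux /GRing.scale /= -enorm_powR; congr (_ + _).
have -> : edot (grad phi z) (grad phi z) `^ (2^-1 * (p - 2) - 1) =
   enorm (grad phi z) `^ (p - 2) / enorm (grad phi z) ^+ 2.
  rewrite powRB; last by apply/implyP => _; rewrite gt_eqF.
  by rewrite -enorm_powR powRr1 ?enorm_sqr// ltW.
rewrite -mulr_sumr -grad_coord; field.
by rewrite enorm_eq0.
Qed.

Lemma continuous_dflux z i : U z -> grad phi z != 0 -> {for z, continuous (dflux i)}.
Proof.
move=> Uz g0.
have n0 : 0 < enorm (grad phi z) by rewrite enorm_gt0.
have cP : {for z, continuous (fun z => enorm (grad phi z) `^ (p - 2))}.
  apply: (@continuous_comp _ _ _ (fun z => enorm (grad phi z)) (fun x : R => x `^ (p - 2))).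
    exact: continuous_enorm_grad.
  apply/differentiable_continuous/derivable1_diffP.
  by apply: ex_derive; exact: is_derive1_powR.
have cI : {for z, continuous (fun z => (enorm (grad phi z) ^+ 2)^-1)}.
  apply: (@cvgV _ _ _ _ (fun z => enorm (grad phi z) ^+ 2)).
    by rewrite expf_neq0// gt_eqF.
  rewrite expr2; under eq_fun do rewrite expr2.
  by apply: cvgM; exact: continuous_enorm_grad.
have cH j k : {for z, continuous (fun z => hess phi z j k)}.
  rewrite (_ : (fun z => _) = 'D_(space_dir j) ('D_(space_dir k) phi)).
    exact: C2_continuous2.
  by apply/funext => w; rewrite mxE.
have cg j : {for z, continuous (fun z => grad phi z ord0 j)}.
  rewrite (_ : (fun z => _) = 'D_(space_dir j) phi); first exact: C2_continuous1.
  by apply/funext => w; rewrite mxE.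
apply: cvgD; first by apply: cvgM; [exact: cP|exact: cH].
apply: cvgM; last exact: cg.
apply: cvgM.
  by apply: cvgM; [apply: cvgM; [exact: cvg_cst|exact: cP]|exact: cI].
by apply: continuous_sum_ord => j; apply: cvgM; [exact: cg|exact: cH].
Qed.

End C2_functions.

Section weak_subsolution.
Context {R : realType} (N : nat) (p : R).
Hypothesis p_gt1 : 1 < p.
Local Notation Z := ('rV[R]_N * R)%type.
Local Notation T := ('rV[R]_N * measurableTypeR R)%type.
Local Notation mu := (@lebesgue_st R N).

Lemma Rintegral_sum d (X : measurableType d) (m : {measure set X -> \bar R})
    (D : set X) n (F : 'I_n -> X -> R) : measurable D ->
  (forall i, m.-integrable D (EFin \o F i)) ->
  m.-integrable D (EFin \o (fun x => \sum_i F i x)) /\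
  \int[m]_(x in D) (\sum_i F i x) = \sum_i \int[m]_(x in D) F i x.
Proof.
move=> mD; elim: n F => [|n IHn] F iF.
  have E : (fun x => \sum_(i < 0) F i x) = cst 0 by apply/funext => x; rewrite big_ord0.
  rewrite E big_ord0; split; last by rewrite /Rintegral integral0.
  exact: integrable0.
have E : (fun x => \sum_(i < n.+1) F i x) = (fun x => F ord0 x + \sum_(i < n) F (lift ord0 i) x).
  by apply/funext => x; rewrite big_ord_recl.
have [i1 e1] := IHn (fun i => F (lift ord0 i)) (fun i => iF _).
rewrite E big_ord_recl; split; first exact: integrable_EFinD.
by rewrite RintegralD// e1.
Qed.

Variables (U : set Z) (phi : Z -> R).
Hypothesis C2 : Ck 2 U phi.
Variables (B C : set Z).
Hypotheses (oB : open B) (bB : bounded_set B) (BU : B `<=` U) (cC : closed C) (CB : C `<=` B).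
Variables (eta : Z -> R) (deta : 'I_N -> Z -> R).
Hypotheses (eta_derive : forall z, B z -> forall i, is_derive z (space_dir i) eta (deta i z))
  (eta_cont : forall z, B z -> {for z, continuous eta})
  (deta_cont : forall i z, B z -> {for z, continuous (deta i)})
  (eta_ge0 : forall z, B z -> 0 <= eta z)
  (eta_supp : forall z, B z -> ~ C z -> eta z = 0).
Variables (i0 : 'I_N) (x0 : 'rV[R]_N) (r : Z -> R).
Hypotheses (r_cont : forall z, B z -> {for z, continuous r})
  (grad_neq0 : forall z, B z -> z.1 <> x0 -> grad phi z != 0)
  (subsol : forall z, B z -> z.1 <> x0 -> r z <= p_laplace p phi z).

Let c := x0 ord0 i0.
Let a (i : 'I_N) z := flux p (grad phi z) ord0 i.
Let W z := \sum_i a i z * deta i z + eta z * r z.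

Let a_cont i z : B z -> {for z, continuous (a i)}.
Proof. by move=> Bz; apply: (continuous_flux_grad p_gt1 C2); exact: BU. Qed.

Let deta_supp i z : B z -> ~ C z -> deta i z = 0.
Proof.
exact: (derive_vanish oB cC (fun z Bz => eta_derive Bz i) eta_supp).
Qed.

Let W_cont z : B z -> {for z, continuous W}.
Proof.
move=> Bz; apply: cvgD.
  by apply: continuous_sum_ord => i; apply: cvgM; [exact: a_cont|exact: deta_cont].
by apply: cvgM; [exact: eta_cont|exact: r_cont].
Qed.

Let W_supp z : B z -> ~ C z -> W z = 0.
Proof.
move=> Bz nCz; rewrite /W eta_supp// mul0r addr0 big1// => i _.
by rewrite deta_supp// mulr0.
Qed.

Let crd_dir (i : 'I_N) : crd (Some i0) (space_dir i : Z) = (i == i0)%:R.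
Proof. by rewrite /= mxE eqxx eq_sym. Qed.

Section fixed_width.
Variables (d : R).
Hypothesis d0 : 0 < d.

Let s z := (crd (Some i0) z - c) / d.
Let chi z := 1 - plateau (s z).
Let B' : set Z := B `&` [set z | crd (Some i0) z != c].
Let C' : set Z := C `&` [set z | d / 2 <= `|crd (Some i0) z - c|].

Let oB' : open B'.
Proof.
apply: openI => //.
rewrite (_ : [set z : Z | _] = (@crd R N (Some i0)) @^-1` [set x | x != c])//.
apply: open_comp; last exact: open_neq.
by move=> z _; exact: continuous_crd.
Qed.

Let cC' : closed C'.
Proof.
apply: closedI => //.
rewrite (_ : [set z : Z | _] = (fun z : Z => `|crd (Some i0) z - c|) @^-1` [set x | d / 2 <= x])//.
apply: closed_comp; last exact: closed_ge.
move=> z _; apply: (@continuous_comp _ _ _ (fun z : Z => crd (Some i0) z - c) (fun x : R => `|x|)).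
  by apply: cvgB; [exact: continuous_crd|exact: cvg_cst].
exact: norm_continuous.
Qed.

Let C'B' : C' `<=` B'.
Proof.
move=> z [Cz hz]; split; first exact: CB.
apply/eqP => e; have : d / 2 <= `|crd (Some i0) z - c| := hz.
by rewrite e subrr normr0 leNgt divr_gt0.
Qed.

Let bB' : bounded_set B'.
Proof.
by have [M [Mr hM]] := bB; exists M; split => // y My z [Bz _]; exact: (hM y My).
Qed.

Let chi_near z : `|crd (Some i0) z - c| <= d / 2 -> chi z = 0.
Proof.
move=> h; rewrite /chi plateau_eq1 ?subrr// /s normrM normfV (gtr0_norm d0).
by rewrite ler_pdivrMr// mulrC.
Qed.

Let chi_supp z : B' z -> ~ C' z -> chi z = 0 \/ eta z = 0 /\ forall i, deta i z = 0.
Proof.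
move=> [Bz zc] nC'; have [Cz|nCz] := pselect (C z); last first.
  by right; split; [exact: eta_supp|move=> i; exact: deta_supp].
left; apply: chi_near; rewrite leNgt; apply/negP => h; apply: nC'; split => //.
exact: ltW.
Qed.

Let F (i : 'I_N) z := eta z * chi z * a i z.
Let dF (i : 'I_N) z := deta i z * chi z * a i z
  - eta z * (dplateau (s z) * ((i == i0)%:R / d)) * a i z + eta z * chi z * dflux p phi i z.

Let chi_cont z : {for z, continuous chi}.
Proof.
apply: cvgB; first exact: cvg_cst.
apply: (@continuous_comp _ _ _ s (@plateau R)); last exact: continuous_plateau.
by apply: cvgM; [apply: cvgB; [exact: continuous_crd|exact: cvg_cst]|exact: cvg_cst].
Qed.

Let dpl_cont z : {for z, continuous (dplateau \o s)}.
Proof.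
apply: (@continuous_comp _ _ _ s (@dplateau R)); last exact: continuous_dplateau.
by apply: cvgM; [apply: cvgB; [exact: continuous_crd|exact: cvg_cst]|exact: cvg_cst].
Qed.

Let B'_neq z : B' z -> z.1 <> x0.
Proof. by move=> [_ /eqP zc] zx; apply: zc; rewrite /= zx. Qed.

Let F_derive i z : B' z -> is_derive z (space_dir i) (F i) (dF i z).
Proof.
move=> B'z; have [Bz zc] := B'z.
have zx := B'_neq B'z.
have d1 := eta_derive Bz i.
have d2 : is_derive z (space_dir i) chi (- (dplateau (s z) * ((i == i0)%:R / d))).
  have h := is_deriveB (is_derive_cst (1 : R) z (space_dir i)) (is_derive_cutoff i0 c d z (space_dir i)).
  by refine (is_derive_eq h _); rewrite sub0r crd_dir.
have d3 := is_derive_flux p C2 i (BU Bz) (grad_neq0 Bz zx).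
have h := is_deriveM (is_deriveM d1 d2) d3.
rewrite (_ : F i = (eta * chi * (fun z => flux p (grad phi z) ord0 i)))//.
refine (is_derive_eq h _).
by rewrite !fctE /dF /a /GRing.scale /=; ring.
Qed.

Let dF_cont i z : B' z -> {for z, continuous (dF i)}.
Proof.
move=> B'z; have [Bz zc] := B'z.
have zx := B'_neq B'z.
apply: cvgD; first apply: cvgB.
- apply: cvgM; last exact: a_cont.
  by apply: cvgM; [exact: deta_cont|exact: chi_cont].
- apply: cvgM; last exact: a_cont.
  apply: cvgM; first exact: eta_cont.
  by apply: cvgM; [exact: dpl_cont|exact: cvg_cst].
- apply: cvgM; first by apply: cvgM; [exact: eta_cont|exact: chi_cont].
  by apply: (continuous_dflux C2 (BU Bz)); exact: grad_neq0.
Qed.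

Let F_cont i z : B' z -> {for z, continuous (F i)}.
Proof.
move=> B'z; have [Bz zc] := B'z.
apply: cvgM; last exact: a_cont.
by apply: cvgM; [exact: eta_cont|exact: chi_cont].
Qed.

Let F_supp i z : B' z -> ~ C' z -> F i z = 0.
Proof.
move=> B'z nC'; have [h|[h _]] := chi_supp B'z nC'; rewrite /F h ?mulr0 ?mul0r//.
Qed.

Let mB : measurable (B : set T). Proof. exact: open_measurable_st. Qed.
Let mB' : measurable (B' : set T). Proof. exact: open_measurable_st. Qed.

Let sum_dF0 : mu.-integrable B' (EFin \o (fun z => \sum_i dF i z)) /\
  \int[mu]_(z in B') (\sum_i dF i z) = 0.
Proof.
have idF i : mu.-integrable B' (EFin \o dF i).
  apply: (integrable_glue oB' bB' cC' C'B'); first exact: dF_cont.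
  exact: (derive_vanish oB' cC' (@F_derive i) (@F_supp i)).
have [iS eS] := @Rintegral_sum _ T mu B' N dF mB' idF; split => //.
rewrite eS big1// => i _.
exact: (integral_derive_eq0 oB' bB' cC' C'B' (@F_derive i) (@F_cont i) (@dF_cont i) (@F_supp i)).
Qed.

Let sum_dF z : \sum_i dF i z = chi z * (\sum_i a i z * deta i z) -
  eta z * a i0 z * (dplateau (s z) / d) + eta z * chi z * p_laplace p phi z.
Proof.
rewrite /dF big_split /= sumrB -mulr_sumr sum_dflux; congr (_ - _ + _).
  by rewrite mulr_sumr; apply: eq_bigr => i _; ring.
rewrite (bigD1 i0)//= eqxx big1 ?addr0 ?div1r => [|i /negbTE ->]; first by ring.
by rewrite mul0r !mulr0 mul0r.
Qed.

(** The field [F] has an integrable divergence of integral 0, because it vanishes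
    near the hyperplane. Expanding the divergence leaves the term in which the
    cutoff is differentiated. *)
Lemma cutoff_integral_le :
  \int[mu]_(z in B) (chi z * W z) <=
  \int[mu]_z (((fun z => eta z * a i0 z) \_ B) z * (dplateau (s z) / d)).
Proof.
have [iS S0] := sum_dF0.
have E1 : \int[mu]_(z in B) (chi z * W z) = \int[mu]_(z in B') (chi z * W z).
  rewrite Rintegral_mkcond [RHS]Rintegral_mkcond; congr Rintegral.
  apply/funext => z; rewrite /patch; have [Bz|nBz] := pselect (B z); last first.
    by rewrite !memNset// => -[].
  rewrite mem_set//; case: ifPn => // /negP; rewrite inE => nB'.
  have zc : crd (Some i0) z = c by apply/eqP/negPn/negP => h; apply: nB'; split.
  by rewrite chi_near ?mul0r// zc subrr normr0 divr_ge0// ltW.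
have E2 : \int[mu]_z (((fun z => eta z * a i0 z) \_ B) z * (dplateau (s z) / d)) =
    \int[mu]_(z in B') (eta z * a i0 z * (dplateau (s z) / d)).
  rewrite [RHS]Rintegral_mkcond; congr Rintegral.
  apply/funext => z; rewrite /patch; have [Bz|nBz] := pselect (B z); last first.
    by rewrite !memNset// ?mul0r// => -[].
  rewrite mem_set//; case: ifPn => // /negP; rewrite inE => nB'.
  have zc : crd (Some i0) z = c by apply/eqP/negPn/negP => h; apply: nB'; split.
  by rewrite dplateau_eq0_near ?mul0r ?mulr0// /s zc subrr mul0r normr0.
have BB' : B' `<=` B by move=> z [].
have iQ : mu.-integrable B' (EFin \o (fun z => eta z * a i0 z * (dplateau (s z) / d))).
  apply: (integrableS mB mB' BB').
  apply: (integrable_glue oB bB cC CB).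
    move=> z Bz; apply: cvgM; first by apply: cvgM; [exact: eta_cont|exact: a_cont].
    by apply: cvgM; [exact: dpl_cont|exact: cvg_cst].
  by move=> z Bz nCz; rewrite eta_supp// !mul0r.
have iW : mu.-integrable B' (EFin \o (fun z => chi z * W z)).
  apply: (integrableS mB mB' BB').
  apply: (integrable_glue oB bB cC CB).
    by move=> z Bz; apply: cvgM; [exact: chi_cont|exact: W_cont].
  by move=> z Bz nCz; rewrite W_supp// mulr0.
rewrite E1 E2 -[leRHS]add0r -S0 -RintegralD//.
apply: le_Rintegral => //; first exact: integrable_EFinD.
move=> z B'z; have [Bz _] := B'z.
rewrite sum_dF /W.
have h : eta z * chi z * r z <= eta z * chi z * p_laplace p phi z.
  rewrite ler_wpM2l ?mulr_ge0 ?eta_ge0 ?subr_ge0 ?plateau_le1//.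
  by apply: subsol => //; exact: B'_neq.
set X := \sum_i _; set Y := eta z * a i0 z * _.
have -> : chi z * (X + eta z * r z) = chi z * X + eta z * chi z * r z by ring.
have -> : chi z * X - Y + eta z * chi z * p_laplace p phi z + Y =
  chi z * X + eta z * chi z * p_laplace p phi z by ring.
by rewrite lerD2l.
Qed.

End fixed_width.

(** Multiply by the cutoff 1 - plateau, which removes a neighbourhood of the
    hyperplane through [x0], where the p-Laplacian is not controlled. As the width
    [d] tends to 0 the error terms vanish: one by [concentration], the other
    because the slab has small measure. *)
Theorem subsolution_weak : \int[mu]_(z in B) (\sum_i a i z * deta i z + eta z * r z) <= 0.
Proof.
have mB : measurable (B : set T) by exact: open_measurable_st.
have iW : mu.-integrable B (EFin \o W) by exact: (integrable_glue oB bB cC CB W_cont W_supp).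
have [h kW] := ckernel_glue oB bB cC CB W_cont W_supp.
have [M M0 hM] := ckernel_bounded kW.
have WM z : B z -> `|W z| <= M by move=> Bz; have := hM z; rewrite /patch mem_set.
have [h' kF] : exists h, ckernel h ((fun z => eta z * a i0 z) \_ B).
  apply: (ckernel_glue oB bB cC CB).
    by move=> z Bz; apply: cvgM; [exact: eta_cont|exact: a_cont].
  by move=> z Bz nCz; rewrite eta_supp// mul0r.
have [L L0 BL] : exists2 L : R, 0 < L & forall z, B z -> `|z| < L.
  have [Y [Yr hY]] := bB; exists (`|Y| + 2); first by rewrite ltr_wpDl.
  move=> z Bz; have : Y < `|Y| + 1 by rewrite (le_lt_trans (ler_norm _))// ltrDl.
  move=> /hY /(_ z Bz) /= hz; rewrite (le_lt_trans hz)// ltrD2l ltr1n//.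
have [K K0 hK] := slab_measure_le i0 c L0.
apply/ler_addgt0Pl => e e0; rewrite addr0.
have e2 : 0 < e / 2 by rewrite divr_gt0.
have [d1 d10 hd1] := concentration i0 c kF e2.
pose d2 := e / 2 / (M * K + 1).
have MK : 0 < M * K + 1 by rewrite ltr_wpDl// mulr_ge0.
have d20 : 0 < d2 by rewrite divr_gt0.
pose d := Num.min (d1 / 2) d2.
have d0 : 0 < d by rewrite lt_min d20 divr_gt0.
have dd1 : d < d1 by rewrite gt_min; apply/orP; left; rewrite ltr_pdivrMr// ltr_pMr// ltr1n.
pose chi z := 1 - plateau ((crd (Some i0) z - c) / d).
pose kap z := plateau ((crd (Some i0) z - c) / d).
have kap_cont : continuous kap.
  move=> z; apply: (@continuous_comp _ _ _ (fun z : Z => (crd (Some i0) z - c) / d) (@plateau R));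
    last exact: continuous_plateau.
  by apply: cvgM; [apply: cvgB; [exact: continuous_crd|exact: cvg_cst]|exact: cvg_cst].
have i1 : mu.-integrable B (EFin \o (fun z => chi z * W z)).
  apply: (integrable_glue oB bB cC CB).
    move=> z Bz; apply: cvgM; last exact: W_cont.
    by apply: cvgB; [exact: cvg_cst|exact: kap_cont].
  by move=> z Bz nCz; rewrite W_supp// mulr0.
have i2 : mu.-integrable B (EFin \o (fun z => kap z * W z)).
  apply: (integrable_glue oB bB cC CB).
    by move=> z Bz; apply: cvgM; [exact: kap_cont|exact: W_cont].
  by move=> z Bz nCz; rewrite W_supp// mulr0.
have E : \int[mu]_(z in B) W z =
    \int[mu]_(z in B) (chi z * W z) + \int[mu]_(z in B) (kap z * W z).
  by rewrite -RintegralD//; apply: eq_Rintegral => z _; rewrite /chi /kap; ring.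
rewrite -/W in E *; rewrite (_ : \int[mu]_(z in B) _ = \int[mu]_(z in B) W z)// E.
rewrite [e]splitr lerD//.
  apply: (le_trans (cutoff_integral_le d0)); apply: (le_trans (ler_norm _)).
  by apply: hd1; rewrite d0 dd1.
have mS : measurable (slab i0 c d L : set T) by exact: measurable_slab.
have mBS : measurable (B `&` slab i0 c d L : set T) by exact: measurableI.
have finS : (mu (B `&` slab i0 c d L) <= (d * K)%:E)%E.
  by apply: le_trans (hK _ d0); apply: le_measure; rewrite ?inE//; exact: subIsetr.
have finS' : (mu (B `&` slab i0 c d L) < +oo)%E by apply: le_lt_trans finS _; rewrite ltry.
rewrite (_ : \int[mu]_(z in B) (kap z * W z) =
   \int[mu]_(z in B `&` slab i0 c d L) (kap z * W z)); last first.
  rewrite Rintegral_mkcondr; apply: eq_Rintegral => z; rewrite inE => Bz.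
  rewrite /patch; case: ifPn => // /negP; rewrite inE => nS.
  rewrite /kap plateau_eq0 ?mul0r// normrM normfV (gtr0_norm d0) ler_pdivlMr// mul1r.
  by rewrite leNgt; apply/negP => hz; apply: nS; split => //; exact: BL.
have i3 : mu.-integrable (B `&` slab i0 c d L) (EFin \o (fun z => kap z * W z)).
  by apply: (integrableS mB mBS _ i2); exact: subIsetl.
rewrite (le_trans (ler_norm _))// (le_trans (le_normr_Rintegral mBS i3))//.
apply: (@le_trans _ _ (\int[mu]_(z in B `&` slab i0 c d L) (cst M z))).
  apply: le_Rintegral => //; first exact: (integrable_norm i3).
    apply: measurable_bounded_integrable => //.
    by exists M; split; [exact: num_real|move=> y My z _ /=; rewrite ger0_norm// ltW].
  move=> z [Bz _]; rewrite normrM -[leRHS]mul1r ler_pM// ?WM//.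
  by rewrite /kap ger0_norm ?plateau_ge0// plateau_le1.
rewrite Rintegral_cst//.
apply: (@le_trans _ _ (M * (d * K))).
  rewrite ler_wpM2l// -lee_fin fineK//.
  by rewrite ge0_fin_numE.
apply: (@le_trans _ _ (d2 * (M * K + 1))); last by rewrite /d2 divfK// gt_eqF.
rewrite mulrCA ler_pM ?(ltW d0) ?mulr_ge0// ?lerDl//.
by rewrite ge_min lexx orbT.
Qed.

End weak_subsolution.

(** * Integrability of the data of a weak supersolution *)

Section power_bounds.
Context {R : realType} (p : R).
Hypothesis p_gt1 : 1 < p.

Lemma powR_le1D (a q : R) : 0 <= a -> 0 <= q <= p -> a `^ q <= 1 + a `^ p.
Proof.
move=> a0 /andP[q0 qp].
have [a1|a1] := leP a 1.
  have one : 1 `^ q = 1 :> R by rewrite powR1.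
  apply: (@le_trans _ _ 1); last by rewrite lerDl powR_ge0.
  by rewrite -[leRHS]one; apply: ge0_ler_powR; rewrite ?nnegrE.
apply: (@le_trans _ _ (a `^ p)); last by rewrite lerDr.
by apply: ler_powR => //; exact: ltW.
Qed.

Lemma le_1D_powR (a : R) : 0 <= a -> a <= 1 + a `^ p.
Proof.
by move=> a0; rewrite -[leLHS]powRr1//; apply: powR_le1D => //; rewrite ler01 ltW.
Qed.

End power_bounds.

Section supersolution_data.
Context {R : realType} (N : nat) (p : R).
Hypothesis p_gt1 : 1 < p.
Local Notation Z := ('rV[R]_N * R)%type.
Local Notation T := ('rV[R]_N * measurableTypeR R)%type.
Local Notation mu := (@lebesgue_st R N).
Implicit Types (z w : Z).

(** Space-time carries the sup norm. *)
Lemma cylinder_ball (x : 'rV[R]_N) (t r : R) :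
  cylinder (ball x r) (t - r) (t + r) = ball (x, t) r.
Proof.
apply/seteqP; split => -[y s] /=; rewrite /cylinder -!ball_normE /= prod_normE /= gt_max.
  move=> [/= h1]; rewrite in_itv /= => /andP[h2 h3].
  by rewrite h1 /= ltr_distlC h2 h3.
by move=> /andP[h1]; rewrite ltr_distlC => h2; split => //=; rewrite in_itv.
Qed.

Lemma measurable_row (Q : set Z) (Du : Z -> 'rV[R]_N) : measurable (Q : set T) ->
  measurable_fun (Q : set T) Du ->
  measurable_fun [set: T] (fun z => if z \in Q then Du z else 0 : 'rV[measurableTypeR R]_N).
Proof.
move=> mQ mDu; apply/measurable_fun_rVP => i.
rewrite (_ : (fun z => _) = (fun z => Du z ord0 i) \_ Q).
  by apply/(measurable_restrictT _ mQ); exact: (measurableT_comp (measurable_coord i) mDu).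
by apply/funext => z; rewrite /patch; case: ifP => //; rewrite mxE.
Qed.

(** Completed by the time 0, a row vector becomes a point of space-time, where
    continuous functions are measurable. *)
Lemma measurable_continuous_row (Q : set Z) (Du : Z -> 'rV[R]_N) (g : 'rV[R]_N -> R) :
  measurable (Q : set T) -> measurable_fun (Q : set T) Du -> continuous g ->
  measurable_fun (Q : set T) (g \o Du).
Proof.
move=> mQ mDu cg.
pose D z : 'rV[R]_N := if z \in Q then Du z else 0.
have mg : measurable_fun [set: T] (fun z : T => g z.1).
  apply: continuous_measurable_st => z.
  by apply: (@continuous_comp Z 'rV[R]_N R fst g); [exact: cvg_fst|exact: cg].
have mD : measurable_fun [set: T] (fun z => (D z, 0 : measurableTypeR R) : T).
  by apply/measurable_fun_pairP; split; [exact: measurable_row|exact: measurable_cst].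
have mgD := measurableT_comp mg mD.
apply: (eq_measurable_fun (g \o D)); last exact: measurable_funTS mgD.
by move=> z zQ /=; rewrite /D zQ.
Qed.

Section integrability.
Variables (Q : set Z) (u : Z -> R) (Du : Z -> 'rV[R]_N).
Hypotheses (mQ : measurable (Q : set T)) (bQ : bounded_set Q)
  (mu_u : measurable_fun (Q : set T) u) (mDu : measurable_fun (Q : set T) Du)
  (fin : (\int[mu]_(z in Q) (`|u z| `^ p + enorm (Du z) `^ p)%:E < +oo)%E).

(** The added 1 makes the energy dominate all lower powers of the gradient as well
    as constants. *)
Definition energy z : R := 1 + enorm (Du z) `^ p.

Let men : measurable_fun (Q : set T) (fun z => enorm (Du z) `^ p).
Proof.
have h := measurable_continuous_row mQ mDu (@continuous_enorm R N).
exact: (measurableT_comp (measurable_powR p) h).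
Qed.

Lemma integrable_energy : mu.-integrable Q (EFin \o energy).
Proof.
apply: integrable_EFinD => //.
  apply: measurable_bounded_integrable => //.
    exact: lebesgue_st_bounded.
  exists 1; split; first exact: num_real.
  by move=> y y1 z _ /=; rewrite normr1 ltW.
apply/integrableP; split; first exact/measurable_EFinP.
apply: le_lt_trans fin; apply: ge0_le_integral => //.
- by apply/measurable_EFinP; apply: measurableT_comp.
- apply/measurable_EFinP; apply: measurable_funD => //.
  apply: (measurableT_comp (measurable_powR p)).
  exact: measurableT_comp.
- by move=> z _; rewrite lee_fin ger0_norm ?powR_ge0// lerDr powR_ge0.
Qed.

Lemma integrable_le_energy (g : Z -> R) (K : R) : measurable_fun (Q : set T) g ->
  (forall z, Q z -> `|g z| <= K * energy z) -> mu.-integrable Q (EFin \o g).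
Proof.
move=> mg hg.
apply: (le_integrable mQ _ _ (integrable_EFinZ K mQ integrable_energy)).
  exact/measurable_EFinP.
by move=> z Qz /=; rewrite lee_fin (le_trans (hg z Qz))// ler_norm.
Qed.

Lemma integrable_Du i : mu.-integrable Q (EFin \o (fun z => Du z ord0 i)).
Proof.
apply: (@integrable_le_energy _ 1).
  exact: (measurableT_comp (measurable_coord i) mDu).
move=> z _; rewrite mul1r (le_trans (le_coord_enorm _ _))//.
by apply: le_1D_powR => //; exact: enorm_ge0.
Qed.

Lemma integrable_flux i : mu.-integrable Q (EFin \o (fun z => flux p (Du z) ord0 i)).
Proof.
apply: (@integrable_le_energy _ 1).
  apply: (measurable_continuous_row (g := fun v => flux p v ord0 i) mQ mDu).
  by move=> v; exact: continuous_flux_coord.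
move=> z _; rewrite mul1r (le_trans (le_flux_coord _ _ _))//.
by apply: powR_le1D; rewrite ?enorm_ge0// subr_ge0 (ltW p_gt1)/= gerBl ler01.
Qed.

Lemma integrable_reaction (f : 'rV[R]_N -> R) (Cf beta : R) : continuous f -> 0 <= Cf ->
  1 <= beta -> beta < p -> (forall v, `|f v| <= Cf * (1 + enorm v `^ beta)) ->
  mu.-integrable Q (EFin \o (fun z => f (Du z))) /\
  forall z, `|f (Du z)| <= 2 * Cf * energy z.
Proof.
move=> cf Cf0 b1 bp fg.
have H z : `|f (Du z)| <= 2 * Cf * energy z.
  rewrite (le_trans (fg _))// [leRHS](_ : _ = Cf * (2 * energy z)); last by ring.
  rewrite ler_wpM2l//.
  rewrite /energy.
  have h : enorm (Du z) `^ beta <= 1 + enorm (Du z) `^ p.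
    by apply: powR_le1D; rewrite ?enorm_ge0// (le_trans ler01 b1) ltW.
  by have := powR_ge0 (enorm (Du z)) p; lra.
split => //; apply: (@integrable_le_energy _ (2 * Cf)) => //.
exact: (measurable_continuous_row mQ mDu cf).
Qed.

End integrability.
End supersolution_data.

(** * The mollified supersolution *)

Section mollified_equation.
Context {R : realType} (N : nat) (p : R).
Local Notation Z := ('rV[R]_N * R)%type.
Local Notation T := ('rV[R]_N * measurableTypeR R)%type.
Local Notation mu := (@lebesgue_st R N).
Implicit Types (z w : Z).

Lemma derive_translate (V : normedModType R) (k : V -> R) (v a w : V) :
  'D_v (fun y => k (y - a)) w = 'D_v k (w - a).
Proof.
by rewrite /derive; congr (lim (_ @ 0^')); apply/funext => h /=; rewrite addrA.
Qed.

Variables (Q : set Z).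
Hypotheses (mQ : measurable (Q : set T)).
Variables (h : R) (z : Z).
Hypotheses (h0 : 0 < h) (hQ : forall w, `|w - z| <= h -> Q w).

Let k : Z -> R := mollifier h.
Let psi w := k (w - z).

Let psi_test : test_function Q psi.
Proof.
apply: (@test_function_ckernel _ _ _ h); first by move=> n; exact: Ck_mollifier.
  exact: ckernel_mollifier.
exact: hQ.
Qed.

Let dk v := 'D_v k.

Lemma ckernel_dmollifier v : ckernel h ('D_v (@mollifier R N h)).
Proof.
apply: ckernel_derive; last exact: ckernel_mollifier.
have := @Ck_mollifier R N h 0 1.
by rewrite (_ : (fun w => _) = mollifier h)//; apply/funext => w; rewrite subr0.
Qed.

Let off w : ~ Q w -> psi w = 0 /\ forall v, dk v (w - z) = 0.
Proof.
move=> nQ; have wh : h < `|w - z| by rewrite ltNge; apply/negP => /hQ.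
split; first by rewrite /psi /k (proj2 (ckernel_mollifier N h)).
by move=> v; rewrite /dk (proj2 (ckernel_dmollifier v)).
Qed.

Let dtE w : dt psi w = dk ((0 : 'rV[R]_N), (1 : R)) (w - z).
Proof. exact: derive_translate. Qed.

Let dxE i w : dx i psi w = dk (space_dir i) (w - z).
Proof. exact: derive_translate. Qed.

(** The translate of the mollifier centred at [z] is an admissible test function. *)
Lemma mollified_supersolution (Xi : set Z) (f : 'rV[R]_N -> R) (u : Z -> R) (Du : Z -> 'rV[R]_N) :
  measurable (Xi : set T) -> Q `<=` Xi ->
  mu.-integrable Q (EFin \o u) ->
  (forall i, mu.-integrable Q (EFin \o (fun w => flux p (Du w) ord0 i))) ->
  mu.-integrable Q (EFin \o (f \o Du)) ->
  (forall psi, test_function Q psi -> (forall w, 0 <= psi w) ->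
    (0 <= \int[mu]_(w in Xi)
      (- u w * dt psi w + enorm (Du w) `^ (p - 2) * edot (Du w) (grad psi w)
       - psi w * f (Du w))%:E)%E) ->
  0 <= - convolve Q ('D_((0 : 'rV[R]_N), (1 : R)) (mollifier h)) u z
   + \sum_i convolve Q ('D_(space_dir i) (mollifier h)) (fun w => flux p (Du w) ord0 i) z
   - convolve Q (mollifier h) (f \o Du) z.
Proof.
move=> mXi QXi iu iflux ifD weak.
have := weak psi psi_test (fun w => mollifier_ge0 _ h0).
pose G w := - u w * dt psi w + enorm (Du w) `^ (p - 2) * edot (Du w) (grad psi w)
   - psi w * f (Du w).
rewrite -[X in (0 <= X)%E]/(\int[mu]_(w in Xi) (G w)%:E)%E.
pose G' w := - (dk ((0 : 'rV[R]_N), (1 : R)) (w - z) * u w) + \sum_i dk (space_dir i) (w - z) * flux p (Du w) ord0 i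
   - k (w - z) * f (Du w).
have GE w : G w = G' w.
  rewrite /G /G' dtE; congr (_ + _ - _); first by rewrite mulNr mulrC.
  rewrite /edot mulr_sumr; apply: eq_bigr => i _.
  by rewrite mxE dxE mxE; ring.
have -> : (\int[mu]_(w in Xi) (G w)%:E = \int[mu]_(w in Q) (G' w)%:E)%E.
  rewrite integral_mkcond [RHS]integral_mkcond; apply: eq_integral => w _.
  rewrite /patch; have [Qw|nQw] := pselect (Q w).
    by rewrite !mem_set// ?GE//; exact: QXi.
  rewrite (memNset nQw); case: ifP => // _; rewrite GE /G'.
  have [e1 e2] := off nQw.
  rewrite e2 -/(psi w) e1 !mul0r subr0 oppr0 add0r big1 // => i _.
  by rewrite e2 mul0r.
move=> I0.
have kt := ckernel_dmollifier ((0 : 'rV[R]_N), (1 : R)).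
have i1 := integrable_convolve mQ iu z kt.
have i2 i := integrable_convolve mQ (iflux i) z (ckernel_dmollifier (space_dir i)).
have i3 := integrable_convolve mQ ifD z (ckernel_mollifier N h).
have [iS eS] := @Rintegral_sum _ _ T mu Q N
  (fun i w => dk (space_dir i) (w - z) * flux p (Du w) ord0 i) mQ i2.
have := fine_ge0 I0; rewrite -/(Rintegral mu Q G') /G'.
have i1' : mu.-integrable Q (EFin \o (fun w => - (dk ((0 : 'rV[R]_N), (1 : R)) (w - z) * u w))).
  have := integrable_EFinZ (-1) mQ i1.
  by rewrite (_ : (fun x => _) = (fun w => - (dk ((0 : 'rV[R]_N), (1 : R)) (w - z) * u w)))//; apply/funext => w; rewrite mulN1r.
rewrite RintegralB//; last exact: integrable_EFinD.
rewrite RintegralD// eS.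
have -> : \int[mu]_(w in Q) - (dk ((0 : 'rV[R]_N), (1 : R)) (w - z) * u w) =
    - convolve Q ('D_((0 : 'rV[R]_N), (1 : R)) (mollifier h)) u z.
  rewrite /convolve -mulN1r -RintegralZl//.
  by apply: eq_Rintegral => w _; rewrite mulN1r.
by [].
Qed.

End mollified_equation.

Section mollified_gradient.
Context {R : realType} (N : nat) (p : R).
Local Notation Z := ('rV[R]_N * R)%type.
Local Notation T := ('rV[R]_N * measurableTypeR R)%type.
Local Notation mu := (@lebesgue_st R N).
Implicit Types (z w : Z).

Lemma compact_norm_sub_le_rV (a : 'rV[R]_N) (h : R) : compact [set x : 'rV[R]_N | `|x - a| <= h].
Proof.
apply: bounded_closed_compact; last exact: closed_norm_sub_le.
exists (h + `|a|); split; first exact: num_real.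
move=> y hy x /= xh; rewrite (le_trans _ (ltW hy))// -(subrK a x).
by rewrite (le_trans (ler_normD _ _))// lerD2r.
Qed.

(** A ball of space is a slice of a ball of space-time. *)
Lemma measurable_ball_rV (a : 'rV[R]_N) (r : R) : measurable (ball a r).
Proof.
rewrite (_ : ball a r = ysection (ball (a, 0) r : set T) (0 : R)).
  by apply: measurable_ysection; exact: measurable_ball_st.
apply/seteqP; split => x; rewrite /ysection /= -!ball_normE /= ?inE /= prod_normE /= gt_max subrr normr0.
  by move=> ax; rewrite ax (le_lt_trans _ ax).
by move=> /andP[].
Qed.

Lemma mollifier_slice (h t s : R) (a x : 'rV[R]_N) :
  mollifier h ((x, t) - (a, s)) = (bump_mass N h)^-1 * bump1 h (t - s) * bumpx h (x - a).
Proof. by rewrite /mollifier /bumpz /=; ring. Qed.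

Lemma derive_slice (k : Z -> R) (t : R) (x v : 'rV[R]_N) :
  'D_v (fun y => k (y, t)) x = 'D_((v, 0) : Z) k (x, t).
Proof.
rewrite /derive; congr (lim (_ @ 0^')); apply/funext => h /=.
congr (_ *: (k _ - _)); congr pair => /=.
by rewrite scaler0 add0r.
Qed.

(** Fubini: at almost every time the restriction of the mollifier to the time
    slice is a test function in space, against which [Du] is the weak gradient. *)
Lemma mollified_gradient (x0 : 'rV[R]_N) (t0 r h : R) (z : Z) (u : Z -> R) (Du : Z -> 'rV[R]_N)
    (i : 'I_N) : 0 < h ->
  (forall w, `|w - z| <= h -> ball (x0, t0) r w) ->
  mu.-integrable (ball (x0, t0) r) (EFin \o u) ->
  mu.-integrable (ball (x0, t0) r) (EFin \o (fun w => Du w ord0 i)) ->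
  {ae (@lebesgue_measure R), forall t, t0 - r < t < t0 + r ->
    sobolev p (ball x0 r) (fun x => u (x, t)) (fun x => Du (x, t))} ->
  convolve (ball (x0, t0) r) ('D_(space_dir i) (mollifier h)) u z =
  - convolve (ball (x0, t0) r) (mollifier h) (fun w => Du w ord0 i) z.
Proof.
set Q := ball (x0, t0) r => h0 hQ iu iDu slices.
have mQ : measurable (Q : set T) by exact: measurable_ball_st.
have mb := measurable_ball_rV x0 r.
pose k : Z -> R := mollifier h.
pose A w := 'D_(space_dir i) k (w - z) * u w.
pose B w := k (w - z) * - Du w ord0 i.
have iA : mu.-integrable setT (EFin \o (A \_ Q)).
  rewrite -restrict_EFin; apply/(integrable_mkcond _ mQ).
  have := integrable_convolve mQ iu z (@ckernel_dmollifier R N h (space_dir i)).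
  exact: id.
have iN : mu.-integrable Q (EFin \o (fun w => - Du w ord0 i)).
  have := integrable_EFinZ (-1) mQ iDu.
  by rewrite (_ : (fun w => _) = (fun w => - Du w ord0 i))//; apply/funext => w; rewrite mulN1r.
have iB : mu.-integrable setT (EFin \o (B \_ Q)).
  rewrite -restrict_EFin; apply/(integrable_mkcond _ mQ).
  exact: (integrable_convolve mQ iN z (ckernel_mollifier N h)).
pose m1 := lebesgue_rV N : {sigma_finite_measure set 'rV[R]_N -> \bar R}.
pose m2 := @lebesgue_measure R : {sigma_finite_measure set (measurableTypeR R) -> \bar R}.
have sA := @ae_integrable2 _ _ _ _ R m1 m2 _ iA.
have sB := @ae_integrable2 _ _ _ _ R m1 m2 _ iB.
have eA := @integral21_prod_meas1 _ _ _ _ R m1 m2 _ iA.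
have eB := @integral21_prod_meas1 _ _ _ _ R m1 m2 _ iB.
have FF : Filter (almost_everywhere m2) by exact: ae_filter_ringOfSetsType.
have QE x t : Q (x, t) = (ball x0 r x /\ t0 - r < t < t0 + r).
  by rewrite /Q -cylinder_ball /cylinder /= in_itv.
(* For almost every time the two slices have opposite integrals: by the definition
   of the weak gradient, or because both vanish. *)
have key : {ae m2, forall t, (\int[m1]_x ((A \_ Q) (x, t))%:E =
    \int[m1]_x ((B \_ Q) (x, t))%:E)%E}.
  have sl : {ae m2, forall t, t0 - r < t < t0 + r ->
      sobolev p (ball x0 r) (fun x => u (x, t)) (fun x => Du (x, t))} := slices.
  apply: filterS3 sl sA sB => t st At Bt.
  have [[tI tz]|off] := pselect (t0 - r < t < t0 + r /\ `|t - z.2| <= h); last first.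
    have AB x : (A \_ Q) (x, t) = 0 /\ (B \_ Q) (x, t) = 0.
      rewrite /patch; case: ifPn => // /set_mem; rewrite QE => -[_ tI].
      have hw : h < `|(x, t) - z|.
        rewrite ltNge; apply/negP => wz; apply: off; split => //.
        by rewrite (le_trans _ wz)// prod_normE /= le_max lexx orbT.
      rewrite /A /B /k (proj2 (@ckernel_dmollifier R N h _)) ?(proj2 (ckernel_mollifier N h))//.
      by rewrite !mul0r.
    rewrite !integral0_eq ?oppe0// => x _; first by rewrite (proj2 (AB x)).
    by rewrite (proj1 (AB x)).
  pose psi (x : 'rV[R]_N) := mollifier h ((x, t) - z).
  have [_ _ _ weak] := st tI.
  have tpsi : test_function (ball x0 r) psi.
    apply: (@test_function_ball _ _ z.1 h).
    - exact: compact_norm_sub_le_rV.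
    - move=> n; rewrite (_ : psi = fun x => ((bump_mass N h)^-1 * bump1 h (t - z.2)) * bumpx h (x - z.1)).
        by apply: Ck_mul; [exact: Ck_cst|exact: Ck_bumpx].
      by apply/funext => x; rewrite /psi (surjective_pairing z) mollifier_slice.
    - move=> x hx; rewrite /psi (proj2 (ckernel_mollifier N h))//.
      by rewrite prod_normE /= lt_max hx.
    - move=> x hx; have : Q (x, t) by apply: hQ; rewrite prod_normE /= ge_max hx tz.
      by rewrite QE => -[].
  have slice (F : Z -> R) (G : 'rV[R]_N -> R) : (forall x, F (x, t) = G x) ->
      m1.-integrable setT (fun x => ((F \_ Q) (x, t))%:E) ->
      (\int[m1]_x ((F \_ Q) (x, t))%:E = (\int[m1]_(x in ball x0 r) G x)%:E)%E /\
      m1.-integrable (ball x0 r) (EFin \o G).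
    move=> FG iF.
    have FE x : (F \_ Q) (x, t) = (G \_ (ball x0 r)) x.
      rewrite /patch FG; have [xb|nb] := pselect (ball x0 r x).
        by rewrite !mem_set// QE.
      by rewrite !memNset// QE => -[].
    split; last first.
      apply/(integrable_mkcond _ mb); rewrite restrict_EFin.
      rewrite (_ : EFin \o _ = (fun x => ((F \_ Q) (x, t))%:E))//.
      by apply/funext => x /=; rewrite FE.
    rewrite /Rintegral [in RHS]integral_mkcond restrict_EFin.
    rewrite (_ : EFin \o _ = (fun x => ((F \_ Q) (x, t))%:E)).
      by rewrite fineK//; exact: integrable_fin_num.
    by apply/funext => x /=; rewrite FE.
  have [|-> _] := slice A (fun x => u (x, t) * 'D_(delta_mx ord0 i : 'rV[R]_N) psi x) _ At.
    move=> x; rewrite /A mulrC; congr (_ * _).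
    by rewrite (derive_slice (fun w => k (w - z)) t x) derive_translate.
  have [|-> iG] := slice B (fun x => - (Du (x, t) ord0 i * psi x)) _ Bt.
    by move=> x; rewrite /B mulrN mulrC.
  congr EFin; rewrite (weak _ _ tpsi).
  have := integrable_EFinZ (-1) mb iG.
  rewrite (_ : (fun x => _) = (fun x => Du (x, t) ord0 i * psi x)) => [iG'|]; last first.
    by apply/funext => x; rewrite mulN1r opprK.
  rewrite -mulN1r -RintegralZl//.
  by apply: eq_Rintegral => x _; rewrite mulN1r.
have IE : (\int[mu]_w ((A \_ Q) w)%:E = \int[mu]_w ((B \_ Q) w)%:E)%E.
  rewrite /lebesgue_st -[LHS]eA -[in RHS]eB.
  apply: ae_eq_integral => //; [exact: measurable_fubini_G iA|exact: measurable_fubini_G iB|].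
  by apply: filterS key => t kt _; exact: kt.
transitivity (convolve Q k (fun w => - Du w ord0 i) z).
  rewrite /convolve /Rintegral integral_mkcond [in RHS]integral_mkcond !restrict_EFin.
  by congr fine.
rewrite /convolve -mulN1r -RintegralZl//; last exact: (integrable_convolve mQ iDu z (ckernel_mollifier N h)).
by apply: eq_Rintegral => w _; rewrite mulN1r mulrN.
Qed.

End mollified_gradient.

(** * Testing the difference of a subsolution and a supersolution *)

Section tested_difference.
Context {R : realType} (N : nat) (p : R).
Hypothesis p_gt1 : 1 < p.
Local Notation Z := ('rV[R]_N * R)%type.
Local Notation T := ('rV[R]_N * measurableTypeR R)%type.
Local Notation mu := (@lebesgue_st R N).
Local Notation time_dir := ((0 : 'rV[R]_N), (1 : R)).
Implicit Types (z w : Z).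
Variables (U : set Z) (phi : Z -> R).
Hypothesis C2 : Ck 2 U phi.
Variables (B C : set Z).
Hypotheses (oB : open B) (bB : bounded_set B) (BU : B `<=` U) (cC : closed C) (CB : C `<=` B).
Variables (i0 : 'I_N) (x0 : 'rV[R]_N) (f : 'rV[R]_N -> R) (eps m : R).
Hypotheses (f_cont : continuous f)
  (grad_neq0 : forall z, B z -> z.1 <> x0 -> grad phi z != 0)
  (subsol : forall z, B z -> z.1 <> x0 -> dt phi z - p_laplace p phi z - f (grad phi z) <= - eps).
Variables (v dv s : Z -> R) (w V dV : 'I_N -> Z -> R).
Hypotheses (v_derive : forall z i, B z -> is_derive z (space_dir i) v (w i z))
  (v_derive_t : forall z, B z -> is_derive z time_dir v (dv z))
  (V_derive : forall z i, B z -> is_derive z (space_dir i) (V i) (dV i z))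
  (v_cont : continuous v) (w_cont : forall i, continuous (w i)) (dv_cont : continuous dv)
  (V_cont : forall i, continuous (V i)) (dV_cont : forall i, continuous (dV i)) (s_cont : continuous s)
  (supersol : forall z, B z -> 0 <= dv z - \sum_i dV i z - s z)
  (v_big : forall z, B z -> ~ C z -> phi z + m <= v z).

Let g z := posp (phi z + m - v z).
Let a i z := flux p (grad phi z) ord0 i.
Let eta z := g z ^+ 2.
Let deta i z := 2 * g z * ('D_(space_dir i) phi z - w i z).

Let g0 z : B z -> ~ C z -> g z = 0.
Proof. by move=> Bz nCz; rewrite /g posp_le0// subr_le0 v_big. Qed.

Let g_cont z : B z -> {for z, continuous g}.
Proof.
move=> Bz; apply: (@continuous_comp _ _ _ (fun z => phi z + m - v z) posp); last exact: continuous_posp.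
apply: cvgB; last exact: v_cont.
apply: cvgD; [|exact: cvg_cst].
exact (C2_continuous C2 (BU Bz)).
Qed.

Let g_derive n z u d : B z -> is_derive z u v d ->
  is_derive z u (fun z => g z ^+ n.+2) (n.+2%:R * g z ^+ n.+1 * ('D_u phi z - d)).
Proof.
move=> Bz dv'; apply: (@is_derive_chain _ _ (fun z => phi z + m - v z) (fun y => posp y ^+ n.+2)).
  exact: is_derive_posp.
have dm := is_derive_cst m z u.
have := is_deriveB (is_deriveD (C2_derive C2 u (BU Bz)) dm) dv'.
by rewrite addr0.
Qed.

Let eta_cont z : B z -> {for z, continuous eta}.
Proof.
move=> Bz; rewrite (_ : eta = fun z => g z * g z); first by apply: cvgM; exact: g_cont.
by apply/funext => y; rewrite /eta expr2.
Qed.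

Let deta_cont i z : B z -> {for z, continuous (deta i)}.
Proof.
move=> Bz; apply: cvgM.
  by apply: cvgM; [exact: cvg_cst|exact: g_cont].
by apply: cvgB; [exact (C2_continuous1 C2 (BU Bz))|exact: w_cont].
Qed.

Let a_cont i z : B z -> {for z, continuous (a i)}.
Proof. by move=> Bz; exact: (continuous_flux_grad p_gt1 C2 (BU Bz)). Qed.

Let r z := dt phi z + eps - f (grad phi z).

Let r_cont z : B z -> {for z, continuous r}.
Proof.
move=> Bz; apply: cvgB.
  by apply: cvgD; [exact (C2_continuous1 C2 (BU Bz))|exact: cvg_cst].
apply: (@continuous_comp Z 'rV[R]_N R (grad phi) f z); last exact: f_cont.
exact (continuous_grad C2 (BU Bz)).
Qed.

Let mB : measurable (B : set T).
Proof. exact: open_measurable_st. Qed.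

Let eta0 z : B z -> ~ C z -> eta z = 0.
Proof. by move=> Bz nCz; rewrite /eta g0// expr0n. Qed.

Let deta0 i z : B z -> ~ C z -> deta i z = 0.
Proof. by move=> Bz nCz; rewrite /deta g0// mulr0 mul0r. Qed.

Let eta_derive z i : B z -> is_derive z (space_dir i) eta (deta i z).
Proof.
move=> Bz; refine (is_derive_eq (g_derive 0 Bz (v_derive i Bz)) _).
by rewrite expr1.
Qed.

Let G1 z := \sum_i a i z * deta i z + eta z * r z.

Let G1_le0 : \int[mu]_(z in B) G1 z <= 0.
Proof.
apply: (@subsolution_weak R N p p_gt1 U phi C2 B C oB bB BU cC CB eta deta _ _ _ _ _ i0 x0 r) => //.
- by move=> z Bz i; exact: eta_derive.
- by move=> z Bz; rewrite sqr_ge0.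
- move=> z Bz zx; have := subsol Bz zx; rewrite /r.
  by move: (dt _ _) (p_laplace _ _ _) (f _) => A L F; lra.
Qed.

Let iG1 : mu.-integrable B (EFin \o G1).
Proof.
apply: (integrable_glue oB bB cC CB).
  move=> z Bz; apply: cvgD; last by apply: cvgM; [exact: eta_cont|exact: r_cont].
  apply: continuous_sum_ord => i.
  by apply: cvgM; [exact: a_cont|exact: deta_cont].
move=> z Bz nCz; rewrite /G1 eta0// mul0r addr0 big1// => i _.
by rewrite deta0// mulr0.
Qed.

Let G2 z := eta z * (dv z - \sum_i dV i z - s z).

Let G2_ge0 : 0 <= \int[mu]_(z in B) G2 z.
Proof. by apply: Rintegral_ge0 => z Bz; rewrite mulr_ge0 ?sqr_ge0 ?supersol. Qed.

Let iG2 : mu.-integrable B (EFin \o G2).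
Proof.
apply: (integrable_glue oB bB cC CB).
  move=> z Bz; apply: cvgM; first exact: eta_cont.
  apply: cvgB; last exact: s_cont.
  apply: cvgB; first exact: dv_cont.
  by apply: continuous_sum_ord => i; exact: dV_cont.
by move=> z Bz nCz; rewrite /G2 eta0// mul0r.
Qed.

Let D i z := deta i z * V i z + eta z * dV i z.

Let iD i : mu.-integrable B (EFin \o D i).
Proof.
apply: (integrable_glue oB bB cC CB).
  move=> z Bz; apply: cvgD; apply: cvgM; [exact: deta_cont|exact: V_cont|exact: eta_cont|exact: dV_cont].
by move=> z Bz nCz; rewrite /D eta0// deta0// !mul0r addr0.
Qed.

Let D_eq0 i : \int[mu]_(z in B) D i z = 0.
Proof.
apply: (@integral_derive_eq0 R N (fun z => eta z * V i z) (D i) B C (space_dir i)) => //.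
- move=> z Bz; refine (is_derive_eq (is_deriveM (eta_derive i Bz) (V_derive i Bz)) _).
  by rewrite /D /GRing.scale /=; ring.
- by move=> z Bz; apply: cvgM; [exact: eta_cont|exact: V_cont].
- move=> z Bz; apply: cvgD; apply: cvgM; [exact: deta_cont|exact: V_cont|exact: eta_cont|exact: dV_cont].
- by move=> z Bz nCz; rewrite eta0// mul0r.
Qed.

Let Dt z := eta z * (dt phi z - dv z).

Let iDt : mu.-integrable B (EFin \o Dt).
Proof.
apply: (integrable_glue oB bB cC CB).
  move=> z Bz; apply: cvgM; first exact: eta_cont.
  by apply: cvgB; [exact (C2_continuous1 C2 (BU Bz))|exact: dv_cont].
by move=> z Bz nCz; rewrite /Dt eta0// mul0r.
Qed.

Let Dt_eq0 : \int[mu]_(z in B) Dt z = 0.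
Proof.
have : \int[mu]_(z in B) (3 * Dt z) = 0.
  apply: (@integral_derive_eq0 R N (fun z => g z ^+ 3) (fun z => 3 * Dt z) B C time_dir) => //.
  - move=> z Bz; refine (is_derive_eq (g_derive 1 Bz (v_derive_t Bz)) _).
    by rewrite /Dt -mulrA.
  - move=> z Bz; rewrite (_ : (fun z => g z ^+ 3) = fun z => g z * eta z).
      by apply: cvgM; [exact: g_cont|exact: eta_cont].
    by apply/funext => y; rewrite exprS.
  - move=> z Bz; apply: cvgM; first exact: cvg_cst.
    apply: cvgM; first exact: eta_cont.
    by apply: cvgB; [exact (C2_continuous1 C2 (BU Bz))|exact: dv_cont].
  - by move=> z Bz nCz; rewrite g0// expr0n.
rewrite RintegralZl// => /eqP; rewrite mulf_eq0 pnatr_eq0 /= => /eqP.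
by [].
Qed.

(** The integrand is G1 - G2 minus terms of integral zero: G1 is the weak form of
    the inequality of [phi] tested with g^2, G2 the inequality of [v] multiplied by
    g^2, and the remaining terms are the derivatives of g^2 V_i and g^3 / 3. *)
Theorem tested_difference :
  let F z := 2 * g z * \sum_i (flux p (grad phi z) ord0 i - V i z) * ('D_(space_dir i) phi z - w i z)
     + g z ^+ 2 * (eps - f (grad phi z) + s z) in
  mu.-integrable B (EFin \o F) /\ \int[mu]_(z in B) F z <= 0.
Proof.
move=> F.
have [iS eS] := @Rintegral_sum _ _ T mu B N D mB iD.
(* The divergence terms trade the derivatives of V and of v for those of eta. *)
have FE : F = fun z => G1 z - G2 z - (\sum_i D i z + Dt z).
  apply/funext => z; rewrite /F /G1 /G2 /Dt /D /r big_split /= -mulr_sumr.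
  have -> : 2 * g z * \sum_i (flux p (grad phi z) ord0 i - V i z) * ('D_(space_dir i) phi z - w i z) =
    \sum_i a i z * deta i z - \sum_i deta i z * V i z.
    rewrite -sumrB mulr_sumr; apply: eq_bigr => i _.
    by rewrite /a /deta; ring.
  by rewrite -/(eta z); ring.
have i1 : mu.-integrable B (EFin \o (fun z => G1 z - G2 z)) by exact: integrable_EFinB.
have i2 : mu.-integrable B (EFin \o (fun z => \sum_i D i z + Dt z)) by exact: integrable_EFinD.
split; first by rewrite FE; exact: integrable_EFinB.
have D0 : \int[mu]_(z in B) (\sum_i D i z + Dt z) = 0.
  rewrite RintegralD// Dt_eq0 addr0.
  by apply: etrans eS _; apply: big1 => i _; exact: D_eq0.
rewrite FE RintegralB// D0 subr0 RintegralB//.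
by rewrite subr_le0 (le_trans G1_le0).
Qed.

End tested_difference.

(** * Passing to the limit *)

Section fatou_below.
Context {R : realType} d (X : measurableType d) (m : {measure set X -> \bar R}).

Lemma measurable_limn_einf (B : set X) (f : (X -> \bar R)^nat) :
  (forall n, measurable_fun B (f n)) -> measurable_fun B (fun x => limn_einf (f^~ x)).
Proof.
move=> mf; rewrite (_ : (fun x => _) = (fun x => - limn_esup ((fun n x => - f n x) ^~ x))%E).
  apply: measurableT_comp => //; apply: measurable_fun_limn_esup => n.
  by apply: measurableT_comp => //; exact: mf.
by apply/funext => x; rewrite -limn_einfN; congr limn_einf; apply/funext => n /=; rewrite oppeK.
Qed.

Lemma limn_einf_le_lim (u v : (\bar R)^nat) (l : \bar R) : (forall n, (u n <= v n)%E) ->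
  v n @[n --> \oo] --> l -> (limn_einf u <= l)%E.
Proof.
move=> uv vl; rewrite limn_einf_lim -(cvg_lim (@ereal_hausdorff R) vl).
apply: lee_lim; [exact: is_cvg_einfs|by apply/cvg_ex; exists l|].
apply: nearW => n; apply: le_trans (uv n); apply: ereal_inf_lbound.
by exists n => //=.
Qed.

Lemma limn_einf_ge0 (u : (\bar R)^nat) : (forall n, (0 <= u n)%E) -> (0 <= limn_einf u)%E.
Proof.
move=> u0; rewrite limn_einf_lim; apply: lime_ge; first exact: is_cvg_einfs.
by apply: nearW => n; apply: le_ereal_inf_tmp => _ [k _ <-].
Qed.

(** Fatou applied to the nonnegative functions F_ n + K E_ n: in the limit the
    integral of P + K e is at most K times the integral of [e]. *)
Lemma fatou_bounded_below (B : set X) (F_ E_ : nat -> X -> R) (e P : X -> R) (K : R) :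
  measurable B -> 0 <= K ->
  (forall n, m.-integrable B (EFin \o F_ n)) -> (forall n, m.-integrable B (EFin \o E_ n)) ->
  m.-integrable B (EFin \o e) -> measurable_fun B P ->
  (forall x, B x -> 0 <= P x) -> (forall x, B x -> 0 <= e x) ->
  (forall n x, B x -> - (K * E_ n x) <= F_ n x) ->
  (forall n, \int[m]_(x in B) F_ n x <= 0) ->
  (forall n, \int[m]_(x in B) `|E_ n x - e x|%:E <= (1 / (2 ^ n.+1)%:R)%:E)%E ->
  {ae m, forall x, B x -> E_ n x @[n --> \oo] --> e x} ->
  {ae m, forall x, B x -> exists2 l, F_ n x @[n --> \oo] --> l & P x <= l} ->
  {ae m, forall x, B x -> P x = 0}.
Proof.
move=> mB K0 iF iE ie mP P0 e0 FE F0 Ee Eae Fae.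
have iH n : m.-integrable B (EFin \o (fun x => F_ n x + K * E_ n x)).
  by apply: integrable_EFinD => //; exact: integrable_EFinZ.
have H0 n x : B x -> (0 <= (F_ n x + K * E_ n x)%:E)%E.
  by move=> Bx; rewrite lee_fin -(addNr (K * E_ n x)) lerD2r FE.
have mH n : measurable_fun B (fun x => (F_ n x + K * E_ n x)%:E).
  by case/integrableP: (iH n).
have fat := fatou m mB mH H0.
set I := \int[m]_(x in B) e x.
have IE n : (\int[m]_(x in B) (F_ n x + K * E_ n x)%:E <= (K * (I + 1 / (2 ^ n.+1)%:R))%:E)%E.
  rewrite -[leLHS]fineK; last exact: (integrable_fin_num mB (iH n)).
  rewrite lee_fin -/(Rintegral m B (fun x => F_ n x + K * E_ n x)).
  rewrite RintegralD//; last exact: integrable_EFinZ.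
  rewrite RintegralZl// (le_trans (_ : _ <= K * \int[m]_(x in B) E_ n x)) ?gerDr//.
  rewrite ler_wpM2l// -lerBlDl /I -RintegralB//.
  have iD : m.-integrable B (EFin \o (fun x => E_ n x - e x)) by exact: integrable_EFinB.
  rewrite (le_trans (ler_norm _))// (le_trans (le_normr_Rintegral mB iD))//.
  rewrite -lee_fin fineK ?Ee//.
  exact: (integrable_fin_num mB (integrable_norm iD)).
have lim : (limn_einf (fun n => \int[m]_(x in B) (F_ n x + K * E_ n x)%:E) <= (K * I)%:E)%E.
  apply: limn_einf_le_lim IE _; apply/cvg_EFin; first exact: nearW.
  rewrite -[X in _ --> K * X]addr0; apply: cvgM; first exact: cvg_cst.
  apply: cvgD; first exact: cvg_cst.
  have h : `|2^-1 : R| < 1 by rewrite gtr0_norm ?invr_gt0// invf_lt1 ?ltr1n.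
  have := @cvg_geometric R 2^-1 2^-1 h.
  rewrite (_ : geometric _ _ = fun n => 1 / (2 ^ n.+1)%:R)//.
  by apply/funext => n; rewrite /geometric/= natrX exprS div1r invfM exprVn.
have mPe : measurable_fun B (fun x => (P x + K * e x)%:E).
  apply/measurable_EFinP; apply: measurable_funD => //; apply: measurable_funM => //.
  by apply/measurable_EFinP; case/integrableP: ie.
have PeI : (\int[m]_(x in B) (P x + K * e x)%:E <= (K * I)%:E)%E.
  apply: le_trans lim; apply: le_trans fat; apply: ae_ge0_le_integral => //.
  - by move=> x Bx; rewrite lee_fin addr_ge0 ?P0// mulr_ge0 ?e0.
  - by move=> x Bx; apply: limn_einf_ge0 => n; exact: H0.
  - exact: measurable_limn_einf.
  - apply: filterS2 Eae Fae => x Ex Fx Bx.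
    have [l Fl Pl] := Fx Bx; have El := Ex Bx.
    have L : (F_ n x + K * E_ n x)%:E @[n --> \oo] --> (l + K * e x)%:E.
      apply/cvg_EFin; first by near=> n.
      by apply: cvgD => //; apply: cvgM => //; exact: cvg_cst.
    by rewrite (cvg_limn_einf_sup L).1 lee_fin lerD2r.
have mPE : measurable_fun B (EFin \o P) by exact/measurable_EFinP.
suff I0 : (\int[m]_(x in B) `|(EFin \o P) x| = 0)%E.
  have /(ae_eq_integral_abs m mB mPE) := I0; apply: filterS => x Px Bx.
  by have [] := Px Bx.
rewrite (eq_integral (EFin \o P)) => [|x]; last first.
  by rewrite inE => Bx; rewrite gee0_abs// lee_fin P0.
apply/eqP; rewrite eq_le integral_ge0 ?andbT => [|x Bx]; last by rewrite lee_fin P0.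
move: PeI; under eq_integral do rewrite EFinD.
have iKe : m.-integrable B (EFin \o (fun x => K * e x)) by exact: integrable_EFinZ.
rewrite ge0_integralD//; last first.
- by case/integrableP: iKe.
- by move=> x Bx; rewrite lee_fin mulr_ge0 ?e0.
have -> : (\int[m]_(x in B) (K * e x)%:E = (K * I)%:E)%E.
  rewrite /I -RintegralZl// /Rintegral fineK//.
  exact: (integrable_fin_num mB iKe).
by rewrite -leeBrDr// -EFinB subrr.
Unshelve. all: by end_near.
Qed.

End fatou_below.

(** * Pointwise bounds for mollifications *)

Section mollified_bounds.
Context {R : realType} (N : nat).
Local Notation Z := ('rV[R]_N * R)%type.
Local Notation T := ('rV[R]_N * measurableTypeR R)%type.
Local Notation mu := (@lebesgue_st R N).
Implicit Types (z w : Z) (g : Z -> R).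
Variables (Q : set Z) (h : R) (z : Z).
Hypotheses (mQ : measurable (Q : set T)) (bQ : bounded_set Q) (h0 : 0 < h)
  (hQ : forall w, `|w - z| <= h -> Q w).
Local Notation avg g := (convolve Q (mollifier h) g z).

Lemma integrable_cst c : mu.-integrable Q (EFin \o (cst c : Z -> R)).
Proof.
apply: (@integrable_continuous_bounded R N Q (cst c) `|c|) => //.
exact: cst_continuous.
Qed.

Lemma convolveZ c g : mu.-integrable Q (EFin \o g) -> (avg (fun w => c * g w)) = c * avg g.
Proof.
move=> ig; rewrite /convolve -RintegralZl//; last exact: integrable_mollified.
by apply: eq_Rintegral => w _; rewrite mulrCA.
Qed.

Lemma convolve_ge c g : mu.-integrable Q (EFin \o g) ->
  (forall w, `|w - z| <= h -> c <= g w) -> c <= avg g.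
Proof.
move=> ig cg; rewrite -subr_ge0 -{1}(convolve_cst c h0 mQ hQ) -convolveB//; last exact: integrable_cst.
apply: Rintegral_ge0 => w Qw; have [wz|wz] := leP `|w - z| h.
  by rewrite mulr_ge0 ?mollifier_ge0 ?subr_ge0 ?cg.
by rewrite (proj2 (ckernel_mollifier N h))// mul0r.
Qed.

Lemma convolve_norm_le c g : mu.-integrable Q (EFin \o g) ->
  (forall w, Q w -> `|g w| <= c) -> `|avg g| <= c.
Proof.
move=> ig gc; rewrite -(convolve_cst c h0 mQ hQ); apply: convolve_le => //.
  exact: integrable_cst.
by move=> w Qw _; exact: gc.
Qed.

Lemma convolve_norm_leZ c g e : mu.-integrable Q (EFin \o g) -> mu.-integrable Q (EFin \o e) ->
  (forall w, Q w -> `|g w| <= c * e w) -> `|avg g| <= c * avg e.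
Proof.
move=> ig ie ge; rewrite -convolveZ//; apply: convolve_le => //.
  exact: integrable_EFinZ.
by move=> w Qw _; exact: ge.
Qed.

(** The bound on products of values at two different points is averaged in one
    variable with the other frozen, and then in the other. *)
Lemma convolve_product_le g1 g2 e :
  mu.-integrable Q (EFin \o g1) -> mu.-integrable Q (EFin \o g2) ->
  mu.-integrable Q (EFin \o e) ->
  (forall w w', Q w -> Q w' -> `|g1 w * g2 w'| <= e w + e w') ->
  `|avg g1 * avg g2| <= 2 * avg e.
Proof.
move=> i1 i2 ie H.
have ic c : mu.-integrable Q (EFin \o (fun w => e w + c)).
  by apply: integrable_EFinD => //; exact: integrable_cst.
have eD c : (avg (fun w => e w + c)) = avg e + c.
  rewrite (convolveD _ (g := cst c))//; last exact: integrable_cst.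
  by rewrite convolve_cst.
(* The first average, with the second variable frozen. *)
have step w' : Q w' -> `|avg g1 * g2 w'| <= e w' + avg e.
  move=> Qw'; rewrite mulrC -convolveZ// addrC -eD; apply: convolve_le => //.
    exact: integrable_EFinZ.
  by move=> w Qw _; rewrite mulrC; exact: H.
rewrite -convolveZ// mulr2n mulrDl mul1r -eD.
apply: convolve_le => //; first exact: integrable_EFinZ.
by move=> w Qw _; exact: step.
Qed.

End mollified_bounds.

Section compact_sets.
Context {R : realType} (N : nat).
Local Notation Z := ('rV[R]_N * R)%type.
Implicit Types (z w a : Z).

Lemma compact_norm_sub_le a (h : R) : compact [set w : Z | `|w - a| <= h].
Proof.
apply: compact_bounded_closed_prod; last exact: closed_norm_sub_le.
exists (h + `|a|); split; first exact: num_real.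
move=> y hy x /= xh; rewrite (le_trans _ (ltW hy))// -(subrK a x).
by rewrite (le_trans (ler_normD _ _))// lerD2r.
Qed.

Lemma compact_bounded_on (K : set Z) (k : Z -> R) : compact K ->
  (forall z, K z -> {for z, continuous k}) -> exists M, forall z, K z -> `|k z| <= M.
Proof.
move=> cK ck.
have wk : {within K, continuous k} by apply: continuous_in_subspaceT => z; rewrite inE; exact: ck.
have [M [Mr hM]] := compact_bounded (continuous_compact wk cK).
exists (M + 1) => z Kz; apply: (hM (M + 1)); first by rewrite ltrDl.
by exists z.
Qed.

End compact_sets.

(** Either factor is at most the larger of [s] and [t]. *)
Lemma powR_mul_le {R : realType} (p s t : R) : 1 < p -> 0 <= s -> 0 <= t ->
  s `^ (p - 1) * t <= s `^ p + t `^ p.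
Proof.
move=> p1 s0 t0; have p0 : 0 < p by rewrite (lt_trans _ p1).
have q0 : 0 <= p - 1 by rewrite subr_ge0 ltW.
have [st|/ltW st] := leP t s.
  rewrite -(mulr_powRB1 s0 p0) [s * _]mulrC (le_trans (_ : _ <= s `^ (p - 1) * s))//.
    by rewrite ler_wpM2l ?powR_ge0.
  by rewrite lerDl powR_ge0.
rewrite -(mulr_powRB1 t0 p0) [t * _]mulrC (le_trans (_ : _ <= t `^ (p - 1) * t))//.
  by rewrite ler_wpM2r// ge0_ler_powR// nnegrE.
by rewrite lerDr powR_ge0.
Qed.

(** * Local comparison *)

Section comparison.
Context {R : realType} (N : nat) (p : R).
Hypothesis p_gt1 : 1 < p.
Local Notation Z := ('rV[R]_N * R)%type.
Local Notation T := ('rV[R]_N * measurableTypeR R)%type.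
Local Notation mu := (@lebesgue_st R N).
Implicit Types (z w : Z).
Variables (Xi : set Z) (phi u : Z -> R) (Du : Z -> 'rV[R]_N) (f : 'rV[R]_N -> R).
Hypotheses (oXi : open Xi) (C2 : Ck 2 Xi phi) (f_cont : continuous f).
Variables (i0 : 'I_N) (x0 : 'rV[R]_N) (t0 r : R).
Hypothesis r0 : 0 < r.
Let z0 : Z := (x0, t0).
Let Q : set Z := ball z0 r.
Hypothesis QXi : Q `<=` Xi.
Variables (K c : R).
Hypotheses (mu_u : measurable_fun (Q : set T) u) (uK : forall z, Q z -> `|u z| <= K)
  (iDu : forall i, mu.-integrable Q (EFin \o (fun z => Du z ord0 i)))
  (iflux : forall i, mu.-integrable Q (EFin \o (fun z => flux p (Du z) ord0 i)))
  (ifD : mu.-integrable Q (EFin \o (f \o Du)))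
  (ie : mu.-integrable Q (EFin \o energy p Du))
  (fD_le : forall z, `|f (Du z)| <= c * energy p Du z)
  (slices : {ae (@lebesgue_measure R), forall t, t0 - r < t < t0 + r ->
    sobolev p (ball x0 r) (fun x => u (x, t)) (fun x => Du (x, t))})
  (weak : forall psi, test_function Q psi -> (forall w, 0 <= psi w) ->
    (0 <= \int[mu]_(w in Xi)
      (- u w * dt psi w + enorm (Du w) `^ (p - 2) * edot (Du w) (grad psi w)
       - psi w * f (Du w))%:E)%E).
Variables (eps m M : R).
Hypotheses (eps0 : 0 < eps) (m0 : 0 < m)
  (grad_neq0 : forall z, Q z -> z.1 <> x0 -> grad phi z != 0)
  (subsol : forall z, Q z -> z.1 <> x0 -> dt phi z - p_laplace p phi z - f (grad phi z) <= - eps)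
  (phi_le_u : forall z, Q z -> phi z <= u z)
  (shell : forall z, r / 8 <= `|z - z0| <= r * (3 / 4) -> phi z + 2 * m <= u z)
  (gradM : forall z, Q z -> enorm (grad phi z) <= M)
  (react : forall (v1 v2 : 'rV[R]_N) g, enorm v1 <= M -> 0 <= g <= m ->
    g * (eps / 2) <= 2 * edot (flux p v1 - flux p v2) (v1 - v2) + g * (eps - f v1 + f v2)).

Let B : set Z := ball z0 (r / 2).
Let C : set Z := [set w | `|w - z0| <= r / 4].

Let mQ : measurable (Q : set T). Proof. exact: measurable_ball_st. Qed.
Let mB : measurable (B : set T). Proof. exact: measurable_ball_st. Qed.

Let BE z : B z = (`|z - z0| < r / 2) :> Prop.
Proof. by rewrite /B -ball_normE /= distrC. Qed.

Let QE z : Q z = (`|z - z0| < r) :> Prop.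
Proof. by rewrite /Q -ball_normE /= distrC. Qed.

Let bounded_ball e : bounded_set (ball z0 e).
Proof.
exists (`|z0| + `|e|); split; first exact: num_real.
move=> y hy z; rewrite -ball_normE /= distrC => ze.
rewrite (le_trans _ (ltW hy))// -(subrK z0 z) addrC (le_trans (ler_normD _ _))// lerD2l.
by rewrite ltW// (lt_le_trans ze)// ler_norm.
Qed.

Let bQ : bounded_set Q. Proof. exact: bounded_ball. Qed.

Let oB : open B. Proof. by apply: ball_open; rewrite divr_gt0. Qed.

Let BQ : B `<=` Q.
Proof.
by move=> z; rewrite BE QE => zr; rewrite (lt_trans zr)// ltr_pdivrMr// ltr_pMr// ltr1n.
Qed.

Let BXi : B `<=` Xi. Proof. by move=> z /BQ /QXi. Qed.

Let CB : C `<=` B.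
Proof. by move=> z; rewrite BE => /le_lt_trans; apply; move: r0; lra. Qed.

Let cC : closed C. Proof. exact: closed_norm_sub_le. Qed.

Let iu : mu.-integrable Q (EFin \o u).
Proof.
apply: measurable_bounded_integrable => //; first exact: lebesgue_st_bounded.
by exists K; split => [|y Ky z Qz]; [exact: num_real|exact: le_trans (uK Qz) (ltW Ky)].
Qed.

Let scale : exists2 h1, 0 < h1 <= r / 8 & forall z w, B z -> `|w - z| <= h1 -> `|phi z - phi w| <= m.
Proof.
have cK := @compact_norm_sub_le R N z0 (r / 2).
have ck z : [set w | `|w - z0| <= r / 2] z -> {for z, continuous phi}.
  move=> /= zr; apply: (C2_continuous C2); apply: QXi; rewrite QE.
  by rewrite (le_lt_trans zr)//; move: r0; lra.
have [d d0 hd] := compact_unif cK ck m0.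
exists (Num.min (r / 8) (d / 2)).
  by rewrite lt_min ge_min lexx !divr_gt0.
move=> z w; rewrite BE => zB; rewrite le_min => /andP[_ wz].
apply/ltW/hd; first exact: ltW.
by rewrite distrC (le_lt_trans wz)//; move: d0; lra.
Qed.

Section fixed_scale.
Variable h : R.
Hypotheses (h0 : 0 < h) (hr : h <= r / 8)
  (h_unif : forall z w, B z -> `|w - z| <= h -> `|phi z - phi w| <= m).
Local Notation avg g := (convolve Q (mollifier h) g).

Let near_Q z : B z -> forall w, `|w - z| <= h -> Q w.
Proof.
rewrite BE => zr w wz; rewrite QE -(subrK z w) -addrA (le_lt_trans (ler_normD _ _))//.
by move: r0 hr wz zr; lra.
Qed.

Let avg_continuous g : mu.-integrable Q (EFin \o g) -> continuous (avg g).
Proof. by move=> ig; exact: (convolve_continuous mQ ig (ckernel_mollifier N h)). Qed.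

Let avg_derive g z v : mu.-integrable Q (EFin \o g) ->
  is_derive z v (avg g) (- convolve Q ('D_v (mollifier h)) g z).
Proof.
move=> ig; apply: (convolve_derive mQ ig z _ (ckernel_mollifier N h) (@ckernel_dmollifier R N h v)).
move=> y; have := @Ck_mollifier R N h 0 1.
rewrite (_ : (fun w => _) = mollifier h); last by apply/funext => w; rewrite subr0.
by move=> [hd _]; apply/derivableP/diff_derivable; exact: hd.
Qed.

Let davg_continuous g v : mu.-integrable Q (EFin \o g) ->
  continuous (fun z => - convolve Q ('D_v (mollifier h)) g z).
Proof.
move=> ig z; apply: cvgN.
exact: (convolve_continuous mQ ig (@ckernel_dmollifier R N h v)).
Qed.

(** The integrand of [tested_difference] for the mollified supersolution. *)
Definition defect z := let g := posp (phi z + m - avg u z) in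
  2 * g * \sum_i (flux p (grad phi z) ord0 i - avg (fun w => flux p (Du w) ord0 i) z)
    * ('D_(space_dir i) phi z - avg (fun w => Du w ord0 i) z)
  + g ^+ 2 * (eps - f (grad phi z) + avg (f \o Du) z).

(** The mollification exceeds phi + m outside of [C] because [u] exceeds phi + 2 m on
    the shell and [phi] oscillates by at most [m] at the scale [h]. *)
Lemma integral_defect_le0 : mu.-integrable B (EFin \o defect) /\ \int[mu]_(z in B) defect z <= 0.
Proof.
apply: (@tested_difference R N p p_gt1 Xi phi C2 B C oB (@bounded_ball _) BXi cC CB i0 x0 f eps m f_cont
  _ _ (avg u) (fun z => - convolve Q ('D_((0 : 'rV[R]_N), (1 : R)) (mollifier h)) u z) (avg (f \o Du))
  (fun i => avg (fun w => Du w ord0 i)) (fun i => avg (fun w => flux p (Du w) ord0 i))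
  (fun i z => - convolve Q ('D_(space_dir i) (mollifier h)) (fun w => flux p (Du w) ord0 i) z)).
- by move=> z /BQ; exact: grad_neq0.
- by move=> z /BQ; exact: subsol.
- move=> z i Bz; rewrite -[X in is_derive _ _ _ X]opprK.
  rewrite -(mollified_gradient h0 (near_Q Bz) iu (iDu i) slices).
  exact: avg_derive.
- by move=> z Bz; exact: avg_derive.
- by move=> z i Bz; exact: avg_derive.
- exact: avg_continuous.
- by move=> i; exact: avg_continuous.
- exact: davg_continuous.
- by move=> i; exact: avg_continuous.
- by move=> i; exact: davg_continuous.
- exact: avg_continuous.
- move=> z Bz; have := mollified_supersolution mQ h0 (near_Q Bz) (open_measurable_st oXi) QXi iu iflux ifD weak.
  by rewrite sumrN opprK.
- move=> z Bz nCz; apply: (convolve_ge mQ bQ h0 (near_Q Bz) iu) => w wz.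
  have zr : r / 4 < `|z - z0| by rewrite ltNge; apply/negP.
  have zw : `|z - z0| <= `|w - z| + `|w - z0|.
    by rewrite -{1}(subrK w z) -addrA (le_trans (ler_normD _ _))// distrC.
  have wz0 : `|w - z0| <= `|w - z| + `|z - z0|.
    by rewrite -{1}(subrK z w) -addrA (le_trans (ler_normD _ _)).
  have hw : r / 8 <= `|w - z0| <= r * (3 / 4).
    have zB : `|z - z0| < r / 2 by rewrite -BE.
    by apply/andP; split; move: r0 hr; lra.
  have := shell hw; have := h_unif Bz wz; rewrite ler_norml => /andP[_].
  by lra.
Qed.

Let avg_energy_ge1 z : B z -> 1 <= avg (energy p Du) z.
Proof.
move=> Bz; apply: (convolve_ge mQ bQ h0 (near_Q Bz) ie) => w _.
by rewrite /energy lerDl powR_ge0.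
Qed.

Let avg_flux_le z i : B z -> `|avg (fun w => flux p (Du w) ord0 i) z| <= avg (energy p Du) z.
Proof.
move=> Bz; rewrite -[leRHS]mul1r; apply: convolve_norm_leZ => // w _; rewrite mul1r.
rewrite (le_trans (le_flux_coord _ _ _))//; apply: powR_le1D; first exact: enorm_ge0.
by rewrite subr_ge0 (ltW p_gt1)/= gerBl ler01.
Qed.

Let avg_Du_le z i : B z -> `|avg (fun w => Du w ord0 i) z| <= avg (energy p Du) z.
Proof.
move=> Bz; rewrite -[leRHS]mul1r; apply: convolve_norm_leZ => // w _; rewrite mul1r.
rewrite (le_trans (le_coord_enorm _ _))//; apply: le_1D_powR => //; exact: enorm_ge0.
Qed.

Let avg_product_le z i : B z ->
  `|avg (fun w => flux p (Du w) ord0 i) z * avg (fun w => Du w ord0 i) z| <= 2 * avg (energy p Du) z.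
Proof.
move=> Bz; apply: (convolve_product_le mQ bQ h0 (near_Q Bz)) => // w w' _ _.
rewrite normrM (@le_trans _ _ (enorm (Du w) `^ (p - 1) * enorm (Du w')))//.
  by apply: ler_pM => //; [exact: le_flux_coord|exact: le_coord_enorm].
rewrite (le_trans (powR_mul_le p_gt1 (enorm_ge0 _) (enorm_ge0 _)))//.
by rewrite lerD// /energy lerDr.
Qed.

(** The constant does not depend on [h]. The only product of two unbounded factors
    is that of the mollified flux and the mollified gradient. *)
Lemma defect_ge (A : R) z : B z ->
  (forall i, `|flux p (grad phi z) ord0 i| <= A) -> (forall i, `|'D_(space_dir i) phi z| <= A) ->
  `|f (grad phi z)| <= A ->
  - ((2 * (2 * K + m) * (N%:R * (A ^+ 2 + 2 * A + 2)) + (2 * K + m) ^+ 2 * (A + c)) * avg (energy p Du) z)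
    <= defect z.
Proof.
move=> Bz aA dA fA; rewrite /defect.
set E := avg (energy p Du) z; set g := posp _.
have E1 : 1 <= E by exact: avg_energy_ge1.
have A0 : 0 <= A by rewrite (le_trans _ fA).
have Qz := BQ Bz.
have uh : `|avg u z| <= K by exact: (convolve_norm_le mQ bQ h0 (near_Q Bz)).
have [g0 gG] : 0 <= g /\ g <= 2 * K + m.
  split; first exact: posp_ge0.
  have K0 : 0 <= K by rewrite (le_trans _ uh).
  have := phi_le_u Qz; have := uK Qz; move: uh; rewrite !ler_norml => /andP[nu _] /andP[_ uz] pu.
  by rewrite ge_max; apply/andP; split; move: m0 nu K0 uz pu; lra.
have S i : - ((A ^+ 2 + 2 * A + 2) * E) <=
   (flux p (grad phi z) ord0 i - avg (fun w => flux p (Du w) ord0 i) z) *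
   ('D_(space_dir i) phi z - avg (fun w => Du w ord0 i) z).
  have := avg_flux_le i Bz; have := avg_Du_le i Bz; have := avg_product_le i Bz; rewrite -/E.
  move: (aA i) (dA i); move: (flux p _ _ _) ('D_ _ _ _) (avg _ _) (avg _ _) => a b w V ha hb hVw hw hV.
  have h1 : `|a * b| <= A * A by rewrite normrM ler_pM.
  have h2 : `|a * w| <= A * E by rewrite normrM ler_pM.
  have h3 : `|V * b| <= E * A by rewrite normrM ler_pM.
  have h4 : A * A <= A ^+ 2 * E by rewrite expr2 ler_peMr// mulr_ge0.
  move: h1 h2 h3 hVw; rewrite !ler_norml => /andP[h1 _] /andP[_ h2] /andP[_ h3] /andP[h5 _].
  by rewrite mulrBl !mulrBr !mulrDl; lra.
have SS : - (N%:R * ((A ^+ 2 + 2 * A + 2) * E)) <= \sum_i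
   (flux p (grad phi z) ord0 i - avg (fun w => flux p (Du w) ord0 i) z) *
   ('D_(space_dir i) phi z - avg (fun w => Du w ord0 i) z).
  have <- : \sum_(i < N) - ((A ^+ 2 + 2 * A + 2) * E) = - (N%:R * ((A ^+ 2 + 2 * A + 2) * E)).
    by move: ((A ^+ 2 + _ + _) * E) => X; rewrite sumr_const card_ord mulNrn mulr_natl.
  by apply: ler_sum => i _; exact: S.
have fh : `|avg (f \o Du) z| <= c * E by apply: convolve_norm_leZ => // w _; exact: fD_le.
move: SS; set SU := \sum_i _ => SS.
have T1 : - (2 * (2 * K + m) * (N%:R * (A ^+ 2 + 2 * A + 2)) * E) <= 2 * g * SU.
  have W0 : 0 <= N%:R * (A ^+ 2 + 2 * A + 2) * E.
    by rewrite !mulr_ge0 ?ler0n// ?(le_trans _ E1)// !addr_ge0// ?exprn_ge0// mulr_ge0.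
  apply: (@le_trans _ _ (2 * g * - (N%:R * (A ^+ 2 + 2 * A + 2) * E))).
    by rewrite mulrN lerN2 -[leRHS]mulrA ler_wpM2r// ler_wpM2l.
  by rewrite ler_wpM2l ?mulr_ge0// -[_ * E]mulrA.
have T2 : - ((2 * K + m) ^+ 2 * (A + c) * E) <= g ^+ 2 * (eps - f (grad phi z) + avg (f \o Du) z).
  have Y0 : 0 <= (A + c) * E.
    rewrite mulrDl addr_ge0 ?(le_trans _ fh)//.
    by rewrite mulr_ge0// (le_trans _ E1).
  apply: (@le_trans _ _ (g ^+ 2 * - ((A + c) * E))).
    by rewrite mulrN lerN2 -mulrA ler_wpM2r// lerXn2r// nnegrE (le_trans g0).
  rewrite ler_wpM2l ?exprn_ge0// mulrDl.
  have AE : A <= A * E by rewrite ler_peMr.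
  move: fA fh; rewrite !ler_norml => /andP[_ h1] /andP[h2 _].
  by move: eps0 h1 h2 AE; move: (f _) (avg _ _) (c * E) (A * E) => *; lra.
by rewrite mulrDl opprD lerD.
Qed.

End fixed_scale.

Let grad_bounds : exists A, forall z, B z ->
  [/\ forall i, `|flux p (grad phi z) ord0 i| <= A, forall i, `|'D_(space_dir i) phi z| <= A &
      `|f (grad phi z)| <= A].
Proof.
have cK := @compact_norm_sub_le R N z0 (r / 2).
have ck z : [set w | `|w - z0| <= r / 2] z -> {for z, continuous (f \o grad phi)}.
  move=> /= zr; apply: (@continuous_comp Z 'rV[R]_N R (grad phi) f z); last exact: f_cont.
  apply: (continuous_grad C2); apply: QXi; rewrite QE.
  by rewrite (le_lt_trans zr)//; move: r0; lra.
have [Mf hMf] := compact_bounded_on cK ck.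
have M0 : 0 <= M.
  by apply: le_trans (gradM (_ : Q z0)); [exact: enorm_ge0|exact: ballxx].
have Mf0 : 0 <= Mf.
  by apply: le_trans (hMf z0 _); [exact: normr_ge0|rewrite /= subrr normr0 divr_ge0// ltW].
exists (M `^ (p - 1) + M + Mf) => z Bz; have Qz := BQ Bz; split.
- move=> i; rewrite (le_trans (le_flux_coord _ _ _))// -addrA (@le_trans _ _ (M `^ (p - 1)))//.
    by apply: ge0_ler_powR; rewrite ?nnegrE ?enorm_ge0 ?gradM// subr_ge0 ltW.
  by rewrite lerDl addr_ge0.
- move=> i; rewrite -grad_coord (le_trans (le_coord_enorm _ _))// (le_trans (gradM Qz))//.
  by rewrite addrAC lerDr addr_ge0// powR_ge0.
- rewrite (le_trans (hMf z _)) ?lerDr ?addr_ge0 ?powR_ge0//=.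
  by move: Bz; rewrite BE => /ltW.
Qed.

(** Let the scale tend to 0 in [integral_defect_le0]; [react] bounds the limit of
    the integrand from below by (eps / 2) ((phi + m - u)^+)^2. *)
Theorem comparison : {ae mu, forall z, B z -> phi z + m <= u z}.
Proof.
have FF : Filter (almost_everywhere mu) := ae_filter_ringOfSetsType mu.
have [h1 /andP[h10 h1r] hu] := scale.
(* All the functions that are mollified, so that one sequence of scales serves for
   all of them. *)
pose G (j : 'I_N + 'I_N + bool + unit) z := match j with
  | inl (inl (inl i)) => Du z ord0 i
  | inl (inl (inr i)) => flux p (Du z) ord0 i
  | inl (inr b) => if b then u z else f (Du z)
  | inr tt => energy p Du z end.
have iG j : mu.-integrable Q (EFin \o G j).
  by case: j => [[[i|i]|[]]|[]]; [exact: iDu|exact: iflux|exact: iu|exact: ifD|exact: ie].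
have BQh z : B z -> forall w, `|w - z| <= h1 -> Q w.
  rewrite BE => zr w wz; rewrite QE -(subrK z w) -addrA (le_lt_trans (ler_normD _ _))//.
  by move: r0 h1r wz zr; lra.
have [h_ [hh _ Gae GL1]] := mollify_ae mQ bQ mB h10 BQh iG.
have [A hA] := grad_bounds.
have hn0 n : 0 < h_ n by have /andP[] := hh n.
have hnr n : h_ n <= r / 8 by have /andP[_ h2] := hh n; exact: le_trans h1r.
have hnu n z w : B z -> `|w - z| <= h_ n -> `|phi z - phi w| <= m.
  by move=> Bz wz; have /andP[_ h2] := hh n; apply: hu => //; exact: le_trans h2.
pose k := 2 * (2 * K + m) * (N%:R * (A ^+ 2 + 2 * A + 2)) + (2 * K + m) ^+ 2 * (A + c).
pose g z := posp (phi z + m - u z).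
pose P z := g z * (g z * (eps / 2)).
(* P is the lower bound that the reaction inequality provides for the limit. *)
suff : {ae mu, forall z, B z -> P z = 0}.
  apply: filterS => z Pz Bz; rewrite -subr_le0 leNgt; apply/negP => g0.
  have : 0 < P z by rewrite /P /g posp_id ?(ltW g0)// !mulr_gt0// divr_gt0.
  by rewrite Pz// ltxx.
have iE n : mu.-integrable B (EFin \o (convolve Q (mollifier (h_ n)) (energy p Du))).
  have ck := convolve_continuous mQ ie (ckernel_mollifier N (h_ n)).
  have [b hb] := compact_bounded_on (@compact_norm_sub_le R N z0 (r / 2)) (fun z _ => ck z).
  apply: measurable_bounded_integrable => //.
  - exact: lebesgue_st_bounded (@bounded_ball _).
  - by apply: measurable_funTS; exact: continuous_measurable_st.
  - exists b; split => [|y by_ z]; first exact: num_real.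
    by rewrite /= BE => zr; exact: le_trans (hb z (ltW zr)) (ltW by_).
have z0B : B z0 by exact: ballxx _ (divr_gt0 r0 _).
have K0 : 0 <= K by rewrite (le_trans _ (uK (BQ z0B))).
have A0 : 0 <= A by have [_ _] := hA _ z0B; exact: le_trans.
have c0 : 0 <= c.
  rewrite -(pmulr_lge0 (x := energy p Du z0)); last by rewrite ltr_pwDl// powR_ge0.
  exact: le_trans (fD_le z0).
have mg : measurable_fun (B : set T) g.
  have mp := continuous_measurable_fun (@continuous_posp R).
  apply: (measurableT_comp mp); apply: measurable_funB; last exact: measurable_funS mQ BQ mu_u.
  apply: measurable_funD => //; apply: continuous_on_measurable oB _ => z Bz.
  exact (C2_continuous C2 (BXi Bz)).
apply: (@fatou_bounded_below R _ T mu B (fun n => defect (h_ n))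
  (fun n => convolve Q (mollifier (h_ n)) (energy p Du)) (energy p Du) P k) => //.
- by rewrite addr_ge0// !mulr_ge0// ?addr_ge0// ?mulr_ge0 ?exprn_ge0// ?addr_ge0// ?ler0n// ?mulr_ge0// ltW.
- by move=> n; have [] := integral_defect_le0 (hn0 n) (hnr n) (hnu n).
- exact: (integrableS mQ mB BQ ie).
- exact: measurable_funM mg (measurable_funM mg (measurable_cst _)).
- by move=> z Bz; rewrite !mulr_ge0 ?posp_ge0 ?invr_ge0// ltW.
- by move=> z Bz; rewrite addr_ge0// powR_ge0.
- move=> n z Bz; have [h2 h3 h4] := hA z Bz.
  exact: (defect_ge (hn0 n) (hnr n) Bz h2 h3 h4).
- by move=> n; have [] := integral_defect_le0 (hn0 n) (hnr n) (hnu n).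
- exact: (GL1 (inr tt)).
- exact: (Gae (inr tt)).
have Gall := @filter_forall _ _ (fun j z => B z -> convolve Q (mollifier (h_ n)) (G j) z @[n --> \oo] --> G j z)
  _ FF Gae.
apply: filterS Gall => z Gz Bz.
have Qz := BQ Bz.
have gcvg : posp (phi z + m - convolve Q (mollifier (h_ n)) u z) @[n --> \oo] --> g z.
  apply: (@cvg_comp _ _ _ _ (@posp R) _ _ _ _ (@continuous_posp R _)).
  apply: cvgB; first exact: cvg_cst.
  exact: (Gz (inl (inr true)) Bz).
exists (2 * g z * (\sum_i (flux p (grad phi z) ord0 i - flux p (Du z) ord0 i)
    * ('D_(space_dir i) phi z - Du z ord0 i)) + g z ^+ 2 * (eps - f (grad phi z) + f (Du z))).
  apply: cvgD.
    apply: cvgM; first by apply: cvgM => //; exact: cvg_cst.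
    apply: cvg_big; first exact: add_continuous.
    move=> i _; apply: cvgM; (apply: cvgB; first exact: cvg_cst).
      exact: (Gz (inl (inl (inr i))) Bz).
    exact: (Gz (inl (inl (inl i))) Bz).
  apply: cvgM.
    by rewrite expr2; under eq_fun do rewrite expr2; exact: cvgM.
  apply: cvgD; first exact: cvg_cst.
  exact: (Gz (inl (inr false)) Bz).
have gm : 0 <= g z <= m.
  rewrite posp_ge0 /= /g ge_max (ltW m0) /=.
  by have := phi_le_u Qz; lra.
have := react (Du z) (gradM Qz) gm.
move/(ler_wpM2l (posp_ge0 (phi z + m - u z))); rewrite -/(g z) -/(P z) => /le_trans; apply.
rewrite le_eqVlt; apply/orP; left; apply/eqP.
rewrite (_ : edot _ _ = \sum_i (flux p (grad phi z) ord0 i - flux p (Du z) ord0 i)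
    * ('D_(space_dir i) phi z - Du z ord0 i)); first by ring.
by apply: eq_bigr => i _; rewrite -grad_coord !mxE.
Qed.

End comparison.

(** * From almost everywhere to pointwise statements *)

Section normalized_representative.
Context {R : realType} (N : nat).
Local Notation Z := ('rV[R]_N * R)%type.
Local Notation T := ('rV[R]_N * measurableTypeR R)%type.
Local Notation mu := (@lebesgue_st R N).
Implicit Types (z w : Z).

(** Nonempty open sets have positive measure. *)
Lemma ae_open_ex (W : set Z) (P : Z -> Prop) : open W -> W !=set0 ->
  {ae mu, forall z, P z} -> exists2 z, W z & P z.
Proof.
move=> oW W0 [A [mA A0 PA]]; apply: contrapT => noz.
have := lebesgue_st_open_gt0 oW W0; rewrite ltNge => /negP; apply.
rewrite -A0; apply: le_measure; rewrite ?inE//; first exact: open_measurable_st.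
move=> z Wz; apply: PA => Pz; apply: noz; by exists z.
Qed.

Lemma Linfty_ae_bounded (Xi : set Z) (u : Z -> R) : Linfty Xi u ->
  exists K : R, {ae mu, forall z, Xi z -> `|u z| <= K}.
Proof.
move=> [_]; rewrite unlock; case: ifPn => [_|]; last first.
  by move=> /negP[]; apply: lebesgue_st_open_gt0; [exact: (@openT Z)|exists 0].
have FF : Filter (almost_everywhere mu) := ae_filter_ringOfSetsType mu.
set s := ess_sup _ _ => soo.
have ae := ess_sup_ge mu (abse \o (EFin \o u) \_ Xi); rewrite -/s in ae.
exists (fine s); apply: filterS ae => z hz Xz; move: hz soo.
rewrite /= /patch mem_set//=; case: s => [s| |]//.
Qed.

(** The essential lower limit at each point inherits the almost everywhere bounds
    on both sides, the upper one because open sets are not null. *)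
Lemma normalized_bounded (Xi : set Z) (u : Z -> R) : open Xi -> Linfty Xi u ->
  (forall z, Xi z -> (u z)%:E = ess_liminf u z) ->
  exists K : R, forall z, Xi z -> `|u z| <= K.
Proof.
move=> oXi uL urep; have FF : Filter (almost_everywhere mu) := ae_filter_ringOfSetsType mu.
have [K aeK] := Linfty_ae_bounded uL.
exists K => z Xz; have nX : nbhs z Xi by exact: open_nbhs_nbhs.
rewrite ler_norml -!lee_fin (urep z Xz); apply/andP; split.
  apply: ereal_sup_ubound; exists Xi => //; apply: filterS aeK => w hw Xw.
  by rewrite lee_fin; move: (hw Xw); rewrite ler_norml => /andP[].
apply: ge_ereal_sup => a [V nV aeV].
have nW : nbhs z (V `&` Xi) by exact: filterI.
have [|||w wW [w1 w2]] := @ae_open_ex (V `&` Xi)° (fun w => (V w -> (a <= (u w)%:E)%E) /\ (Xi w -> `|u w| <= K)).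
- exact: open_interior.
- by exists z.
- exact: filterI aeV aeK.
have [Vw Xw] := interior_subset wW.
by rewrite (le_trans (w1 Vw))// lee_fin (le_trans (ler_norm _) (w2 Xw)).
Qed.

End normalized_representative.

(** The difference u - phi is lower semicontinuous and positive, so it has a
    positive lower bound near each point, uniform by compactness. *)
Lemma lsc_gap (R : realType) (N : nat) (Xi K : set ('rV[R]_N * R)) (u phi : 'rV[R]_N * R -> R) :
  open Xi -> lsc_on Xi u -> compact K -> K `<=` Xi ->
  (forall z, K z -> {for z, continuous phi}) -> (forall z, K z -> phi z < u z) ->
  exists2 m, 0 < m & forall z, K z -> phi z + m <= u z.
Proof.
move=> oXi ul cK KX cphi phiu.
pose P (d : R) (z : 'rV[R]_N * R) := phi z + d <= u z.
have H := (@compact_near_coveringP _ K).1 cK R (0^'+) P _.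
have {H}/H hP : forall z, K z -> \forall z' \near z & d \near 0^'+, P d z'.
  move=> z Kz; pose e := (u z - phi z) / 4.
  have e0 : 0 < e by rewrite divr_gt0// subr_gt0 phiu.
  have au : ((u z - e)%:E < (EFin \o u) z)%E by rewrite lte_fin gtrBl.
  have [V nV hV] := ul z _ au.
  have nV' : nbhs z V by rewrite (nbhs_subspace_interior (A := Xi))//; apply: open_nbhs_nbhs; split => //; exact: KX.
  have /cvgrPdist_lt /(_ _ e0) hphi := cphi z Kz.
  exists (V `&` [set y | `|phi z - phi y| < e], [set d | d < e]).
    by split; [exact: filterI|exact: nbhs_right_lt].
  move=> [y d] /= [[Vy]]; rewrite ltr_norml => /andP[h1 _] de.
  have := hV y Vy; rewrite lte_fin /P => h2.
  have : u z = phi z + 4 * e by rewrite /e mulrC divfK// addrC subrK.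
  by move: h1 h2 de e0; lra.
have : \forall d \near 0^'+, 0 < d /\ (forall z, K z -> P d z).
  near=> d; split; first by near: d; exact: nbhs_right_gt.
  by near: d; exact: hP.
by move=> /filter_ex [d [d0 hd]]; exists d.
Unshelve. all: by end_near. Qed.

(** A ball is the union of the segments from its centre. *)
Lemma connected_ball (R : realType) (V : normedModType R) (a : V) (r : R) :
  0 < r -> connected (ball a r).
Proof.
move=> r0.
have -> : ball a r = \bigcup_(x in ball a r) ((fun s : R => a + s *: (x - a)) @` `[0, 1]%classic).
  apply/seteqP; split => x.
    move=> xr; exists x => //; exists 1; first by rewrite /= in_itv /= ler01 lexx.
    by rewrite scale1r addrC subrK.
  move=> [y]; rewrite -!ball_normE /= => yr [s]; rewrite in_itv /= => /andP[s0 s1] <-.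
  rewrite opprD addrA subrr sub0r normrN normrZ ger0_norm// distrC.
  by rewrite (le_lt_trans _ yr)// ler_piMl.
apply: bigcup_connected.
  exists a => x _ /=; exists 0; first by rewrite /= in_itv /= ler01 lexx.
  by rewrite scale0r addr0.
move=> x _; apply: connected_continuous_connected; first exact: segment_connected.
apply: continuous_subspaceT => s; apply: cvgD; first exact: cvg_cst.
by apply: cvgZr_tmp; exact: cvg_id.
Qed.

Lemma limf_esup_lt0 (R : realType) (X : topologicalType) (f : X -> R) (F : set_system X) :
  (limf_esup (EFin \o f) F < 0)%E ->
  exists2 eps, 0 < eps & exists2 V, F V & forall x, V x -> f x <= - eps.
Proof.
rewrite limf_esupE => /ereal_inf_lt [_ [V FV <-]] sV.
have le x : V x -> ((f x)%:E <= ereal_sup [set (EFin \o f) x | x in V])%E.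
  by move=> Vx; apply: ereal_sup_ubound; exists x.
move: le sV; case: (ereal_sup _) => [s| |]// le s0.
- exists (- s); first by rewrite oppr_gt0 -lte_fin.
  by exists V => // x Vx; rewrite opprK -lee_fin; exact: le.
- by exists 1 => //; exists V => // x Vx; have := le x Vx; rewrite leeNy_eq.
Qed.

(** * Weak supersolutions are viscosity supersolutions *)

Theorem theorem3p5 (R : realType) (N : nat) (N_gt0 : (0 < N)%N)
    (p : R) (p_gt1 : 1 < p)
    (f : 'rV[R]_N -> R) (f_cont : continuous f)
    (Cf beta : R) (Cf_gt0 : 0 < Cf) (beta_ge1 : 1 <= beta) (beta_ltp : beta < p)
    (f_growth : forall xi, `|f xi| <= Cf * (1 + enorm xi `^ beta))
    (Xi : set ('rV[R]_N * R)) (Xi_dom : bounded_domain Xi)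
    (u : 'rV[R]_N * R -> R) (u_Linfty : Linfty Xi u)
    (u_lsc : lsc_on Xi u)
    (u_rep : forall z, Xi z -> (u z)%:E = ess_liminf u z)
    (u_weak : weak_supersolution p f Xi u) :
  viscosity_supersolution p f Xi u.
Proof.
have [oXi _ _ _] := Xi_dom.
have [K uK] := normalized_bounded oXi u_Linfty u_rep.
split => //.
  exists K; split; first exact: num_real.
  by move=> y Ky z /uK uz; exact: le_trans uz (ltW Ky).
move=> phi x0 t0 C2 Xz0 phiz0 phi_lt grad0.
rewrite leNgt; apply/negP => /limf_esup_lt0 [eps eps0 [V FV subV]].
pose z0 : 'rV[R]_N * R := (x0, t0).
have : nbhs z0 (Xi `&` [set z | z.1 <> x0 -> V z]).
  by apply: filterI; [exact: open_nbhs_nbhs|exact: FV].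
move=> /nbhs_ballP[e /= e0 he].
pose r := e / 2.
have r0 : 0 < r by rewrite divr_gt0.
have sub s : s < e -> [set w | `|w - z0| <= s] `<=` ball z0 e.
  by move=> se w /= ws; rewrite -ball_normE /= distrC (le_lt_trans ws).
have re : r < e by rewrite /r ltr_pdivrMr// ltr_pMr// ltr1n.
have QE w : ball z0 r w = (`|w - z0| < r) :> Prop by rewrite -ball_normE /= distrC.
have Qe : ball z0 r `<=` ball z0 e by move=> w; rewrite QE => /ltW; exact: sub.
have QXi : ball z0 r `<=` Xi by move=> w /Qe /he[].
(* The radius e / 2 leaves room for the closure of the ball in the neighbourhood. *)
have cQ : closure (ball z0 r) `<=` [set w | `|w - z0| <= r].
  rewrite closureE; apply: smallest_sub; first exact: closed_norm_sub_le.
  by move=> w; rewrite QE => /ltW.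
have bdom : bounded_domain (ball x0 r).
  split; [exact: ball_open|exact: connected_ball|by exists x0; exact: ballxx|].
  exists (`|x0| + r); split; first exact: num_real.
  move=> y hy x; rewrite -ball_normE /= distrC => xr.
  rewrite (le_trans _ (ltW hy))// -(subrK x0 x) addrC (le_trans (ler_normD _ _))// lerD2l.
  exact: ltW.
have tt : t0 - r < t0 + r by move: r0; lra.
have cpQ : compact (closure (ball z0 r)).
  apply: (subclosed_compact _ (@compact_norm_sub_le R N z0 r)) => //; exact: closed_closure.
have cXi : closure (ball z0 r) `<=` Xi by move=> w /cQ /(sub _ re) /he[].
have := u_weak (ball x0 r) (t0 - r) (t0 + r) bdom tt.
rewrite /parabolic_sobolev /= cylinder_ball => /(_ cpQ cXi) [Du [mu_u mDu slices fin] weak].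
have mQ := measurable_ball_st z0 r.
have bQ : bounded_set (ball z0 r).
  exists (`|z0| + r); split; first exact: num_real.
  move=> y hy w; rewrite QE => wr /=.
  rewrite (le_trans _ (ltW hy))// -(subrK z0 w) addrC (le_trans (ler_normD _ _))// lerD2l.
  exact: ltW.
have ie := integrable_energy mQ bQ mu_u mDu fin.
have iDu := integrable_Du p_gt1 mQ bQ mu_u mDu fin.
have iflux := integrable_flux p_gt1 mQ bQ mu_u mDu fin.
have [ifD fD_le] := integrable_reaction mQ bQ mu_u mDu fin f_cont (ltW Cf_gt0) beta_ge1 beta_ltp f_growth.
have cgrad z : [set w | `|w - z0| <= r] z -> {for z, continuous (fun z => enorm (grad phi z))}.
  by move=> zr; apply: (continuous_enorm_grad C2); have [] := he _ (sub _ re _ zr).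
have [M hM] := compact_bounded_on (@compact_norm_sub_le R N z0 r) cgrad.
have [m1 m10 react] := flux_reaction p_gt1 M f_cont beta_ge1 beta_ltp f_growth eps0.
pose S := [set w | r / 8 <= `|w - z0| <= r * (3 / 4)].
have Sr : S `<=` [set w | `|w - z0| <= r].
  by move=> w /= /andP[_ wr]; rewrite (le_trans wr)//; move: r0; lra.
have cS : compact S.
  apply: (subclosed_compact _ (@compact_norm_sub_le R N z0 r)) => //.
  rewrite (_ : S = [set w | r / 8 <= `|w - z0|] `&` [set w | `|w - z0| <= r * (3 / 4)]).
    apply: closedI; last exact: closed_norm_sub_le.
    rewrite (_ : [set w | r / 8 <= _] = (fun w => `|w - z0|) @^-1` [set x | r / 8 <= x])//.
    apply: closed_comp; last exact: closed_ge.
    by move=> w _; apply: cvg_norm; apply: cvgB; [exact: cvg_id|exact: cvg_cst].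
  by apply/seteqP; split => w; rewrite /S /=; [move/andP|move=> h; apply/andP].
have SXi : S `<=` Xi by move=> w /Sr /(sub _ re) /he[].
have [|w Sw|m2 m20 shell] := lsc_gap oXi u_lsc cS SXi (phi := phi).
- by move=> w /SXi Xw; exact (C2_continuous C2 Xw).
- apply: phi_lt; first exact: SXi.
  by move=> wz; move: Sw; rewrite /S wz /= subrr normr0 => /andP[]; move: r0; lra.
(* Small enough for the reaction inequality, and half the gap on the shell. *)
pose m := Num.min m1 (m2 / 2).
have m0 : 0 < m by rewrite lt_min m10 divr_gt0.
have ae : {ae (@lebesgue_st R N), forall z, ball z0 (r / 2) z -> phi z + m <= u z}.
  apply: (@comparison R N p p_gt1 Xi phi u Du f oXi C2 f_cont (Ordinal N_gt0) x0 t0 r r0 QXi K (2 * Cf)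
    mu_u (fun z Qz => uK z (QXi z Qz)) iDu iflux ifD ie fD_le slices weak eps m M eps0 m0).
  - by move=> z /QXi Xz zx; apply/eqP; exact: grad0.
  - by move=> z /Qe /he[_ hz] zx; apply: subV; exact: hz.
  - move=> z /QXi Xz; have [->|/eqP zz] := eqVneq z z0; first by rewrite phiz0.
    by apply: ltW; exact: phi_lt.
  - move=> z Sz; apply: le_trans (shell z Sz); rewrite lerD2l.
    by rewrite mulrC -ler_pdivlMr// ge_min lexx orbT.
  - by move=> z; rewrite QE => /ltW zr; apply: le_trans (ler_norm _) (hM z zr).
  - move=> v1 v2 g v1M /andP[g0 gm]; apply: react => //.
    by rewrite g0 (le_trans gm)// ge_min lexx.
(* Half of m is given up to the continuity of phi at z0. *)
suff : ((phi z0 + m / 2)%:E <= (u z0)%:E)%E.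
  by rewrite lee_fin -phiz0 gerDl leNgt divr_gt0.
rewrite u_rep//; apply: ereal_sup_ubound.
have m20' : 0 < m / 2 by rewrite divr_gt0.
have /cvgrPdist_lt /(_ _ m20') phi_near := C2_continuous C2 Xz0.
exists (ball z0 (r / 2) `&` [set w | `|phi z0 - phi w| < m / 2]).
  by apply: filterI => //; apply: nbhsx_ballx; rewrite divr_gt0.
have FF : Filter (almost_everywhere (@lebesgue_st R N)) := ae_filter_ringOfSetsType _.
apply: filterS ae => w hw [/hw wu /=]; rewrite ltr_norml => /andP[_ h].
by rewrite lee_fin (le_trans _ wu)//; move: h; lra.
Qed.
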